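(* If $m\ge2$, then every contact diffeomorphism $\mathtt{J}^m(G;W)\to\mathtt{J}^m(G;W)$ is the prolongation of a contact diffeomorphism $\mathtt{J}^1(G;W)\to\mathtt{J}^1(G;W)$. Moreover, suppose that one of the following conditions is satisfied: (A) $\dim(W)>1$, or (B) for every $v\in V_1\setminus\{0\}$ there is $v'\in V_1$ with $[v,v']\neq0$. Then every contact diffeomorphism $\mathtt{J}^1(G;W)\to\mathtt{J}^1(G;W)$ is the prolongation of a contact diffeomorphism $\mathtt{J}^0(G;W)\to\mathtt{J}^0(G;W)$.
   Context: $G$ is a stratified (Carnot) group of step $s\ge1$: a connected, simply connected Lie group with Lie algebra $\mathfrak g=V_1\oplus\dots\oplus V_s$, $V_s\neq\{0\}$, $[V_1,V_j]=V_{j+1}$ for $1\le j<s$, $[V_i,V_j]=0$ for $i+j>s$. $W$ is a finite-dimensional real vector space. For $v\in\mathfrak g$, $\tilde v$ is the left-invariant vector field on $G$ with $\tilde v(e)=v$. For $f\in C^\infty(G;W)$, $k\ge 0$ and $p\in G$, $A^k_{f,p}$ is the $k$-multilinear map $V_1^k\to W$, $A^k_{f,p}(v_1,\dots,v_k)=\tilde v_k\cdots\tilde v_1f(p)$ (with $A^0_{f,p}=f(p)$). $\mathtt{HD}^k(\mathfrak g;W)$ is the vector space of all such $k$-multilinear maps, $\mathtt{HD}^0(\mathfrak g;W)=W$, and $\mathtt{HD}^{\le m}(\mathfrak g;W)=\bigoplus_{k=0}^m\mathtt{HD}^k(\mathfrak g;W)$; the $k$-th component of $A\in \mathtt{HD}^{\le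 m}$ is denoted $A^k$. Right contraction: for $v\in V_1$ and $A\in\mathtt{HD}^k(\mathfrak g;W)$, $k\ge1$, $v\lrcorner A\in\mathtt{HD}^{k-1}(\mathfrak g;W)$ is $(v\lrcorner A)(v_1,\dots,v_{k-1})=A(v_1,\dots,v_{k-1},v)$. Jet space: $\mathtt{J}^m(G;W)=G\times\mathtt{HD}^{\le m}(\mathfrak g;W)$, with $T_{(a,A)}\mathtt{J}^m(G;W)=T_aG\times\mathtt{HD}^{\le m}(\mathfrak g;W)$. Its Cartan distribution $\mathscr H^m$ is \[ \mathscr H^m_{(a,A)}=\{(\tilde v(a),B): v\in V_1,\ B\in\mathtt{HD}^{\le m}(\mathfrak g;W),\ B^\ell=v\lrcorner A^{\ell+1}\ \text{for } 0\le\ell\le m-1\}. \] A contact diffeomorphism of $\mathtt{J}^m(G;W)$ is a smooth diffeomorphism $F$ of $\mathtt{J}^m(G;W)$ onto itself with $dF(\mathscr H^m)\subset\mathscr H^m$. $\pi_k:\mathtt{J}^{k+1}(G;W)\to\mathtt{J}^k(G;W)$ is the projection along $\mathtt{HD}^{k+1}(\mathfrak g;W)$. A contact map $\hat F$ of $\mathtt{J}^{k+1}(G;W)$ is a prolongation of a contact map $F$ of $\mathtt{J}^k(G;W)$ if $\pi_k\circ\hat F=F\circ\pi_k$. For $m\ge2$, a contact diffeomorphism $F$ of $\mathtt{J}^m(G;W)$ is the prolongation of a contact diffeomorphism $F_1$ of $\mathtt{J}^1(G;W)$ if there are contact diffeomorphisms $F_j$ of $\mathtt{J}^j(G;W)$,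 $1\le j\le m$, starting with $F_1$ and with $F_m=F$, such that $\pi_j\circ F_{j+1}=F_j\circ\pi_j$ for $1\le j<m$. *)

(* Defs.v *)
From HB Require Import structures.
From mathcomp Require Import all_boot all_order all_algebra.
From mathcomp Require Import all_classical all_reals all_analysis.

Set Implicit Arguments.
Unset Strict Implicit.
Unset Printing Implicit Defensive.

Import Order.TTheory GRing.Theory Num.Theory.
Import numFieldNormedType.Exports.

Local Open Scope classical_set_scope.
Local Open Scope ring_scope.

Section LinearSpan.
Variables (K : fieldType) (V : vectType K).

(* The linear span of an arbitrary (possibly infinite) set of vectors, i.e. the
   smallest subspace containing it; see [vspanP]. *)
Definition vspan (S : set V) : {vspace V} :=
  xget fullv [set U : {vspace V} | S `<=` [set` U] /\
    forall U' : {vspace V}, S `<=` [set` U'] -> (U <= U')%VS].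

Lemma vspanP (S : set V) : S `<=` [set` vspan S] /\
  forall U : {vspace V}, S `<=` [set` U] -> (vspan S <= U)%VS.
Proof.
pose P d := `[< exists2 U : {vspace V}, \dim U = d & S `<=` [set` U] >].
have exP : exists d, P d.
  exists (\dim (fullv : {vspace V})); apply/asboolP.
  by exists fullv => // x _; rewrite /= memvf.
case: (ex_minnP exP) => d /asboolP[U dimU SU] minU.
rewrite /vspan; case: xgetP => [U1 _ //|noU]; exfalso; apply: (noU U); split => //.
move=> U' SU'; apply/capv_idPl/eqP.
rewrite -(geq_leqif (dimv_leqif_eq (capvSl U U'))) dimU.
apply: minU; apply/asboolP; exists (U :&: U')%VS => // x Sx.
by rewrite /= memv_cap; apply/andP; split; [exact: SU|exact: SU'].
Qed.

End LinearSpan.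

Section SmoothMaps.
Variable R : realType.

Fixpoint Ck (k n q : nat) (U : set 'rV[R]_n) (f : 'rV[R]_n -> 'rV[R]_q) : Prop :=
  (forall x, U x -> {for x, continuous f}) /\
  if k is k'.+1 then
    (forall x, U x -> differentiable f x) /\
    (forall v, Ck k' U (fun x => 'd f x v))
  else True.

Definition smooth_on (n q : nat) (U : set 'rV[R]_n) (f : 'rV[R]_n -> 'rV[R]_q) :=
  forall k, Ck k U f.

(* Raw data of a chart of X with values in R^n; [cinv] is only meaningful on
   the image [cim c] of the domain. *)
Record chart (X : Type) (n : nat) := Chart {
  cdom : set X;
  cmap : X -> 'rV[R]_n;
  cinv : 'rV[R]_n -> X }.

Definition cim X n (c : chart X n) : set 'rV[R]_n := cmap c @` cdom c.

Definition is_chart X n (c : chart X n) : Prop :=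
  (forall x, cdom c x -> cinv c (cmap c x) = x) /\ open (cim c).

Definition prod_chart X Y n q (c : chart X n) (d : chart Y q) :
    chart (X * Y) (n + q) :=
  Chart (cdom c `*` cdom d)
        (fun z => row_mx (cmap c z.1) (cmap d z.2))
        (fun r => (cinv c (lsubmx r), cinv d (rsubmx r))).

Definition vcoord (V : vectType R) : V -> 'rV[R]_(\dim {:V}) :=
  passmx.rVof (vbasis {:V}).

Definition vpoint (V : vectType R) : 'rV[R]_(\dim {:V}) -> V :=
  passmx.vecof (vbasis {:V}).

Definition vect_chart (V : vectType R) : chart V (\dim {:V}) :=
  Chart setT (@vcoord V) (@vpoint V).

Definition smooth_map X Y n q (A : set (chart X n)) (B : set (chart Y q))
    (f : X -> Y) : Prop :=
  forall c d, A c -> B d ->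
    let D := [set r | cim c r /\ cdom d (f (cinv c r))] in
    open D /\ smooth_on D (cmap d \o f \o cinv c).

Definition tangent_map X Y n q (c : chart X n) (d : chart Y q) (f : X -> Y)
    (x : X) : 'rV[R]_n -> 'rV[R]_q :=
  'd (cmap d \o f \o cinv c) (cmap c x).

(* Compatibility of the charts of an atlas amounts to the smoothness of the
   identity in all pairs of charts. *)
Record is_manifold (X : topologicalType) n (A : set (chart X n)) : Prop := {
  manifold_hausdorff : hausdorff_space X;
  manifold_second_countable : @second_countable X;
  manifold_chart : forall c, A c -> is_chart c;
  manifold_cover : forall x, exists c, A c /\ cdom c x;
  manifold_compatible : smooth_map A A id;
  manifold_open : forall U : set X, open U <->
    forall c, A c -> open [set r | cim c r /\ U (cinv c r)] }.

Definition prod_atlas X Y n q (A : set (chart X n)) (B : set (chart Y q)) :=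
  [set prod_chart c d | c in A & d in B].

Record lieGroup := LieGroup {
  lie_sort :> topologicalType;
  lie_dim : nat;
  lie_atlas : set (chart lie_sort lie_dim);
  lie_manifold : is_manifold lie_atlas;
  lie_mul : lie_sort -> lie_sort -> lie_sort;
  lie_one : lie_sort;
  lie_inv : lie_sort -> lie_sort;
  lie_mulA : associative lie_mul;
  lie_mul1 : left_id lie_one lie_mul;
  lie_mulV : left_inverse lie_one lie_inv lie_mul;
  lie_mul_smooth :
    smooth_map (prod_atlas lie_atlas lie_atlas) lie_atlas
      (fun z => lie_mul z.1 z.2);
  lie_inv_smooth : smooth_map lie_atlas lie_atlas lie_inv }.

(* Every loop is null-homotopic relative to its base point. *)
Definition simply_connected (X : topologicalType) : Prop :=
  forall g : R -> X, {within `[0, 1]%classic, continuous g} -> g 0 = g 1 ->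
  exists H : R * R -> X,
    {within `[0, 1]%classic `*` `[0, 1]%classic, continuous H} /\
    forall t, t \in `[0, 1] ->
      [/\ H (0, t) = g t, H (1, t) = g 0, H (t, 0) = g 0 & H (t, 1) = g 0].

End SmoothMaps.

Arguments lie_dim [R] l.
Arguments lie_atlas [R] l.
Arguments lie_one [R] l.

Section LieAlgebra.
Variables (R : realType) (G : lieGroup R).

Definition chart1 : chart R G (lie_dim G) :=
  projT1 (cid (manifold_cover (lie_manifold G) (lie_one G))).

(* The Lie algebra is T_eG, in the coordinates given by [chart1]. *)
Definition lie_alg : vectType R := 'rV[R]_(lie_dim G).

(* The value at p, in the coordinates of c, of the left-invariant vector field
   with value v at the identity. *)
Definition linv_field (c : chart R G (lie_dim G)) (v : lie_alg) (p : G) :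
    'rV[R]_(lie_dim G) :=
  tangent_map chart1 c (lie_mul p) (lie_one G) v.

(* The derivative of f at p along that vector field: d(f o L_p)_e (v). *)
Definition lie_deriv (V : vectType R) (v : lie_alg) (f : G -> V) (p : G) : V :=
  vpoint (tangent_map chart1 (vect_chart V) (f \o lie_mul p) (lie_one G) v).

(* The coordinates at the identity of the commutator of the two left-invariant
   vector fields, obtained by applying it to the coordinate functions. *)
Definition lie_bracket (v w : lie_alg) : lie_alg :=
  lie_deriv v (lie_deriv w (cmap chart1 : G -> lie_alg)) (lie_one G) -
  lie_deriv w (lie_deriv v (cmap chart1 : G -> lie_alg)) (lie_one G).

Definition bracket_space (U U' : {vspace lie_alg}) : {vspace lie_alg} :=
  vspan [set lie_bracket u u' | u in [set` U] & u' in [set` U']].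

(* Only V 1, ..., V s are relevant. *)
Record stratification (s : nat) (V : nat -> {vspace lie_alg}) : Prop := {
  strat_step : (1 <= s)%N;
  strat_sum : (\sum_(i < s) V i.+1)%VS = fullv;
  strat_direct : directv (\sum_(i < s) V i.+1);
  strat_last : V s != 0%VS;
  strat_gen : forall j, (1 <= j < s)%N -> bracket_space (V 1%N) (V j) = V j.+1;
  strat_nil : forall i j, (1 <= i <= s)%N -> (1 <= j <= s)%N -> (s < i + j)%N ->
    bracket_space (V i) (V j) = 0%VS }.

Definition carnot_group s V : Prop :=
  [/\ connected [set: G], simply_connected R G & stratification s V].

End LieAlgebra.

Section Jets.
Variables (R : realType) (G : lieGroup R) (V1 : {vspace lie_alg G}).
Variable W : vectType R.

(* k-multilinear maps V1^k -> W, curried with the LAST argument first, so that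
   (v1, ..., vk) |-> A(v1, ..., vk) is A vk ... v1 and right contraction by v
   is the application to v. *)
Fixpoint multilin (k : nat) : vectType R :=
  if k is k'.+1 then 'Hom(subvs_of V1, multilin k') else W.

Definition contract (k : nat) (v : subvs_of V1) (A : multilin k.+1) :
  multilin k := (A : 'Hom(subvs_of V1, multilin k)) v.

(* [hderiv f k p] is A^k_{f,p}: (v1, ..., vk) |-> ~vk ... ~v1 f (p). The map
   under [linfun] is linear in v when f is smooth. *)
Fixpoint hderiv (f : G -> W) (k : nat) : G -> multilin k :=
  if k is k'.+1 then
    fun p => linfun (fun v : subvs_of V1 => lie_deriv (vsval v) (hderiv f k') p)
  else f.

(* The maps A^k_{f,p} already form a linear subspace, by linearity in f and
   left-invariance, so taking the span only makes it a [vspace]. *)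
Definition HDspace (k : nat) : {vspace multilin k} :=
  vspan [set A | exists (f : G -> W) (p : G),
    smooth_map (lie_atlas G) [set vect_chart W] f /\ A = hderiv f k p].

Definition HD (k : nat) : vectType R := subvs_of (HDspace k).

Definition HDle (m : nat) : Type := forall k : 'I_m.+1, HD k.

Definition HDle_dim (m : nat) : nat := (\sum_(k < m.+1) \dim {:HD k})%N.

Definition HDle_chart (m : nat) : chart R (HDle m) (HDle_dim m) :=
  Chart setT
        (fun A => \mxrow_(k < m.+1) vcoord (A k))
        (fun r k => vpoint (submxrow r k)).

Definition jet (m : nat) : Type := (G * HDle m)%type.

Definition jet_chart (m : nat) (c : chart R G (lie_dim G)) :=
  prod_chart c (HDle_chart m).

Definition jet_atlas (m : nat) := [set jet_chart m c | c in lie_atlas G].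
Arguments jet_atlas : clear implicits.

Definition jet_proj (m : nat) (x : jet m.+1) : jet m :=
  (x.1, fun k => x.2 (widen_ord (leqnSn m.+1) k)).

(* The Cartan distribution at x, in the coordinates of [jet_chart m c]. *)
Definition cartan (m : nat) (c : chart R G (lie_dim G)) (x : jet m) :
    set 'rV[R]_(lie_dim G + HDle_dim m) :=
  [set u | exists (v : subvs_of V1) (B : HDle m),
    (forall l : 'I_m,
      vsval (B (widen_ord (leqnSn m) l)) =
      contract v (vsval (x.2 (lift ord0 l)))) /\
    u = row_mx (linv_field c (vsval v) x.1) (cmap (HDle_chart m) B)].

Definition contact (m : nat) (F : jet m -> jet m) : Prop :=
  forall (x : jet m) (c d : chart R G (lie_dim G)),
    lie_atlas G c -> lie_atlas G d -> cdom c x.1 -> cdom d (F x).1 ->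
    tangent_map (jet_chart m c) (jet_chart m d) F x @` cartan c x
      `<=` cartan d (F x).

Definition contact_diffeo (m : nat) (F : jet m -> jet m) : Prop :=
  [/\ smooth_map (jet_atlas m) (jet_atlas m) F,
      exists F' : jet m -> jet m,
        [/\ cancel F F', cancel F' F &
            smooth_map (jet_atlas m) (jet_atlas m) F']
    & contact F].

Definition prolongs (k : nat) (F : jet k -> jet k) (F' : jet k.+1 -> jet k.+1) :=
  @jet_proj k \o F' = F \o @jet_proj k.

Definition iterated_prolongation (m : nat) (F1 : jet 1 -> jet 1)
    (F : jet m -> jet m) : Prop :=
  exists Fs : forall j, jet j -> jet j,
    [/\ forall j, (1 <= j <= m)%N -> contact_diffeo (Fs j),
        Fs 1%N = F1, Fs m = F &
        forall j, (1 <= j < m)%N -> prolongs (Fs j) (Fs j.+1)].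

End Jets.

(* Main.v *)
Require Import Defs.
From HB Require Import structures.
From mathcomp Require Import all_boot all_order all_algebra.
From mathcomp Require Import all_classical all_reals all_analysis.
From mathcomp Require Import ring lra.

(* Call vertical the directions of J^(m+1) that move only the top component.
   The bracket of a vertical field C with the horizontal field in the direction
   of w in V_1 is the contraction of C by w, placed at level m; it vanishes when
   that contraction does. Pushing such brackets through a contact diffeomorphism
   F, and using that the sum of V_1 and V_2 is direct, yields algebraic
   constraints on the linear map induced by dF on V_1 x HD^(m+1). If m >= 1 and dim V_1 >= 2, a
   dimension count (dim HD^m >= dim V_1, dim HD^(m+1) > dim V_1) forces the V_1
   part of dF(C) to vanish. If dim V_1 = 1, F also preserves the next larger
   distribution, in which the vertical ones are recognised. If m = 0, testing
   against rank one elements of HD^1 leads to the same conclusion under (A) or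
   (B). Once the vertical directions are preserved, the projection of F to J^m
   does not depend on the top component, hence defines a map F_0 of J^m; it is
   contact because contraction HD^(m+1) -> HD^m by a nonzero vector of V_1 is
   onto, so every horizontal vector of J^m lifts. *)

Set Implicit Arguments.
Unset Strict Implicit.
Unset Printing Implicit Defensive.

Import Order.TTheory GRing.Theory Num.Theory.
Import numFieldNormedType.Exports.

Local Open Scope classical_set_scope.
Local Open Scope ring_scope.

(** * Smooth functions of several real variables *)

(** No field is pushed forward and no flow is integrated. In jet coordinates a vertical C is a
    constant field; symmetry of second derivatives, applied to target coordinates composed with F,
    turns its bracket with a horizontal field U into a relation between values of dF. Contactness
    writes the derivatives along C and U with coefficients the V_1 parts of the images. The
    derivatives of these coefficients are unknown, but they enter the base and every level through
    one and the same element of V_1; when [C, U] = 0, directness of V_1 + V_2 makes it vanish.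

    HD^k is only the span of the derivatives of actual functions, not the space of all multilinear
    maps. That contraction is onto is therefore an analytic fact, proved with compactly supported
    functions and a maximum principle.

    When dim V_1 = 1, contraction by a nonzero vector is bijective, so all HD^k have the same
    dimension and the count gives nothing; hence the separate argument.

    Only F is assumed contact. Its inverse is contact because dF is injective between Cartan spaces
    of equal finite dimension; this is needed since the inverse must descend too. *)

Section Calculus.
Variable R : realType.

(** The differential ['d] is picked by choice, so the equality goes through uniqueness of the first
    order expansion, which only sees values near [x]. *)
Lemma near_eq_diff (V U : normedModType R) (f g : V -> U) x :
  {near x, f =1 g} -> differentiable f x ->
  differentiable g x /\ 'd g x = 'd f x :> (V -> U).
Proof.
move=> fg df.
have fgx : f x = g x by exact: (nbhs_singleton fg).
have E : g \o shift x = cst (g x) + 'd f x +o_0 id.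
  apply/eqaddoP => e e0.
  have /diff_locallyP[_ /eqaddoP/(_ e e0) H] := df.
  have fg0 : \forall h \near (0 : V), f (h + x) = g (h + x).
    move: fg; rewrite (near_shift 0 x) subr0 /= => fg'.
    exact: fg'.
  by apply: filterS2 fg0 H => h fgh; rewrite !fctE /= -fgx fgh.
have dgf := diff_unique (diff_continuous df) E.
by split => //; apply/diff_locallyP; rewrite dgf; split => //; exact: diff_continuous.
Qed.

Lemma differentiable_row (V : normedModType R) n (f : V -> 'rV[R]_n) x :
  (forall j, differentiable (fun y => f y 0 j : R) x) -> differentiable f x.
Proof.
move=> fj.
have -> : f = \sum_(j < n) (fun y => (f y 0 j : R) *: ('e_j : 'rV[R]_n)).
  by apply/funext => y; rewrite fct_sumE {1}(row_sum_delta (f y)).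
by apply: differentiable_sum => j; exact: differentiableZl.
Qed.

Lemma differentiable_lin n (U : normedModType R) (L : {linear 'rV[R]_n -> U}) x :
  differentiable L x.
Proof.
have -> : L = (\sum_(j < n) (fun y : 'rV[R]_n => (y 0 j : R) *: L 'e_j)) :> (_ -> _).
  apply/funext => y; rewrite fct_sumE {1}(row_sum_delta y) linear_sum.
  by apply: eq_bigr => j _; rewrite linearZ.
by apply: differentiable_sum => j; apply: differentiableZl; exact: differentiable_coord.
Qed.

Lemma continuous_lin n (U : normedModType R) (L : {linear 'rV[R]_n -> U}) :
  continuous L.
Proof. by move=> x; apply: differentiable_continuous; exact: differentiable_lin. Qed.

Lemma diff_linear n (U : normedModType R) (L : {linear 'rV[R]_n -> U}) x :
  'd L x = L :> ('rV[R]_n -> U).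
Proof. by rewrite diff_lin //; exact: continuous_lin. Qed.

Lemma diff_lin_comp (V : normedModType R) n (U : normedModType R)
    (L : {linear 'rV[R]_n -> U}) (f : V -> 'rV[R]_n) x v :
  differentiable f x -> 'd (L \o f) x v = L ('d f x v).
Proof.
by move=> df; rewrite (diff_comp df (differentiable_lin _ _)) /= diff_linear.
Qed.

Definition mxcoord m n (i : 'I_m) (j : 'I_n) (M : 'M[R]_(m, n)) : R^o := M i j.

Lemma mxcoord_is_linear m n (i : 'I_m) (j : 'I_n) : linear (mxcoord i j).
Proof. by move=> a u v; rewrite /mxcoord !mxE. Qed.

HB.instance Definition _ m n i j := GRing.isLinear.Build R 'M[R]_(m, n) R^o _
  (mxcoord i j) (@mxcoord_is_linear m n i j).

Lemma diff_coord (V : normedModType R) n (f : V -> 'rV[R]_n) x j v :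
  differentiable f x -> 'd (fun y => f y 0 j : R) x v = 'd f x v 0 j.
Proof.
move=> df.
exact: (@diff_lin_comp V n R^o (mxcoord 0 j) f x v df).
Qed.

Section Cdiff.
Variable V : normedModType R.
Implicit Types (f g : V -> R) (x v : V).

(** Pointwise counterpart of [Ck]: differentiability is asked in a neighbourhood, so that the class
    depends only on the germ at [x] and differentials can be taken again. *)
Fixpoint Cdiff k g x : Prop :=
  if k is k'.+1 then
    (\forall y \near x, differentiable g y) /\
    forall v, Cdiff k' (fun y => 'd g y v) x
  else True.

Definition smooth_at g x := forall k, Cdiff k g x.

Lemma CdiffS k g x : Cdiff k.+1 g x -> Cdiff k g x.
Proof.
elim: k g => [//|k IH] g /= [dg Hg]; split => // v.
by apply: IH; exact: Hg.
Qed.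

Lemma near_eq_Cdiff k f g x : {near x, f =1 g} -> Cdiff k f x -> Cdiff k g x.
Proof.
elim: k f g => [//|k IH] f g fg /= [df Hf].
have fg2 := near_join fg.
split.
  near=> y.
  by apply: (near_eq_diff (near fg2 y _) (near df y _)).1.
move=> v; apply: (IH (fun y => 'd f y v)) => //; near=> y.
by rewrite (near_eq_diff (near fg2 y _) (near df y _)).2.
Unshelve. all: by end_near. Qed.

Lemma Cdiff_cst k (a : R) x : Cdiff k (cst a : V -> R) x.
Proof.
elim: k a => [//|k IH] a /=; split; first by near=> y; exact: differentiable_cst.
move=> v; apply: near_eq_Cdiff (IH 0); near=> y; by rewrite diff_cst.
Unshelve. all: by end_near. Qed.

Lemma CdiffD k f g x : Cdiff k f x -> Cdiff k g x ->
  Cdiff k (fun y => f y + g y) x.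
Proof.
elim: k f g => [//|k IH] f g /= [df Hf] [dg Hg]; split.
  by near=> y; apply: differentiableD; [exact: (near df)|exact: (near dg)].
move=> v; apply: near_eq_Cdiff (IH _ _ (Hf v) (Hg v)); near=> y.
by rewrite -[fun _ => _]/(f + g) diffD //; [exact: (near df)|exact: (near dg)].
Unshelve. all: by end_near. Qed.

Lemma CdiffM k f g x : Cdiff k f x -> Cdiff k g x ->
  Cdiff k (fun y => f y * g y) x.
Proof.
elim: k f g => [//|k IH] f g Hf Hg.
have [/CdiffS Hf' /CdiffS Hg'] := (Hf, Hg).
case: Hf Hg => df Hf [dg Hg]; split.
  by near=> y; apply: differentiableM; [exact: (near df)|exact: (near dg)].
move=> v; apply: near_eq_Cdiff (CdiffD (IH _ _ Hf' (Hg v)) (IH _ _ Hg' (Hf v))).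
near=> y.
by rewrite -[fun _ => _]/(f * g) diffM //; [exact: (near df)|exact: (near dg)].
Unshelve. all: by end_near. Qed.

(** The derivative -f^-2 df involves 1/f only at the lower order, where the induction hypothesis
    applies. *)
Lemma CdiffV k f x : f x != 0 -> Cdiff k f x -> Cdiff k (fun y => (f y)^-1) x.
Proof.
move=> fx0; elim: k => [//|k IH] Hf.
have IH' := IH (CdiffS Hf).
case: Hf => df Hf.
have cf : {for x, continuous f}.
  exact: differentiable_continuous (nbhs_singleton df).
have fn0 : \forall y \near x, f y != 0.
  exact: (cvgr_neq0 (f x)).
split.
  by near=> y; apply: differentiableV; [exact: (near df)|exact: (near fn0)].
move=> v; have := CdiffM (Cdiff_cst k (-1) x) (CdiffM (CdiffM IH' IH') (Hf v)).
apply: near_eq_Cdiff; near=> y.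
rewrite diffV; [|exact: (near df)|exact: (near fn0)].
by rewrite /cst -invfM -expr2 mulN1r -mulNr.
Unshelve. all: by end_near. Qed.

Lemma smooth_atP g x : smooth_at g x <->
  (\forall y \near x, differentiable g y) /\ forall v, smooth_at (fun y => 'd g y v) x.
Proof.
split=> [sg|[dg sg] [//|k]]; last by split => // v; exact: sg.
by split=> [|v k]; [exact: (sg 1%N).1|exact: (sg k.+1).2].
Qed.

Lemma smooth_at_diff g x v : smooth_at g x -> smooth_at (fun y => 'd g y v) x.
Proof. by move=> /smooth_atP[]. Qed.

Lemma smooth_at_near g x : smooth_at g x -> \forall y \near x, differentiable g y.
Proof. by move=> /smooth_atP[]. Qed.

Lemma smooth_at_differentiable g x : smooth_at g x -> differentiable g x.
Proof. by move=> /smooth_at_near; exact: nbhs_singleton. Qed.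

Lemma smooth_at_continuous g x : smooth_at g x -> {for x, continuous g}.
Proof. by move=> /smooth_at_differentiable; exact: differentiable_continuous. Qed.

Lemma near_eq_smooth_at f g x : {near x, f =1 g} -> smooth_at f x -> smooth_at g x.
Proof. by move=> fg sf k; exact: near_eq_Cdiff fg (sf k). Qed.

Lemma smooth_at_cst (a : R) x : smooth_at (cst a : V -> R) x.
Proof. by move=> k; exact: Cdiff_cst. Qed.

Lemma smooth_atD f g x : smooth_at f x -> smooth_at g x -> smooth_at (fun y => f y + g y) x.
Proof. by move=> sf sg k; exact: CdiffD. Qed.

Lemma smooth_atM f g x : smooth_at f x -> smooth_at g x -> smooth_at (fun y => f y * g y) x.
Proof. by move=> sf sg k; exact: CdiffM. Qed.

Lemma smooth_atV f x : f x != 0 -> smooth_at f x -> smooth_at (fun y => (f y)^-1) x.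
Proof. by move=> fx0 sf k; exact: CdiffV. Qed.

Lemma smooth_at_sum (I : Type) (s : seq I) (P : pred I) (f : I -> V -> R) x :
  (forall i, P i -> smooth_at (f i) x) ->
  smooth_at (fun y => \sum_(i <- s | P i) f i y) x.
Proof.
move=> sf; elim: s => [|i s IH].
  by apply: near_eq_smooth_at (smooth_at_cst 0 x); near=> y; rewrite big_nil.
have [Pi|Pi] := boolP (P i).
  apply: near_eq_smooth_at (smooth_atD (sf i Pi) IH).
  by near=> y; rewrite big_cons Pi.
by apply: near_eq_smooth_at IH; near=> y; rewrite big_cons (negbTE Pi).
Unshelve. all: by end_near. Qed.

Lemma smooth_at_prod (I : Type) (s : seq I) (P : pred I) (f : I -> V -> R) x :
  (forall i, P i -> smooth_at (f i) x) ->
  smooth_at (fun y => \prod_(i <- s | P i) f i y) x.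
Proof.
move=> sf; elim: s => [|i s IH].
  by apply: near_eq_smooth_at (smooth_at_cst 1 x); near=> y; rewrite big_nil.
have [Pi|Pi] := boolP (P i).
  apply: near_eq_smooth_at (smooth_atM (sf i Pi) IH).
  by near=> y; rewrite big_cons Pi.
by apply: near_eq_smooth_at IH; near=> y; rewrite big_cons (negbTE Pi).
Unshelve. all: by end_near. Qed.

Lemma smooth_at_det p (A : V -> 'M[R]_p) x :
  (forall i j, smooth_at (fun y => A y i j) x) -> smooth_at (fun y => \det (A y)) x.
Proof.
move=> sA; apply: smooth_at_sum => s _; apply: smooth_atM; first exact: smooth_at_cst.
exact: smooth_at_prod.
Qed.

(** The entries are cofactors divided by the determinant. Invertibility is asked near the point
    because [invmx] returns the matrix itself off the units. *)
Lemma smooth_at_invmx p (A : V -> 'M[R]_p) x i j :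
  (\forall y \near x, A y \in unitmx) ->
  (forall i j, smooth_at (fun y => A y i j) x) -> smooth_at (fun y => invmx (A y) i j) x.
Proof.
move=> uA sA; have dA0 : \det (A x) != 0.
  by have := nbhs_singleton uA; rewrite unitmxE unitfE.
have s : smooth_at (fun y => (\det (A y))^-1 * ((-1) ^+ (j + i) *
    \det (row' j (col' i (A y))))) x.
  apply: smooth_atM; first by apply: smooth_atV => //; exact: smooth_at_det.
  apply: smooth_atM; first exact: smooth_at_cst.
  apply: smooth_at_det => a b; apply: near_eq_smooth_at (sA (lift j a) (lift i b)).
  by near=> y; rewrite !mxE.
apply: near_eq_smooth_at s; near=> y.
by rewrite /invmx (near uA y _) // !mxE.
Unshelve. all: by end_near. Qed.

End Cdiff.

Lemma smooth_at_lin n (L : {linear 'rV[R]_n -> R^o}) x : smooth_at (L : _ -> R) x.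
Proof.
apply/smooth_atP; split; first by near=> y; exact: differentiable_lin.
move=> v; apply: near_eq_smooth_at (smooth_at_cst (L v) x).
by near=> y; rewrite diff_linear.
Unshelve. all: by end_near. Qed.

Lemma smooth_at_coord n (i : 'I_n) x : smooth_at (fun y : 'rV[R]_n => y 0 i) x.
Proof. exact: (@smooth_at_lin n (mxcoord 0 i)). Qed.

Definition smooth_row (V : normedModType R) n (f : V -> 'rV[R]_n) x :=
  forall j, smooth_at (fun y => f y 0 j) x.

Section SmoothRow.
Variable V : normedModType R.

Lemma smooth_row_near n (f : V -> 'rV[R]_n) x : smooth_row f x ->
  \forall y \near x, differentiable f y.
Proof.
move=> sf; have : \forall y \near x, forall j, differentiable (fun y => f y 0 j : R) y.
  by apply: filter_forall => j; exact: smooth_at_near.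
by apply: filterS => y Hy; exact: differentiable_row.
Qed.

Lemma smooth_row_differentiable n (f : V -> 'rV[R]_n) x :
  smooth_row f x -> differentiable f x.
Proof. by move=> /smooth_row_near; exact: nbhs_singleton. Qed.

Lemma smooth_row_continuous n (f : V -> 'rV[R]_n) x :
  smooth_row f x -> {for x, continuous f}.
Proof. by move=> /smooth_row_differentiable; exact: differentiable_continuous. Qed.

Lemma smooth_row_diff n (f : V -> 'rV[R]_n) x v :
  smooth_row f x -> smooth_row (fun y => 'd f y v) x.
Proof.
move=> sf j; apply: near_eq_smooth_at (smooth_at_diff v (sf j)).
have df := smooth_row_near sf.
by near=> y; rewrite diff_coord //; exact: (near df).
Unshelve. all: by end_near. Qed.

Lemma near_eq_smooth_row n (f g : V -> 'rV[R]_n) x :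
  {near x, f =1 g} -> smooth_row f x -> smooth_row g x.
Proof.
move=> fg sf j; apply: near_eq_smooth_at (sf j); near=> y.
by rewrite (near fg y _).
Unshelve. all: by end_near. Qed.

(** Expanding the inner differential in the standard basis leaves the outer one in constant
    directions, the form to which the induction hypothesis applies. *)
Lemma Cdiff_comp k p (g : 'rV[R]_p -> R) (f : V -> 'rV[R]_p) x :
  Cdiff k g (f x) -> smooth_row f x -> Cdiff k (g \o f) x.
Proof.
elim: k g => [//|k IH] g [dg Hg] sf.
have df := smooth_row_near sf.
have dgf : \forall y \near x, differentiable g (f y).
  exact: (smooth_row_continuous sf dg).
split; first by near=> y; apply: differentiable_comp; [exact: (near df)|exact: (near dgf)].
move=> v.
have S j : Cdiff k (fun y => 'd f y v 0 j * 'd g (f y) 'e_j) x.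
  by apply: CdiffM; [exact: smooth_row_diff|exact: (IH (fun z => 'd g z 'e_j) (Hg _) sf)].
have : Cdiff k (fun y => \sum_(j < p) ('d f y v 0 j * 'd g (f y) 'e_j)) x.
  have : forall s : seq 'I_p,
      Cdiff k (fun y => \sum_(j <- s) ('d f y v 0 j * 'd g (f y) 'e_j)) x.
    elim=> [|j s IHs].
      by apply: near_eq_Cdiff (Cdiff_cst k 0 x); near=> y; rewrite big_nil.
    by apply: near_eq_Cdiff (CdiffD (S j) IHs); near=> y; rewrite big_cons.
  by apply.
apply: near_eq_Cdiff; near=> y.
rewrite (@diff_comp _ _ _ _ f g); [|exact: (near df)|exact: (near dgf)].
rewrite /= [in RHS](row_sum_delta ('d f y v)) linear_sum /=.
by apply: eq_bigr => j _; rewrite linearZ.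
Unshelve. all: by end_near. Qed.

Lemma smooth_at_comp p (g : 'rV[R]_p -> R) (f : V -> 'rV[R]_p) x :
  smooth_at g (f x) -> smooth_row f x -> smooth_at (g \o f) x.
Proof. by move=> sg sf k; exact: Cdiff_comp. Qed.

Lemma smooth_row_comp p q (g : 'rV[R]_p -> 'rV[R]_q) (f : V -> 'rV[R]_p) x :
  smooth_row g (f x) -> smooth_row f x -> smooth_row (g \o f) x.
Proof. by move=> sg sf j; exact: (smooth_at_comp (sg j)). Qed.

Lemma smooth_at_comp1 (g : R -> R) (f : V -> R) x :
  smooth_at (g : R^o -> R) (f x) -> smooth_at f x -> smooth_at (g \o f) x.
Proof.
move=> sg sf k; elim: k g sg => [//|k IH] g sg.
have [/smooth_at_near df /smooth_at_near dg] := (sf, sg).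
have dgf : \forall y \near x, differentiable (g : R^o -> R) (f y).
  exact: (smooth_at_continuous sf dg).
split; first by near=> y; apply: differentiable_comp; [exact: (near df)|exact: (near dgf)].
move=> v.
have := CdiffM ((sf k.+1).2 v) (IH (fun z => 'd g z (1 : R^o)) (smooth_at_diff (1 : R^o) sg)).
apply: near_eq_Cdiff; near=> y.
rewrite (@diff_comp _ _ _ _ f (g : R^o -> R)); [|exact: (near df)|exact: (near dgf)].
rewrite /= -[in RHS](mulr1 ('d f y v)).
by rewrite -[X in _ = 'd _ _ X]/('d f y v *: (1 : R^o)) linearZ.
Unshelve. all: by end_near. Qed.

End SmoothRow.

Lemma smooth_row_lin n p (L : {linear 'rV[R]_n -> 'rV[R]_p}) x : smooth_row L x.
Proof. by move=> j; exact: (@smooth_at_lin n (mxcoord 0 j \o L)). Qed.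

Lemma smooth_onP n p (U : set 'rV[R]_n) (f : 'rV[R]_n -> 'rV[R]_p) : open U ->
  smooth_on U f <-> forall x, U x -> smooth_row f x.
Proof.
move=> oU; split=> [sf x Ux j k|sf k].
  elim: k f {sf} (sf k) => [//|k IH] f [_ [df Hf]].
  have nU : \forall y \near x, U y by exact: open_nbhs_nbhs.
  split; first by near=> y; apply: differentiable_comp (differentiable_coord _ _ _); apply: df; exact: (near nU).
  move=> v; apply: near_eq_Cdiff (IH _ (Hf v)); near=> y.
  by rewrite diff_coord //; apply: df; exact: (near nU).
elim: k f sf => [|k IH] f sf; split => //.
- by move=> x /sf/smooth_row_continuous.
- by move=> x /sf/smooth_row_continuous.
split; first by move=> x /sf/smooth_row_differentiable.
by move=> v; apply: IH => x /sf; exact: smooth_row_diff.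
Unshelve. all: by end_near. Qed.

End Calculus.

(** * Symmetry of second derivatives and the commutator identity *)

Section Schwarz.
Variable R : realType.

Lemma is_derive_line (V U : normedModType R) (g : V -> U) (a u : V) (s : R) :
  differentiable g (a + s *: u) ->
  is_derive s (1 : R) (fun t : R => g (a + t *: u)) ('d g (a + s *: u) u).
Proof.
move=> dg; pose l : R -> V := fun t => a + t *: u.
have dl : is_diff (s : R^o) (l : R^o -> V) ( *:%R^~ u).
  have -> : l = cst a + ( *:%R^~ u) by [].
  have E : ( *:%R^~ u : R^o -> V) = 0 + ( *:%R^~ u) by rewrite add0r.
  by rewrite [X in is_diff _ _ X]E; exact: is_diffD.
have dgl : differentiable (g \o l : R^o -> U) s.
  by apply: differentiable_comp; [exact: ex_diff|].
apply: DeriveDef; first exact: (@diff_derivable _ R^o).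
rewrite (@deriveE _ R^o) // (@diff_comp _ R^o _ _ l g) //.
by rewrite /= diff_val scale1r.
Qed.

(** The mean value theorem is applied twice: along [u] to the difference of [g] in direction [v],
    then along [v] to the derivative of [g] along [u]. *)
Lemma second_difference (V : normedModType R) (g : V -> R) (x u v : V) (h : R) :
  0 < h ->
  (forall s t : R, 0 <= s <= h -> 0 <= t <= h ->
    differentiable g (x + s *: u + t *: v) /\
    differentiable (fun z => 'd g z u) (x + s *: u + t *: v)) ->
  exists s t : R, [/\ 0 <= s <= h, 0 <= t <= h &
    g (x + h *: u + h *: v) - g (x + h *: u) - g (x + h *: v) + g x =
    'd (fun z => 'd g z u) (x + s *: u + t *: v) v * h * h].
Proof.
move=> h0 dg.
have hh : 0 <= h <= h by rewrite lexx ltW.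
have h00 : 0 <= (0 : R) <= h by rewrite lexx ltW.
pose f (s : R) := g (x + h *: v + s *: u) - g (x + s *: u).
pose df (s : R) := 'd g (x + h *: v + s *: u) u - 'd g (x + s *: u) u.
have fd s : 0 <= s <= h -> is_derive s (1 : R) f (df s).
  move=> sh; apply: is_deriveB; apply: is_derive_line.
    by rewrite addrAC; exact: (dg s h sh hh).1.
  by have := (dg s 0 sh h00).1; rewrite scale0r addr0.
have sub (s : R) : s \in `]0, h[ -> 0 <= s <= h.
  by rewrite in_itv /= => /andP[/ltW -> /ltW ->].
have subc (s : R) : s \in `[0, h] -> 0 <= s <= h by rewrite in_itv.
have [|s /sub sh Es] := @MVT R f df 0 h h0 (fun s H => fd s (sub s H)).
  apply: derivable_within_continuous => s /subc sh.
  exact: (@ex_derive _ _ _ _ _ _ _ (fd s sh)).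
pose k (t : R) := 'd g (x + s *: u + t *: v) u.
have kd t : 0 <= t <= h ->
    is_derive t (1 : R) k ('d (fun z => 'd g z u) (x + s *: u + t *: v) v).
  by move=> th; apply: (@is_derive_line V R (fun z => 'd g z u)); exact: (dg s t sh th).2.
have [|t /sub th Et] := @MVT R k _ 0 h h0 (fun s H => kd s (sub s H)).
  apply: derivable_within_continuous => t /subc th.
  exact: (@ex_derive _ _ _ _ _ _ _ (kd t th)).
exists s, t; split => //; move: Es Et.
rewrite /f /df /k !scale0r !addr0 !subr0 (addrAC x (s *: u)) => Es <-.
rewrite -Es (addrAC x (h *: v)); ring.
Qed.

(** The second difference over a small parallelogram is symmetric in [u] and [v], so the two mixed
    derivatives share a value, taken at two points near [x]; their continuity does the rest. *)
Lemma diff_sym (V : normedModType R) (g : V -> R) (x u v : V) : smooth_at g x ->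
  'd (fun z => 'd g z u) x v = 'd (fun z => 'd g z v) x u.
Proof.
move=> sg.
pose A y := 'd (fun z => 'd g z u) y v; pose B y := 'd (fun z => 'd g z v) y u.
have cont w w' (e : R) : 0 < e -> \forall y \near x,
    `|'d (fun z => 'd g z w) y w' - 'd (fun z => 'd g z w) x w'| < e.
  have := smooth_at_continuous (smooth_at_diff w' (smooth_at_diff w sg)).
  by move=> /cvgrPdistC_lt; apply.
apply/eqP; rewrite -subr_eq0 -normr_le0 -/(A x) -/(B x); apply/ler_addgt0Pl => e e0; rewrite addr0.
have e2 : 0 < e / 2 by rewrite divr_gt0.
have N : \forall y \near x, [/\ differentiable g y,
    differentiable (fun z => 'd g z u) y, differentiable (fun z => 'd g z v) y,
    `|A y - A x| < e / 2 & `|B y - B x| < e / 2].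
  near=> y; split; near: y.
  - exact: smooth_at_near.
  - exact/smooth_at_near/smooth_at_diff.
  - exact/smooth_at_near/smooth_at_diff.
  - exact: cont.
  - exact: cont.
move: N => /nbhs_ballP[r /= r0 Hr].
(* This size gives h (|u| + |v|) < r, so the parallelogram stays in the ball; the summand 1 covers u
   = v = 0. *)
pose h := r / (2 * (`|u| + `|v| + 1)).
have D0 : 0 < 2 * (`|u| + `|v| + 1) by rewrite mulr_gt0 // ltr_wpDl // addr_ge0.
have h0 : 0 < h by rewrite divr_gt0.
have hr : h * (`|u| + `|v|) < r.
  rewrite /h mulrAC ltr_pdivrMr // ltr_pM2l //.
  by have := normr_ge0 u; have := normr_ge0 v; lra.
have inb (s t : R) : 0 <= s <= h -> 0 <= t <= h -> ball x r (x + s *: u + t *: v).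
  move=> /andP[s0 sh] /andP[t0 th]; rewrite -ball_normE /ball_ /=.
  rewrite -addrA opprD addrA subrr add0r normrN; apply: le_lt_trans hr.
  rewrite (le_trans (ler_normD _ _)) // !normrZ (ger0_norm s0) (ger0_norm t0) mulrDr.
  by rewrite lerD // ler_wpM2r.
have [|s [t [sh th E1]]] := @second_difference V g x u v h h0.
  by move=> s t sh th; have [[? ?] _] := Hr _ (inb s t sh th).
have [|s' [t' [sh' th' E2]]] := @second_difference V g x v u h h0.
  move=> s' t' sh' th'; rewrite addrAC.
  by have [] := Hr _ (inb _ _ th' sh').
have [_ _ _ HA _] := Hr _ (inb s t sh th).
have [_ _ _ _ HB] := Hr _ (inb t' s' th' sh').
have AB : A (x + s *: u + t *: v) = B (x + t' *: u + s' *: v).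
  have hn : h != 0 by rewrite gt_eqF.
  rewrite /A /B (addrAC _ (t' *: u)); apply: (mulIf hn); apply: (mulIf hn).
  rewrite -E1 -E2 (addrAC x (h *: v)); ring.
move: HA HB; rewrite -/(A x) -/(B x) -/(A (_ + _)) -/(B (_ + _)) AB distrC.
set c := B _ => Ha Hb; rewrite -[_ - _](subrKA c).
rewrite (le_trans (ler_normD _ _)) // [leRHS]splitr lerD // ltW //.
Unshelve. all: by end_near. Qed.

Lemma diff_mul (V : normedModType R) (a b : V -> R) x v :
  differentiable a x -> differentiable b x ->
  'd (fun y => a y * b y) x v = 'd a x v * b x + a x * 'd b x v.
Proof.
move=> da db; have -> : 'd (fun y => a y * b y) x v = a x * 'd b x v + b x * 'd a x v.
  exact: (congr1 (fun h => h v) (diffM da db)).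
by rewrite addrC (mulrC (b x)).
Qed.

Lemma diff_sumM (V : normedModType R) p (a b : 'I_p -> V -> R) x v :
  (forall i, differentiable (a i) x) -> (forall i, differentiable (b i) x) ->
  'd (fun y => \sum_i a i y * b i y) x v =
  \sum_i ('d (a i) x v * b i x + a i x * 'd (b i) x v).
Proof.
move=> da db.
have dM i : differentiable (fun y => a i y * b i y) x by exact: differentiableM.
have E : (fun y => \sum_i a i y * b i y) = \sum_i (fun y => a i y * b i y).
  by apply/funext => y; rewrite fct_sumE.
have ds : differentiable (\sum_i (fun y => a i y * b i y)) x.
  by apply: differentiable_sum => i; exact: differentiableM.
rewrite E -(deriveE _ ds) derive_sum; last by move=> i; exact: diff_derivable.
apply: eq_bigr => i _; rewrite (deriveE _ (dM i)); exact: diff_mul.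
Qed.

Lemma diff_row_sum n (g : 'rV[R]_n -> R) x u :
  'd g x u = \sum_k u 0 k * 'd g x 'e_k.
Proof.
rewrite [in LHS](row_sum_delta u) linear_sum; apply: eq_bigr => k _.
by rewrite linearZ.
Qed.

(* The identity [C, U] g = C (U g) - U (C g), for a constant field C, when the
   derivatives of g along C and U are combinations of functions g_i. *)
Lemma constant_field_commutator n p (g : 'rV[R]_n -> R) (gi vi wi : 'I_p -> 'rV[R]_n -> R)
    (C : 'rV[R]_n) (U : 'rV[R]_n -> 'rV[R]_n) x :
  smooth_at g x -> (forall i, smooth_at (gi i) x) -> (forall i, smooth_at (vi i) x) ->
  (forall i, smooth_at (wi i) x) -> smooth_row U x ->
  (\forall y \near x, 'd g y C = \sum_i vi i y * gi i y) ->
  (\forall y \near x, 'd g y (U y) = \sum_i wi i y * gi i y) ->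
  'd g x ('d U x C) + \sum_i ('d (vi i) x (U x) - 'd (wi i) x C) * gi i x
    + \sum_i (vi i x * 'd (gi i) x (U x) - wi i x * 'd (gi i) x C) = 0.
Proof.
move=> sg sgi sv sw sU EC EU.
have dd h : smooth_at h x -> differentiable h x by exact: smooth_at_differentiable.
have dgi i := dd _ (sgi i); have dv i := dd _ (sv i); have dw i := dd _ (sw i).
have dUk k := dd _ (sU k).
have dgk k := dd _ (smooth_at_diff ('e_k : 'rV[R]_n) sg).
have dC : differentiable (fun y => 'd g y C) x := dd _ (smooth_at_diff C sg).
have E1 := congr1 (fun h => h (U x)) (near_eq_diff EC dC).2.
have {}E1 := etrans (esym (diff_sumM (U x) dv dgi)) E1.
have sUg : smooth_at (fun y => \sum_k U y 0 k * 'd g y 'e_k) x.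
  apply: smooth_at_sum => k _; apply: smooth_atM; first exact: (sU k).
  exact: smooth_at_diff.
have EU' : \forall y \near x, \sum_k U y 0 k * 'd g y 'e_k = \sum_i wi i y * gi i y.
  by apply: filterS EU => y <-; rewrite [RHS]diff_row_sum.
have E2 := congr1 (fun h => h C) (near_eq_diff EU' (dd _ sUg)).2.
have {}E2 := etrans (esym (diff_sumM C dw dgi)) (etrans E2 (diff_sumM C dUk dgk)).
have dU : differentiable U x by exact: smooth_row_differentiable.
have F1 : \sum_k 'd (fun y => U y 0 k) x C * 'd g x 'e_k = 'd g x ('d U x C).
  rewrite [RHS]diff_row_sum; apply: eq_bigr => k _.
  by congr (_ * _); exact: diff_coord.
(* Symmetry enters here: the second derivatives of [g] in C(Ug) and U(Cg) cancel, and only the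
   derivative of the field [U] along [C] survives. *)
have F2 : \sum_k U x 0 k * 'd (fun y => 'd g y 'e_k) x C =
    'd (fun y => 'd g y C) x (U x).
  by rewrite [RHS]diff_row_sum; apply: eq_bigr => k _; congr (_ * _); exact: diff_sym.
have arith (a1 a2 b1 b2 D f1 f2 c : R) : a1 + a2 = D -> b1 + b2 = f1 + f2 ->
  f1 = c -> f2 = D -> c + (a1 - b1) + (a2 - b2) = 0 by lra.
have {}E1 := etrans (esym (big_split _ _ _ _ _)) E1.
have {}E2 := etrans (esym (big_split _ _ _ _ _)) (etrans E2 (big_split _ _ _ _ _)).
apply: etrans (arith _ _ _ _ _ _ _ _ E1 E2 F1 F2); congr (_ + _ + _).
  by rewrite -sumrB; apply: eq_bigr => i _; exact: mulrBl.
exact: sumrB.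
Qed.

End Schwarz.

(** * Smooth cutoff functions *)

Section Bump.
Variable R : realType.

(** The negative powers make the family stable under differentiation, so smoothness of all members
    follows by one induction on the order. *)
Definition flat n (t : R) : R := if 0 < t then t ^- n * expR (- t^-1) else 0.

Lemma flat_ge0 n t : 0 <= flat n t.
Proof.
rewrite /flat; case: ifP => // t0.
by rewrite mulr_ge0 ?expR_ge0 // invr_ge0 exprn_ge0 // ltW.
Qed.

(** From e^y >= y^(n+2) / (n+2)! at y = 1/t. The bound is quadratic so that the difference quotient
    at 0 tends to 0. *)
Lemma flat_le n t : flat n t <= (n.+2)`!%:R * t ^+ 2.
Proof.
rewrite /flat; case: ifP => t0; last by rewrite mulr_ge0 ?ler0n // sqr_ge0.
have t0' : 0 <= t^-1 by rewrite invr_ge0 ltW.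
have := expR_ge1Dxn n.+1 t0'; rewrite expRN.
set E := expR _ => HE.
have E0 : 0 < E by exact: expR_gt0.
have f0 : 0 < (n.+2)`!%:R :> R by rewrite ltr0n fact_gt0.
have {}HE : t^-1 ^+ n.+2 / (n.+2)`!%:R <= E by apply: le_trans HE; rewrite lerDr.
rewrite ler_pdivrMr // in HE.
have tn0 : t ^+ n != 0 by rewrite expf_neq0 // gt_eqF.
rewrite ler_pdivrMr // mulrAC -ler_pdivrMr ?exprn_gt0 //.
rewrite mulrC in HE; apply: le_trans HE; rewrite -invfM -exprD addn2.
by rewrite -exprVn.
Qed.

Lemma is_derive_flat n (t : R) :
  is_derive t (1 : R) (flat n) (flat n.+2 t - n%:R * flat n.+1 t).
Proof.
have [t0|t0|t0] := ltgtP t 0.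
- have -> : flat n.+2 t - n%:R * flat n.+1 t = 0.
    by rewrite /flat ltNge (ltW t0) /= mulr0 subr0.
  apply: near_eq_is_derive (is_derive_cst 0 _ _).
  have : \forall s \near t, s < 0 by exact: lt_nbhsl.
  by apply: filterS => s s0; rewrite /flat ltNge (ltW s0).
- have fE : \forall s \near t, s^-1 ^+ n * expR (- s^-1) = flat n s.
    have : \forall s \near t, 0 < s by exact: lt_nbhsr.
    by apply: filterS => s s0; rewrite /flat s0 exprVn.
  apply: (near_eq_is_derive fE) => {fE}.
  have tn0 : t != 0 by rewrite gt_eqF.
  have dV : is_derive t (1 : R) (fun s : R => s^-1) (- t ^- 2).
    apply: DeriveDef; first exact: (@derivableV _ _ id).
    rewrite (@deriveV _ _ id) // derive_id -[RHS]mulr1; reflexivity.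
  have dE : is_derive t (1 : R) (fun s : R => expR (- s^-1)) (expR (- t^-1) * t ^- 2).
    have := @is_derive1_comp R expR (fun s => - s^-1) t _ _ (is_derive_expR _) (is_deriveN dV).
    by rewrite opprK.
  have dX : is_derive t (1 : R) (fun s : R => s^-1 ^+ n) (- n%:R * t^-1 ^+ n.+1).
    case: n => [|m].
      by rewrite oppr0 mul0r; exact: is_derive_cst.
    have := is_deriveX m.+1 dV; rewrite exprfctE /=.
    set a := (_ *: _); have -> // : a = - m.+1%:R * t^-1 ^+ m.+2.
    rewrite /a -[LHS]/(m.+1%:R * t^-1 ^+ m * - t ^- 2) -exprVn mulrN mulNr.
    by rewrite -mulrA -exprD addn2.
  have := is_deriveM dX dE.
  rewrite -[X in is_derive _ _ X _]/(fun s : R => s^-1 ^+ n * expR (- s^-1)).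
  set a := (_ + _); have -> // : a = flat n.+2 t - n%:R * flat n.+1 t.
  rewrite /a /flat t0 -[LHS]/(t^-1 ^+ n * (expR (- t^-1) * t ^- 2) +
     expR (- t^-1) * (- n%:R * t^-1 ^+ n.+1)) -!exprVn !exprS; ring.
- have -> : flat n.+2 t - n%:R * flat n.+1 t = 0.
    by rewrite /flat t0 ltxx mulr0 subr0.
  have H : (fun h : R => h^-1 *: (flat n (h *: (1 : R) + t) - flat n t)) @ 0^' --> (0 : R).
    apply/cvgrPdistC_le => e e0.
    have C0 : 0 < (n.+2)`!%:R :> R by rewrite ltr0n fact_gt0.
    near=> h; rewrite subr0.
    have h0 : h != 0 by near: h; exact: nbhs_dnbhs_neq.
    have he : `|h| <= e / (n.+2)`!%:R.
      by near: h; apply: dnbhs0_le; rewrite divr_gt0.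
    rewrite -[h *: 1]/(h * 1) mulr1 t0 addr0 [flat n 0]/flat ltxx subr0.
    rewrite -[_ *: _]/(h^-1 * flat n h) normrM (ger0_norm (flat_ge0 _ _)) normfV.
    rewrite mulrC ler_pdivrMr ?normr_gt0 // (le_trans (flat_le _ _)) //.
    rewrite -[h ^+ 2]ger0_norm ?sqr_ge0 // normrX expr2 mulrA.
    by rewrite ler_wpM2r // mulrC -ler_pdivlMr.
  apply: DeriveDef; first by apply/cvg_ex; exists 0.
  exact: cvg_lim H.
Unshelve. all: by end_near. Qed.

Lemma diff_R (f : R -> R) t v df : is_derive t (1 : R) f df ->
  differentiable (f : R^o -> R) t /\ 'd (f : R^o -> R) t v = v * df.
Proof.
move=> dft; have dif : differentiable (f : R^o -> R) t.
  by apply/derivable1_diffP; exact: (@ex_derive _ _ _ _ _ _ _ dft).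
split => //; have <- : 'd (f : R^o -> R) t 1 = df.
  by rewrite -(deriveE _ dif); exact: (@derive_val _ _ _ _ _ _ _ dft).
by rewrite -[v in LHS]mulr1 -[v * 1]/(v *: (1 : R^o)) linearZ.
Qed.

Lemma smooth_at_flat n t : smooth_at (flat n : R^o -> R) t.
Proof.
move=> k; elim: k n => [//|k IH] n.
split; first by near=> s; exact: (diff_R 0 (is_derive_flat n s)).1.
move=> v; have := CdiffM (Cdiff_cst k v t)
  (CdiffD (IH n.+2) (CdiffM (Cdiff_cst k (- n%:R) t) (IH n.+1))).
apply: near_eq_Cdiff; near=> s.
by rewrite (diff_R v (is_derive_flat n s)).2 /cst mulNr.
Unshelve. all: by end_near. Qed.

(* A smooth cutoff: 1 on t <= 0 and 0 on t >= 1, obtained by truncating flat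
   with itself instead of dividing. *)
Definition cutoff (t : R) : R := flat 0 (flat 0 1 - flat 0 t) / flat 0 (flat 0 1).

Lemma flat1_gt0 : 0 < flat 0 1.
Proof. by rewrite /flat ltr01 mulr_gt0 ?invr_gt0 ?exprn_gt0 // expR_gt0. Qed.

Lemma flat_gt0 t : 0 < t -> 0 < flat 0 t.
Proof. by move=> t0; rewrite /flat t0 mulr_gt0 ?invr_gt0 ?exprn_gt0 // expR_gt0. Qed.

Lemma cutoff1 t : t <= 0 -> cutoff t = 1.
Proof.
move=> t0; rewrite /cutoff [flat 0 t]/flat ltNge t0 /= subr0 divff // gt_eqF //.
exact/flat_gt0/flat1_gt0.
Qed.

Lemma cutoff0 t : 1 <= t -> cutoff t = 0.
Proof.
move=> t1; have t0 : 0 < t by exact: lt_le_trans t1.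
rewrite /cutoff [X in X / _](_ : _ = 0) ?mul0r //.
rewrite {1}/flat ltNge subr_le0 [X in ~~ X](_ : _ = true) //.
rewrite /flat ltr01 t0 !expr0 !invr1 !mul1r ler_expR lerN2.
by rewrite invf_le1.
Qed.

Lemma smooth_at_cutoff t : smooth_at (cutoff : R^o -> R) t.
Proof.
apply: smooth_atM; last exact: smooth_at_cst.
apply: (@smooth_at_comp1 _ _ (flat 0) (fun t => flat 0 1 - flat 0 t)).
  exact: smooth_at_flat.
apply: smooth_atD; first exact: smooth_at_cst.
have := smooth_atM (smooth_at_cst (-1) t) (smooth_at_flat 0 t).
by apply: near_eq_smooth_at; near=> s; rewrite /cst mulN1r.
Unshelve. all: by end_near. Qed.

(** The Euclidean square, since the norm of row vectors is the maximum norm, which is not smooth. *)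
Definition sqdist n (a x : 'rV[R]_n) : R := \sum_i (x 0 i - a 0 i) ^+ 2.

Lemma smooth_at_sqdist n (a x : 'rV[R]_n) : smooth_at (sqdist a) x.
Proof.
apply: smooth_at_sum => i _.
have s : smooth_at (fun y : 'rV[R]_n => y 0 i - a 0 i) x.
  by apply: smooth_atD; [exact: smooth_at_coord|exact: smooth_at_cst].
exact: (smooth_atM s s).
Qed.

Lemma sqdist_coord n (a x : 'rV[R]_n) i e : 0 <= e -> sqdist a x <= e ^+ 2 -> `|x 0 i - a 0 i| <= e.
Proof.
move=> e0 H; rewrite -ler_sqr ?nnegrE // real_normK ?num_real //.
apply: le_trans H; rewrite /sqdist (bigD1 i) //= lerDl.
by apply: sumr_ge0 => j _; exact: sqr_ge0.
Qed.

(** The affine change sends the values e^2/2 and e^2 of [sqdist] to 0 and 1, the two thresholds of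
    [cutoff]. *)
Definition bump n (a : 'rV[R]_n) (e : R) x := cutoff (2 * sqdist a x / e ^+ 2 - 1).

Lemma smooth_at_bump n (a : 'rV[R]_n) e x : smooth_at (bump a e) x.
Proof.
apply: (@smooth_at_comp1 _ _ cutoff (fun x => 2 * sqdist a x / e ^+ 2 - 1)).
  exact: smooth_at_cutoff.
apply: smooth_atD; last exact: smooth_at_cst.
apply: smooth_atM; last exact: smooth_at_cst.
by apply: smooth_atM; [exact: smooth_at_cst|exact: smooth_at_sqdist].
Qed.

Lemma near_bump n (a : 'rV[R]_n) e : 0 < e -> \forall x \near a, bump a e x = 1.
Proof.
move=> e0.
have c : {for a, continuous (sqdist a : _ -> R)}.
  by apply: smooth_at_continuous; exact: smooth_at_sqdist.
have : \forall x \near a, sqdist a x < e ^+ 2 / 2.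
  move: c => /cvgr_lt; apply.
  rewrite /sqdist big1 ?divr_gt0 ?exprn_gt0 // => i _.
  by rewrite subrr expr0n.
apply: filterS => x Hx; apply: cutoff1; rewrite subr_le0 ler_pdivrMr ?exprn_gt0 //.
by rewrite mul1r mulrC -ler_pdivlMr // ltW.
Qed.

Lemma bump0 n (a : 'rV[R]_n) e x : 0 < e -> e ^+ 2 <= sqdist a x -> bump a e x = 0.
Proof.
move=> e0 H; apply: cutoff0; rewrite lerBrDr ler_pdivlMr ?exprn_gt0 //.
by rewrite ler_wpM2l.
Qed.

Lemma compact_sqball n (a : 'rV[R]_n) e : 0 <= e -> compact [set x | sqdist a x <= e ^+ 2].
Proof.
move=> e0; apply: bounded_closed_compact.
  exists (`|a| + e); split; first exact: num_real.
  move=> M HM x /= Hx; apply: le_trans (ltW HM).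
  rewrite -(subrK a x) addrC (le_trans (ler_normD _ _)) // lerD2l.
  rewrite {1}/Num.Def.normr /= mx_normrE; apply: bigmax_le => // -[i j] _ /=.
  by rewrite !mxE (ord1 i) sqdist_coord.
have -> : [set x | sqdist a x <= e ^+ 2] = sqdist a @^-1` [set t | t <= e ^+ 2] by [].
apply: closed_comp; last exact: closed_le.
by move=> x _; apply: smooth_at_continuous; exact: smooth_at_sqdist.
Qed.

Lemma sqball_sub n (a : 'rV[R]_n) (U : set 'rV[R]_n) : nbhs a U ->
  exists2 e, 0 < e & forall x, sqdist a x <= e ^+ 2 -> U x.
Proof.
move=> /nbhs_ballP[r /= r0 Hr]; exists (r / 2); first by rewrite divr_gt0.
move=> x Hx; apply: Hr; rewrite -ball_normE /ball_ /= distrC.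
have r2 : r / 2 < r by rewrite ltr_pdivrMr // ltr_pMr // ltr1n.
apply: le_lt_trans r2; rewrite {1}/Num.Def.normr /= mx_normrE.
apply: bigmax_le => [|[i j] _ /=]; first by rewrite divr_ge0 // ltW.
by rewrite !mxE (ord1 i) sqdist_coord // divr_ge0 // ltW.
Qed.

End Bump.

(** * Left-invariant fields in charts *)

Section Charts.
Variable R : realType.

Lemma diff_along (V U : normedModType R) (f : V -> U) x v w :
  differentiable f x -> (forall t : R, f (x + t *: v) = f x + t *: w) -> 'd f x v = w.
Proof.
move=> df E.
have H := @is_derive_line R V U f x v 0.
rewrite scale0r addr0 in H; have {}H := H df.
have H' : is_derive (0 : R) (1 : R) (fun t : R => f (x + t *: v)) w.
  have -> : (fun t : R => f (x + t *: v)) = (fun t : R => f x + t *: w).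
    by apply/funext => t.
  have := @is_derive_line R U U id (f x) w 0.
  have di : differentiable (@id U) (f x + (0 : R) *: w) by exact: ex_diff.
  by move=> /(_ di); rewrite (@diff_val _ _ _ _ _ _ _ (is_diff_id _)).
by rewrite -(@derive_val _ _ _ _ _ _ _ H) (@derive_val _ _ _ _ _ _ _ H').
Qed.

Lemma near_continuous (V U : topologicalType) (f : V -> U) x (P : U -> Prop) :
  {for x, continuous f} -> (\forall z \near f x, P z) -> \forall y \near x, P (f y).
Proof. by move=> cf nP; exact: (cf _ nP). Qed.

Lemma smooth_row_cst (V : normedModType R) n (a : 'rV[R]_n) (x : V) :
  smooth_row (cst a) x.
Proof. by move=> j; exact: smooth_at_cst. Qed.

Lemma smooth_row_mx (V : normedModType R) n p (f : V -> 'rV[R]_n) (g : V -> 'rV[R]_p) x :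
  smooth_row f x -> smooth_row g x -> smooth_row (fun y => row_mx (f y) (g y)) x.
Proof.
move=> sf sg j; rewrite -[j]splitK; case: (fintype.split j) => k /=.
  by apply: near_eq_smooth_at (sf k); near=> y; rewrite row_mxEl.
by apply: near_eq_smooth_at (sg k); near=> y; rewrite row_mxEr.
Unshelve. all: by end_near. Qed.

Lemma smooth_row_id n (x : 'rV[R]_n) : smooth_row id x.
Proof. by move=> j; exact: smooth_at_coord. Qed.

Section Chart.
Variables (X : Type) (n : nat) (c : chart R X n).
Hypothesis hc : is_chart c.

Lemma cmapK x : cdom c x -> cinv c (cmap c x) = x.
Proof. by case: hc => H _; exact: H. Qed.

Lemma cim_cmap x : cdom c x -> cim c (cmap c x).
Proof. by move=> cx; exists x. Qed.

Lemma cinvP r : cim c r -> cdom c (cinv c r) /\ cmap c (cinv c r) = r.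
Proof. by move=> [x cx <-]; rewrite cmapK. Qed.

Lemma near_cim r : cim c r -> \forall s \near r, cim c s.
Proof. by move=> cr; apply: open_nbhs_nbhs; split => //; case: hc. Qed.

End Chart.

Lemma cim_prod X Y n p (c : chart R X n) (d : chart R Y p) (r : 'rV[R]_(n + p)) :
  cim (prod_chart c d) r <-> cim c (lsubmx r) /\ cim d (rsubmx r).
Proof.
split=> [[[x y] [/= cx dy] <-]|[[x cx Ex] [y dy Ey]]].
  by rewrite row_mxKl row_mxKr; split; [exists x|exists y].
by exists (x, y) => //=; rewrite Ex Ey hsubmxK.
Qed.

Lemma is_chart_prod X Y n p (c : chart R X n) (d : chart R Y p) :
  is_chart c -> is_chart d -> is_chart (prod_chart c d).
Proof.
move=> hc hd; split.
  by move=> [x y] [/= cx dy]; rewrite row_mxKl row_mxKr !cmapK.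
have -> : cim (prod_chart c d) = (lsubmx @^-1` cim c) `&` (rsubmx @^-1` cim d).
  by apply/seteqP; split => r; rewrite cim_prod.
apply: openI.
  by apply: open_comp; [move=> r _; exact: continuous_lsubmx|case: hc].
by apply: open_comp; [move=> r _; exact: continuous_rsubmx|case: hd].
Qed.

Lemma smooth_mapP X Y n p (A : set (chart R X n)) (B : set (chart R Y p)) f c d x :
  smooth_map A B f -> is_chart c -> A c -> B d -> cdom c x -> cdom d (f x) ->
  (\forall s \near cmap c x, cim c s /\ cdom d (f (cinv c s))) /\
  smooth_row (cmap d \o f \o cinv c) (cmap c x).
Proof.
move=> sf hc Ac Bd cx dfx; have [oD sD] := sf c d Ac Bd.
set D := [set r | _] in oD sD.
have Dx : D (cmap c x) by split; [exact: cim_cmap|rewrite cmapK].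
split; first by apply: open_nbhs_nbhs; split.
by have /(smooth_onP _ oD)/(_ _ Dx) := sD.
Qed.

End Charts.

Section LieGroupCharts.
Variables (R : realType) (G : lieGroup R).
Local Notation d := (lie_dim G).
Local Notation atlas := (lie_atlas G).
Local Notation e := (lie_one G).
Local Notation mul := (@lie_mul R G).

Lemma atlas_chart c : atlas c -> is_chart c.
Proof. exact: (manifold_chart (lie_manifold G)). Qed.

Lemma chart_at (p : G) : exists c, atlas c /\ cdom c p.
Proof. exact: (manifold_cover (lie_manifold G)). Qed.

Lemma chart1P : atlas (chart1 G) /\ cdom (chart1 G) e.
Proof. by rewrite /chart1; case: cid. Qed.

Local Notation c1 := (chart1 G).
Local Notation o := (cmap (chart1 G) (lie_one G)).

Lemma atlas_chart1 : atlas c1. Proof. by case: chart1P. Qed.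
Lemma chart1_one : cdom c1 e. Proof. by case: chart1P. Qed.

Lemma lie_mulV_r (x : G) : mul x (lie_inv x) = e.
Proof.
rewrite -[LHS](lie_mul1 (lie_mul _ _)) -{1}(lie_mulV (lie_inv x)).
by rewrite -lie_mulA (lie_mulA (lie_inv x)) lie_mulV lie_mul1 lie_mulV.
Qed.

Lemma lie_mul1_r (x : G) : mul x e = x.
Proof. by rewrite -(lie_mulV x) lie_mulA lie_mulV_r lie_mul1. Qed.

Lemma transition_smooth c c' p : atlas c -> atlas c' -> cdom c p -> cdom c' p ->
  (\forall s \near cmap c p, cim c s /\ cdom c' (cinv c s)) /\
  smooth_row (cmap c' \o cinv c) (cmap c p).
Proof.
move=> Ac Ac' cp c'p.
by have := smooth_mapP (manifold_compatible (lie_manifold G)) (atlas_chart Ac) Ac Ac' cp c'p.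
Qed.

Definition smooth_fun (g : G -> R) p := forall c, atlas c -> cdom c p ->
  smooth_at (g \o cinv c) (cmap c p).

Lemma smooth_fun_chart (g : G -> R) p c : atlas c -> cdom c p ->
  smooth_at (g \o cinv c) (cmap c p) -> smooth_fun g p.
Proof.
move=> Ac cp sg c' Ac' c'p.
have [nt st] := transition_smooth Ac' Ac c'p cp.
have s : smooth_at ((g \o cinv c) \o (cmap c \o cinv c')) (cmap c' p).
  by apply: smooth_at_comp st; rewrite /= (cmapK (atlas_chart Ac')).
apply: near_eq_smooth_at s; apply: filterS nt => r [_ cr] /=.
by rewrite (cmapK (atlas_chart Ac)).
Qed.

(** Nearness on the group is read in charts, the form in which smoothness and differentials are
    available. *)
Definition near_pt (p : G) (P : G -> Prop) := forall c, atlas c -> cdom c p ->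
  \forall r \near cmap c p, P (cinv c r).

Lemma near_pt_chart c p P : atlas c -> cdom c p ->
  (\forall r \near cmap c p, P (cinv c r)) -> near_pt p P.
Proof.
move=> Ac cp nP c' Ac' c'p.
have [nt st] := transition_smooth Ac' Ac c'p cp.
have nP' : \forall r \near (cmap c \o cinv c') (cmap c' p), P (cinv c r).
  by rewrite /= (cmapK (atlas_chart Ac')).
apply: filterS2 nt (near_continuous (smooth_row_continuous st) nP') => r [_ cr] /=.
by rewrite (cmapK (atlas_chart Ac)).
Qed.

Lemma near_pt_eq_smooth (f g : G -> R) p :
  near_pt p (fun q => f q = g q) -> smooth_fun f p -> smooth_fun g p.
Proof. by move=> fg sf c Ac cp; apply: near_eq_smooth_at (fg c Ac cp) (sf c Ac cp). Qed.

Lemma near_pt_self p P : near_pt p P -> P p.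
Proof.
move=> nP; have [c [Ac cp]] := chart_at p.
by have := nbhs_singleton (nP c Ac cp); rewrite (cmapK (atlas_chart Ac)).
Qed.

Lemma mul_smooth ca c c' (a q : G) : atlas ca -> atlas c -> atlas c' ->
  cdom ca a -> cdom c q -> cdom c' (mul a q) ->
  let mulc z := cmap c' (mul (cinv ca (lsubmx z)) (cinv c (rsubmx z))) in
  (\forall z \near row_mx (cmap ca a) (cmap c q),
     [/\ cim ca (lsubmx z), cim c (rsubmx z) &
         cdom c' (mul (cinv ca (lsubmx z)) (cinv c (rsubmx z)))]) /\
  smooth_row mulc (row_mx (cmap ca a) (cmap c q)).
Proof.
move=> Aa Ac Ac' ca_a cq c'aq mulc.
have pc : is_chart (prod_chart ca c) by apply: is_chart_prod; exact: atlas_chart.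
have pA : prod_atlas atlas atlas (prod_chart ca c) by exists ca => //; exists c.
have pd : cdom (prod_chart ca c) (a, q) by [].
have [nm sm] := smooth_mapP (@lie_mul_smooth R G) pc pA Ac' pd c'aq.
by split => //; apply: filterS nm => z [/cim_prod[]].
Qed.

Lemma trans_smooth c c' (a q : G) : atlas c -> atlas c' -> cdom c q -> cdom c' (mul a q) ->
  (\forall r \near cmap c q, cim c r /\ cdom c' (mul a (cinv c r))) /\
  smooth_row (cmap c' \o mul a \o cinv c) (cmap c q).
Proof.
move=> Ac Ac' cq c'aq; have [ca [Aa ca_a]] := chart_at a.
have [nm sm] := mul_smooth Aa Ac Ac' ca_a cq c'aq.
have sr : smooth_row (fun r => row_mx (cmap ca a) r) (cmap c q).
  by apply: smooth_row_mx; [exact: smooth_row_cst|exact: smooth_row_id].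
have caK := cmapK (atlas_chart Aa) ca_a.
have nm' := near_continuous (smooth_row_continuous sr) nm.
split.
  apply: filterS nm' => r /=.
  by rewrite row_mxKl row_mxKr caK => -[].
apply: near_eq_smooth_row (smooth_row_comp sm sr).
by near=> r; rewrite /= row_mxKl row_mxKr caK.
Unshelve. all: by end_near. Qed.

Lemma smooth_fun_trans (f : G -> R) a q : smooth_fun f (mul a q) -> smooth_fun (f \o mul a) q.
Proof.
move=> sf c Ac cq; have [c' [Ac' c'aq]] := chart_at (mul a q).
have [nt st] := trans_smooth Ac Ac' cq c'aq.
have s : smooth_at ((f \o cinv c') \o (cmap c' \o mul a \o cinv c)) (cmap c q).
  by apply: smooth_at_comp st; rewrite /= (cmapK (atlas_chart Ac)) //; exact: sf.
apply: near_eq_smooth_at s; apply: filterS nt => r [_ cr] /=.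
by rewrite (cmapK (atlas_chart Ac')).
Qed.

Definition deriv_at (v : lie_alg G) (f : G -> R) (p : G) : R :=
  'd (f \o mul p \o cinv c1) o v.

Lemma deriv_at_chart v f p c : atlas c -> cdom c p ->
  differentiable (f \o cinv c) (cmap c p) ->
  deriv_at v f p = 'd (f \o cinv c) (cmap c p) (linv_field c v p).
Proof.
move=> Ac cp df.
have cp' : cdom c (mul p e) by rewrite lie_mul1_r.
have [nt st] := trans_smooth atlas_chart1 Ac chart1_one cp'.
have E : (cmap c \o mul p \o cinv c1) o = cmap c p.
  by rewrite /= (cmapK (atlas_chart atlas_chart1) chart1_one) lie_mul1_r.
have dc : differentiable (cmap c \o mul p \o cinv c1) o by exact: smooth_row_differentiable.
have df' : differentiable (f \o cinv c) ((cmap c \o mul p \o cinv c1) o) by rewrite E.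
have := diff_comp dc df'; rewrite E => D.
rewrite /deriv_at.
have nE : {near o, (f \o cinv c) \o (cmap c \o mul p \o cinv c1) =1 f \o mul p \o cinv c1}.
  by apply: filterS nt => r [_ cr] /=; rewrite (cmapK (atlas_chart Ac)).
apply: etrans (congr1 (fun h => h v) (near_eq_diff nE (differentiable_comp dc df')).2) _.
exact: (congr1 (fun h => h v) D).
Qed.

(** Near [p] the field is the differential of the multiplication, written in charts, at (r, o) in
    the constant direction (0, v); it is smooth in r because multiplication is. *)
Lemma linv_smooth c v p : atlas c -> cdom c p ->
  smooth_row (fun r => linv_field c v (cinv c r)) (cmap c p).
Proof.
move=> Ac cp.
have cp' : cdom c (mul p e) by rewrite lie_mul1_r.
have [nm sm] := mul_smooth Ac atlas_chart1 Ac cp chart1_one cp'.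
set mulc := (fun z => cmap c _) in sm.
have sr : smooth_row (fun r => row_mx r o) (cmap c p).
  by apply: smooth_row_mx; [exact: smooth_row_id|exact: smooth_row_cst].
pose w : 'rV[R]_(d + d) := row_mx 0 v.
have S : smooth_row ((fun z => 'd mulc z w) \o (fun r => row_mx r o)) (cmap c p).
  exact: (@smooth_row_comp R _ _ _ _ (row_mx^~ o) (cmap c p) (smooth_row_diff w sm) sr).
apply: near_eq_smooth_row S.
have dm := @near_continuous _ _ (row_mx^~ o) (cmap c p) _ (smooth_row_continuous sr) (smooth_row_near sm).
near=> r; have dmr : differentiable mulc (row_mx r o) by exact: (near dm).
rewrite /= /linv_field /tangent_map.
have sr' : smooth_row (fun x => row_mx r x) o.
  by apply: smooth_row_mx; [exact: smooth_row_cst|exact: smooth_row_id].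
have dr' := smooth_row_differentiable sr'.
have -> : cmap c \o mul (cinv c r) \o cinv c1 = mulc \o (fun x => row_mx r x).
  by apply/funext => x; rewrite /mulc /= row_mxKl row_mxKr.
rewrite (diff_comp dr' dmr) /=; congr ('d _ _ _).
symmetry; apply: diff_along => // t.
by rewrite scale_row_mx add_row_mx scaler0 addr0.
Unshelve. all: by end_near. Qed.

Lemma smooth_fun_deriv v f p : smooth_fun f p -> smooth_fun (deriv_at v f) p.
Proof.
move=> sf; have [c [Ac cp]] := chart_at p; apply: (smooth_fun_chart Ac cp).
have sc := sf c Ac cp; have sl := linv_smooth v Ac cp.
have s : smooth_at (fun r => \sum_k linv_field c v (cinv c r) 0 k *
    'd (f \o cinv c) r 'e_k) (cmap c p).
  apply: smooth_at_sum => k _; apply: smooth_atM; first exact: (sl k).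
  exact: smooth_at_diff.
apply: near_eq_smooth_at s.
have dn := smooth_at_near sc; have cn := near_cim (atlas_chart Ac) (cim_cmap cp).
apply: filterS2 dn cn => r dr cr.
have [cr' Er] := cinvP (atlas_chart Ac) cr.
have dr' : differentiable (f \o cinv c) (cmap c (cinv c r)) by rewrite Er.
by rewrite /= (deriv_at_chart v Ac cr' dr') Er; symmetry; exact: diff_row_sum.
Qed.

Lemma deriv_at_trans v f a q : deriv_at v (f \o mul a) q = deriv_at v f (mul a q).
Proof.
have E : (f \o mul a) \o mul q \o cinv c1 = f \o mul (mul a q) \o cinv c1.
  by apply/funext => x /=; rewrite lie_mulA.
by rewrite /deriv_at E.
Qed.

Lemma near_pt_deriv v (f g : G -> R) p : smooth_fun f p ->
  near_pt p (fun q => f q = g q) -> near_pt p (fun q => deriv_at v f q = deriv_at v g q).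
Proof.
move=> sf fg c Ac cp.
have nf := smooth_at_near (sf c Ac cp); have nc := near_cim (atlas_chart Ac) (cim_cmap cp).
have nE := near_join (fg c Ac cp).
apply: filterS3 nf nc nE => r dr cr Er.
have [cr' rK] := cinvP (atlas_chart Ac) cr.
have [dg dE] := near_eq_diff Er dr.
rewrite -rK in dr dg dE.
have Ef := deriv_at_chart v Ac cr' dr; have Eg := deriv_at_chart v Ac cr' dg.
have E := congr1 (fun h => h (linv_field c v (cinv c r))) dE.
exact: (etrans Ef (esym (etrans Eg E))).
Qed.

Definition coord1 (k : 'I_d) (p : G) : R := cmap c1 p 0 k.

Lemma coord1_smooth k : smooth_fun (coord1 k) e.
Proof.
apply: (smooth_fun_chart atlas_chart1 chart1_one).
apply: near_eq_smooth_at (smooth_at_coord k o).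
apply: filterS (near_cim (atlas_chart atlas_chart1) (cim_cmap chart1_one)) => r cr.
by have [_ Er] := cinvP (atlas_chart atlas_chart1) cr; rewrite /coord1 /= Er.
Qed.

Lemma deriv_coord1 v k : deriv_at v (coord1 k) e = v 0 k.
Proof.
rewrite /deriv_at.
have nE : {near o, (fun r : 'rV[R]_d => r 0 k) =1 coord1 k \o mul e \o cinv c1}.
  apply: filterS (near_cim (atlas_chart atlas_chart1) (cim_cmap chart1_one)) => r cr.
  have [_ Er] := cinvP (atlas_chart atlas_chart1) cr.
  by rewrite /coord1 /= lie_mul1 Er.
apply: etrans (congr1 (fun h => h v) (near_eq_diff nE (differentiable_coord _ 0 k)).2) _.
exact: (congr1 (fun h => h v) (diff_linear (mxcoord 0 k : {linear 'rV[R]_d -> R^o}) o)).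
Qed.

(* Coordinates at p, obtained by left translation of chart1. *)
Definition tcoord (p : G) k := coord1 k \o mul (lie_inv p).

Lemma tcoord_smooth p k : smooth_fun (tcoord p k) p.
Proof. by apply: smooth_fun_trans; rewrite lie_mulV; exact: coord1_smooth. Qed.

Lemma deriv_tcoord v p k : deriv_at v (tcoord p k) p = v 0 k.
Proof. by rewrite deriv_at_trans lie_mulV deriv_coord1. Qed.

Definition linv_mx c p : 'M[R]_d := lin1_mx ('d (cmap c \o mul p \o cinv c1) o).

Lemma linv_mxE c v p : linv_field c v p = v *m linv_mx c p.
Proof. by rewrite mul_rV_lin1. Qed.

(** The derivatives at [p] of the functions [tcoord p k] recover every component of [v] from the
    value of its field at [p], so a field vanishing there has v = 0. *)
Lemma linv_mx_unit c p : atlas c -> cdom c p -> linv_mx c p \in unitmx.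
Proof.
move=> Ac cp; rewrite -row_free_unit; apply: inj_row_free => v.
rewrite -linv_mxE => v0; apply/rowP => k; rewrite mxE -(deriv_tcoord v p k).
have st := @tcoord_smooth p k c Ac cp.
by rewrite (deriv_at_chart v Ac cp (smooth_at_differentiable st)) v0 linear0.
Qed.

(** Components of a tangent vector at [p] in the left-invariant frame. *)
Definition lie_coord c p (z : 'rV[R]_d) : lie_alg G := z *m invmx (linv_mx c p).

Lemma lie_coordK c p v : atlas c -> cdom c p -> lie_coord c p (linv_field c v p) = v.
Proof. by move=> Ac cp; rewrite /lie_coord linv_mxE mulmxK // linv_mx_unit. Qed.

Lemma linv_field_coord c p z : atlas c -> cdom c p -> linv_field c (lie_coord c p z) p = z.
Proof. by move=> Ac cp; rewrite /lie_coord linv_mxE mulmxKV // linv_mx_unit. Qed.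

Lemma lie_coord_smooth c (V : normedModType R) (f : V -> 'rV[R]_d) (z : V -> 'rV[R]_d) x :
  atlas c -> cim c (f x) -> smooth_row f x -> smooth_row z x ->
  smooth_row (fun y => lie_coord c (cinv c (f y)) (z y)) x.
Proof.
move=> Ac cfx sf sz k.
have [cf' fK] := cinvP (atlas_chart Ac) cfx.
have nc := near_continuous (smooth_row_continuous sf) (near_cim (atlas_chart Ac) cfx).
have si i : smooth_at (fun y => invmx (linv_mx c (cinv c (f y))) i k) x.
  apply: smooth_at_invmx.
    by apply: filterS nc => y /= /(cinvP (atlas_chart Ac))[cy _]; exact: linv_mx_unit.
  move=> a b.
  have sl : smooth_row (fun r => linv_field c 'e_a (cinv c r)) (f x).
    by rewrite -fK; exact: linv_smooth.
  apply: near_eq_smooth_at (smooth_at_comp (sl b) sf); near=> y.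
  by rewrite /= linv_mxE -rowE mxE.
have s : smooth_at (fun y => \sum_i z y 0 i * invmx (linv_mx c (cinv c (f y))) i k) x.
  by apply: smooth_at_sum => i _; apply: smooth_atM; [exact: sz|exact: si].
by apply: near_eq_smooth_at s; near=> y; rewrite /lie_coord mxE.
Unshelve. all: by end_near. Qed.

End LieGroupCharts.

(** * Coordinates and linear functionals on finite-dimensional spaces *)

Section Functionals.
Variable R : realType.

Lemma vcoord_linear (V : vectType R) : linear (@vcoord R V).
Proof. exact: passmx.rVof_linear. Qed.

HB.instance Definition _ (V : vectType R) := GRing.isLinear.Build R V
  'rV[R]_(\dim {:V}) _ (@vcoord R V) (@vcoord_linear V).

Lemma vpoint_linear (V : vectType R) : linear (@vpoint R V).
Proof. exact: passmx.vecof_linear. Qed.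

HB.instance Definition _ (V : vectType R) := GRing.isLinear.Build R
  'rV[R]_(\dim {:V}) V _ (@vpoint R V) (@vpoint_linear V).

Variables V U : vectType R.

Lemma vcoordK : cancel (@vcoord R V) (@vpoint R V).
Proof. by apply: passmx.rVofK; exact: vbasisP. Qed.

Lemma vpointK : cancel (@vpoint R V) (@vcoord R V).
Proof. by apply: passmx.vecofK; exact: vbasisP. Qed.

Definition coordf (i : 'I_(\dim {:V})) : 'Hom(V, R^o) :=
  linfun (mxcoord 0 i \o @vcoord R V).

Lemma coordfE i x : coordf i x = vcoord x 0 i.
Proof. by rewrite lfunE. Qed.

Definition bvec (i : 'I_(\dim {:V})) : V := vpoint 'e_i.

Lemma bvec_sum x : x = \sum_i coordf i x *: bvec i.
Proof.
rewrite -{1}[x]vcoordK {1}(row_sum_delta (vcoord x)) linear_sum.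
by apply: eq_bigr => i _; rewrite linearZ coordfE.
Qed.

Lemma coordf_inj x : (forall i, coordf i x = 0) -> x = 0.
Proof. by move=> H; rewrite [x]bvec_sum big1 // => i _; rewrite H scale0r. Qed.

Lemma hom_sep x : (forall mu : 'Hom(V, R^o), mu x = 0) -> x = 0.
Proof. by move=> H; exact: coordf_inj. Qed.

Lemma hom_sep_eq x y : (forall mu : 'Hom(V, R^o), mu x = mu y) -> x = y.
Proof.
move=> H; apply/eqP; rewrite -subr_eq0; apply/eqP/hom_sep => mu.
by rewrite linearB /= H subrr.
Qed.

(** Each functional is precomposed with the projector complementary to [S]; all of them vanish on
    [x], so [x] equals its projection. *)
Lemma hom_sep_vspace (S : {vspace V}) x :
  (forall mu : 'Hom(V, R^o), (forall y, y \in S -> mu y = 0) -> mu x = 0) -> x \in S.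
Proof.
move=> H; have E : x - projv S x = 0.
  apply: hom_sep => mu; have := H (mu \o (\1 - projv S))%VF.
  rewrite comp_lfunE /= add_lfunE opp_lfunE id_lfunE; apply => y yS.
  by rewrite comp_lfunE add_lfunE opp_lfunE id_lfunE projv_id // subrr linear0.
by rewrite -(subrK (projv S x) x) E add0r memv_proj.
Qed.

Definition tens_fun (l : 'Hom(V, R^o)) (w : U) (x : V) : U := (l x : R) *: w.

Lemma tens_fun_linear l w : linear (tens_fun l w).
Proof. by move=> a x y; rewrite /tens_fun linearP /= scalerDl scalerA. Qed.

HB.instance Definition _ l w := GRing.isLinear.Build R V U _ (tens_fun l w)
  (tens_fun_linear l w).

Definition tens l w : 'Hom(V, U) := linfun (tens_fun l w).

Lemma tensE l w x : tens l w x = (l x : R) *: w.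
Proof. by rewrite lfunE. Qed.

Lemma tens_linear l : linear (tens l).
Proof.
move=> a w w'; apply/lfunP => x.
by rewrite add_lfunE scale_lfunE !tensE scalerDr !scalerA mulrC.
Qed.

HB.instance Definition _ l := GRing.isLinear.Build R U 'Hom(V, U) _ (tens l)
  (tens_linear l).

Lemma hom_tens_sum (A : 'Hom(V, U)) : A = \sum_i tens (coordf i) (A (bvec i)).
Proof.
apply/lfunP => x; rewrite sum_lfunE {1}[x]bvec_sum linear_sum.
by apply: eq_bigr => i _; rewrite linearZ tensE.
Qed.

End Functionals.

(** * Globally defined smooth functions on the group *)

Section LieGroupFunctions.
Variables (R : realType) (G : lieGroup R).
Local Notation d := (lie_dim G).
Local Notation atlas := (lie_atlas G).
Local Notation e := (lie_one G).
Local Notation mul := (@lie_mul R G).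
Local Notation c1 := (chart1 G).
Local Notation o := (cmap (chart1 G) (lie_one G)).

Lemma near_pt_join (p : G) P : near_pt p P -> near_pt p (fun q => near_pt q P).
Proof.
move=> nP c Ac cp; have nc := near_cim (atlas_chart Ac) (cim_cmap cp).
apply: filterS2 nc (near_join (nP c Ac cp)) => r cr nr.
have [cr' rK] := cinvP (atlas_chart Ac) cr.
by apply: (near_pt_chart Ac cr'); rewrite rK.
Qed.

Definition ext (c : chart R G d) (h : 'rV[R]_d -> R) (p : G) : R :=
  if `[< cdom c p >] then h (cmap c p) else 0.

Lemma ext_in c h p : cdom c p -> ext c h p = h (cmap c p).
Proof. by move=> cp; rewrite /ext asboolT. Qed.

(** At a point off the chart domain the extension is locally zero: the image of the closed ball is
    compact, hence closed in the Hausdorff group, and misses a neighbourhood of that point. *)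
Lemma ext_smooth c h a (r : R) : atlas c -> 0 <= r ->
  (forall x, sqdist a x <= r ^+ 2 -> cim c x) ->
  (forall x, cim c x -> smooth_at h x) ->
  (forall x, r ^+ 2 <= sqdist a x -> h x = 0) -> forall p, smooth_fun (ext c h) p.
Proof.
move=> Ac r0 Kc sh h0 p.
have M := lie_manifold G.
case: (pselect (cdom c p)) => cp.
  apply: (smooth_fun_chart Ac cp); have nc := near_cim (atlas_chart Ac) (cim_cmap cp).
  apply: near_eq_smooth_at (sh _ (cim_cmap cp)); apply: filterS nc => x cx.
  by have [cx' xK] := cinvP (atlas_chart Ac) cx; rewrite /= ext_in // xK.
pose K := [set x | sqdist a x <= r ^+ 2].
have cK : compact (cinv c @` K).
  apply: continuous_compact; last exact: compact_sqball.
  apply: continuous_in_subspaceT => x; rewrite inE => Kx.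
  have cx := Kc x Kx; have [cx' xK] := cinvP (atlas_chart Ac) cx.
  move=> P /=; rewrite nbhsE => -[U [oU Ux] UP].
  have [/(_ oU c Ac) oV _] := manifold_open M U.
  have : nbhs x [set y | cim c y /\ U (cinv c y)] by apply: open_nbhs_nbhs; split.
  by apply: filterS => y [_ Uy]; exact: UP.
have clK : closed (cinv c @` K) by apply: compact_closed cK; exact: (manifold_hausdorff M).
have npK : ~ (cinv c @` K) p.
  by move=> [x Kx xp]; apply: cp; rewrite -xp; exact: (cinvP (atlas_chart Ac) (Kc x Kx)).1.
have [c' [Ac' c'p]] := chart_at p.
apply: (smooth_fun_chart Ac' c'p).
have [/(_ (closed_openC clK) c' Ac') oV _] := manifold_open M (~` (cinv c @` K)).
have nV : nbhs (cmap c' p) [set y | cim c' y /\ (~` (cinv c @` K)) (cinv c' y)].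
  apply: open_nbhs_nbhs; split => //; split; first exact: cim_cmap.
  by rewrite (cmapK (atlas_chart Ac')).
apply: near_eq_smooth_at (smooth_at_cst 0 _); apply: filterS nV => x [_ nK].
rewrite /= /ext; case: asboolP => // cx.
have [le|lt] := leP (sqdist a (cmap c (cinv c' x))) (r ^+ 2).
  by exfalso; apply: nK; exists (cmap c (cinv c' x)) => //; rewrite (cmapK (atlas_chart Ac)).
by rewrite h0 // ltW.
Qed.

(** Used to see that a curve in the group is constant by testing it with real functions, although no
    single chart need contain it. *)
Lemma smooth_functions_separate (p q : G) : p <> q ->
  exists g : G -> R, (forall x, smooth_fun g x) /\ g p <> g q.
Proof.
move=> pq; have [c [Ac cp]] := chart_at p.
pose U := [set x | cim c x /\ (cdom c q -> x <> cmap c q)].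
have nU : nbhs (cmap c p) U.
  have nc := near_cim (atlas_chart Ac) (cim_cmap cp).
  have pq' : cdom c q -> cmap c p != cmap c q.
    move=> cq; apply/eqP => E; apply: pq.
    by rewrite -(cmapK (atlas_chart Ac) cp) E (cmapK (atlas_chart Ac)).
  case: (pselect (cdom c q)) => cq; last by apply: filterS nc => x; split.
  have nn : \forall x \near cmap c p, x != cmap c q.
    have : {for cmap c p, continuous (fun x : 'rV[R]_d => x - cmap c q)}.
      by apply: differentiable_continuous; apply: differentiableB.
    move=> /cvgr_neq0; rewrite subr_eq0 => /(_ (pq' cq)).
    by apply: filterS => x; rewrite subr_eq0.
  by apply: filterS2 nc nn => x cx /eqP.
have [r r0 Hr] := sqball_sub nU.
pose h := bump (cmap c p) r.
exists (ext c h); split.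
  apply: (@ext_smooth c h (cmap c p) r) => //; first exact: ltW.
  - by move=> x /Hr[].
  - by move=> x _; exact: smooth_at_bump.
  - by move=> x; exact: bump0.
rewrite ext_in // /h (nbhs_singleton (near_bump _ r0)) /ext.
case: asboolP => [cq|_]; last by move/eqP; rewrite oner_eq0.
rewrite bump0 //; first by move/eqP; rewrite oner_eq0.
by have [/Hr[_ /(_ cq)]|/ltW] := leP (sqdist (cmap c p) (cmap c q)) (r ^+ 2).
Qed.

Section VectorValued.
Variable V : vectType R.

Definition smooth_vfun (f : G -> V) p := forall mu : 'Hom(V, R^o), smooth_fun (mu \o f) p.

Lemma smooth_mapE (f : G -> V) :
  smooth_map atlas [set vect_chart V] f <-> forall p, smooth_vfun f p.
Proof.
split=> [sf p mu c Ac cp|sf c _ Ac ->].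
  have [_ s] := smooth_mapP sf (atlas_chart Ac) Ac (erefl _) cp (I : cdom (vect_chart V) (f p)).
  have := smooth_at_comp (@smooth_at_lin R _ (mu \o @vpoint R V) _) s.
  by apply: near_eq_smooth_at; near=> x; rewrite /= vcoordK.
have -> : [set r | cim c r /\ cdom (vect_chart V) (f (cinv c r))] = cim c.
  by apply/seteqP; split => r // -[].
have [_ oc] := atlas_chart Ac; split => //.
apply/(smooth_onP _ oc) => r cr i; have [cr' rK] := cinvP (atlas_chart Ac) cr.
have := sf (cinv c r) (coordf i) c Ac cr'; rewrite rK.
by apply: near_eq_smooth_at; near=> x; rewrite /= coordfE.
Unshelve. all: by end_near. Qed.

Lemma hom_lie_deriv (mu : 'Hom(V, R^o)) v (f : G -> V) p : smooth_vfun f p ->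
  mu (lie_deriv v f p) = deriv_at v (mu \o f) p.
Proof.
move=> sf; pose F := @vcoord R V \o (f \o mul p) \o cinv c1.
have dF : differentiable F o.
  apply: smooth_row_differentiable => i.
  have sp : smooth_fun (coordf i \o f) (mul p e) by rewrite lie_mul1_r.
  have := smooth_fun_trans sp (@atlas_chart1 R G) (@chart1_one R G).
  by apply: near_eq_smooth_at; near=> x; rewrite /F /= coordfE.
have E := diff_lin_comp (mu \o @vpoint R V) v dF.
have EF : mu \o @vpoint R V \o F = (mu \o f) \o mul p \o cinv c1.
  by apply/funext => x; rewrite /F /= vcoordK.
by rewrite /deriv_at -EF E.
Unshelve. all: by end_near. Qed.

Lemma smooth_lie_deriv v (f : G -> V) p :
  near_pt p (smooth_vfun f) -> smooth_vfun (lie_deriv v f) p.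
Proof.
move=> nf mu; have sf := near_pt_self nf mu.
apply: near_pt_eq_smooth (smooth_fun_deriv v sf) => c Ac cp.
by apply: filterS (nf c Ac cp) => r sr; rewrite /= hom_lie_deriv.
Qed.

Lemma lie_deriv_linear (f : G -> V) p : linear (fun v : lie_alg G => lie_deriv v f p).
Proof.
move=> a u v; rewrite /lie_deriv /tangent_map.
by rewrite !linearP.
Qed.

End VectorValued.
End LieGroupFunctions.

(** * Horizontal derivatives and contraction *)

Section LocalMaximum.
Variable R : realType.

Lemma diff_at_max (V : normedModType R) (g : V -> R) x v :
  (\forall y \near x, differentiable g y) -> (\forall y \near x, g y <= g x) ->
  'd g x v = 0.
Proof.
move=> dg mg.
have dx := nbhs_singleton dg.
have N : \forall y \near x, differentiable g y /\ g y <= g x by exact: filterI.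
move: N => /nbhs_ballP[r /= r0 Hr].
pose dl := r / (`|v| + 1).
have v1 : 0 < `|v| + 1 by rewrite ltr_wpDl.
have dl0 : 0 < dl by rewrite divr_gt0.
have inb (t : R) : t \in `]- dl, dl[ -> ball x r (x + t *: v).
  rewrite in_itv /= -ltr_norml => tdl; rewrite -ball_normE /ball_ /=.
  rewrite opprD addrA subrr add0r normrN normrZ.
  have [->|t0] := eqVneq t 0; first by rewrite normr0 mul0r.
  rewrite (@lt_trans _ _ (`|t| * (`|v| + 1))) // ?ltr_pM2l ?normr_gt0 ?ltrDl //.
  by rewrite -ltr_pdivlMr.
have dh (t : R) : t \in `]- dl, dl[ ->
    is_derive t (1 : R) (fun t : R => g (x + t *: v)) ('d g (x + t *: v) v).
  by move=> /inb/Hr[d1 _]; exact: is_derive_line.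
have in0 : (0 : R) \in `]- dl, dl[ by rewrite in_itv /= oppr_lt0 dl0.
have lt2 : - dl <= dl by rewrite ge0_cp // ltW.
have H := @derive1_at_max R (fun t : R => g (x + t *: v)) (- dl) dl 0 lt2
  (fun t H => @ex_derive _ _ _ _ _ _ _ (dh t H)) in0.
have {}H : is_derive (0 : R) (1 : R) (fun t : R => g (x + t *: v)) 0.
  by apply: H => t /inb/Hr[_ le]; rewrite scale0r addr0.
have := @derive_val _ _ _ _ _ _ _ (dh 0 in0); rewrite (@derive_val _ _ _ _ _ _ _ H).
by rewrite scale0r addr0.
Qed.

End LocalMaximum.

Section HorizontalDerivatives.
Variables (R : realType) (G : lieGroup R).
Local Notation d := (lie_dim G).
Local Notation atlas := (lie_atlas G).
Local Notation e := (lie_one G).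
Local Notation mul := (@lie_mul R G).
Local Notation c1 := (chart1 G).
Local Notation o := (cmap (chart1 G) (lie_one G)).

Lemma deriv_at_mulr v (g : G -> R) p a : smooth_fun g p ->
  deriv_at v (fun q => g q * a) p = deriv_at v g p * a.
Proof.
move=> sg; have [c [Ac cp]] := chart_at p.
have dg := smooth_at_differentiable (sg c Ac cp).
have dga : differentiable ((fun q => g q * a) \o cinv c) (cmap c p).
  by apply: differentiableM => //; exact: differentiable_cst.
have E1 := deriv_at_chart v Ac cp dga; have E2 := deriv_at_chart v Ac cp dg.
have Z : 'd (cst a : 'rV[R]_d -> R) (cmap c p) (linv_field c v p) = 0.
  exact: (congr1 (fun h => h (linv_field c v p)) (diff_cst a (cmap c p))).
have E3 := diff_mul (linv_field c v p) dg (differentiable_cst a (cmap c p)).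
have E4 := congr1 (fun z => _ + _ * z) Z.
have E5 : 'd (g \o cinv c) (cmap c p) (linv_field c v p) * a + (g \o cinv c) (cmap c p) * 0
  = deriv_at v g p * a by rewrite mulr0 addr0 E2.
exact: (etrans E1 (etrans E3 (etrans (E4 _ _) E5))).
Qed.

Lemma linv_field_one v : linv_field c1 v e = v.
Proof.
apply/rowP => k.
have sk := @coord1_smooth R G k c1 (@atlas_chart1 R G) (@chart1_one R G).
have E := deriv_at_chart v (@atlas_chart1 R G) (@chart1_one R G) (smooth_at_differentiable sk).
rewrite -(deriv_coord1 v k) E.
have nE : {near o, (fun r : 'rV[R]_d => r 0 k) =1 coord1 k \o cinv c1}.
  apply: filterS (near_cim (atlas_chart (@atlas_chart1 R G)) (cim_cmap (@chart1_one R G))) => r cr.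
  by have [_ Er] := cinvP (atlas_chart (@atlas_chart1 R G)) cr; rewrite /coord1 /= Er.
have D := congr1 (fun h => h (linv_field c1 v e)) (near_eq_diff nE (differentiable_coord _ 0 k)).2.
symmetry; apply: etrans D _.
exact: (congr1 (fun h => h _) (diff_linear (mxcoord 0 k : {linear 'rV[R]_d -> R^o}) o)).
Qed.

(** HD^k is spanned by derivatives of globally smooth maps, so a prescribed germ at the identity has
    to be extended; a cutoff around the identity does it. *)
Lemma local_extension (h : 'rV[R]_d -> R) : (forall x, smooth_at h x) ->
  exists g : G -> R, (forall p, smooth_fun g p) /\
    (\forall r \near o, cim c1 r /\ g (cinv c1 r) = h r).
Proof.
move=> sh; have Ac := @atlas_chart1 R G; have co := @chart1_one R G.
have nc := near_cim (atlas_chart Ac) (cim_cmap co).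
have [r r0 Hr] := sqball_sub nc.
exists (ext c1 (fun x => bump o r x * h x)); split.
  apply: (@ext_smooth _ _ c1 _ o r) => //; first exact: ltW.
    by move=> x _; apply: smooth_atM; [exact: smooth_at_bump|exact: sh].
  by move=> x Hx; rewrite bump0 // mul0r.
apply: filterS2 nc (near_bump o r0) => x cx bx; split => //.
have [cx' xK] := cinvP (atlas_chart Ac) cx.
by rewrite ext_in // xK bx mul1r.
Qed.

Section Vector.
Variables V U : vectType R.

Lemma smooth_scale (g : G -> R) (w : V) p : smooth_fun g p ->
  smooth_vfun (fun q => g q *: w) p.
Proof.
move=> sg mu c Ac cp.
have := smooth_atM (sg c Ac cp) (smooth_at_cst (mu w : R) (cmap c p)).
by apply: near_eq_smooth_at; near=> x; rewrite /= linearZ.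
Unshelve. all: by end_near. Qed.

Lemma lie_deriv_scale v (g : G -> R) (w : V) p : smooth_fun g p ->
  lie_deriv v (fun q => g q *: w) p = deriv_at v g p *: w.
Proof.
move=> sg; apply: hom_sep_eq => mu.
have E1 := hom_lie_deriv mu v (smooth_scale w sg).
have E2 : mu \o (fun q => g q *: w) = fun q => g q * mu w.
  by apply/funext => q; rewrite /= linearZ.
rewrite E2 in E1; have E3 := deriv_at_mulr v (mu w) sg.
apply: etrans E1 (etrans E3 _); symmetry; exact: linearZ.
Qed.

Lemma lin_lie_deriv (L : 'Hom(V, U)) v (f : G -> V) p : smooth_vfun f p ->
  L (lie_deriv v f p) = lie_deriv v (L \o f) p.
Proof.
move=> sf; apply: hom_sep_eq => mu.
have E (m : 'Hom(U, R^o)) : m \o (L \o f) = (m \o L)%VF \o f.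
  by apply/funext => q; rewrite /= comp_lfunE.
have sLf : smooth_vfun (L \o f) p by move=> m; rewrite E; exact: sf.
by rewrite (hom_lie_deriv mu v sLf) E -(hom_lie_deriv _ v sf) comp_lfunE.
Qed.

Lemma near_pt_lie_deriv v (f g : G -> V) p :
  (forall q, smooth_vfun f q) -> near_pt p (fun q => f q = g q) ->
  near_pt p (fun q => lie_deriv v f q = lie_deriv v g q).
Proof.
move=> sf nE c Ac cp; apply: filterS (near_pt_join nE Ac cp) => r.
set q := cinv c r => nq; apply: hom_sep_eq => mu.
have nmu : near_pt q (fun q => (mu \o f) q = (mu \o g) q).
  by move=> c' Ac' c'q; apply: filterS (nq c' Ac' c'q) => x /= ->.
have sg : smooth_vfun g q.
  move=> m; apply: near_pt_eq_smooth (sf q m) => c' Ac' c'q.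
  by apply: filterS (nq c' Ac' c'q) => x /= ->.
have E1 := hom_lie_deriv mu v (sf q); have E2 := hom_lie_deriv mu v sg.
have E3 := near_pt_self (near_pt_deriv v (sf q mu) nmu).
exact: (etrans E1 (etrans E3 (esym E2))).
Qed.

End Vector.

Variables (V1 : {vspace lie_alg G}) (W : vectType R).
Local Notation mlin := (multilin V1 W).
Local Notation HD k := (HD V1 W k).

(** A bundled copy of the map under [linfun] in [hderiv]. It is linear in [v] for every [f], as a
    differential is linear by construction, so [linfun] unfolds without side conditions. *)
Definition lie_deriv_sub (V : vectType R) (f : G -> V) p (v : subvs_of V1) : V :=
  lie_deriv (vsval v) f p.

Lemma lie_deriv_sub_linear (V : vectType R) (f : G -> V) p : linear (lie_deriv_sub f p).
Proof. by move=> a u v; rewrite /lie_deriv_sub linearP lie_deriv_linear. Qed.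

HB.instance Definition _ (V : vectType R) (f : G -> V) p :=
  GRing.isLinear.Build R (subvs_of V1) V _ (lie_deriv_sub f p) (lie_deriv_sub_linear f p).

Lemma contract_hderiv v (f : G -> W) k p :
  Defs.contract v (hderiv V1 f k.+1 p) = lie_deriv (vsval v) (hderiv V1 f k) p.
Proof. by rewrite /Defs.contract /=; exact: (lfunE (lie_deriv_sub (hderiv V1 f k) p)). Qed.

Lemma contract_linear k (v : subvs_of V1) : linear (@Defs.contract R G V1 W k v).
Proof. by move=> a A B; rewrite /Defs.contract add_lfunE scale_lfunE. Qed.

HB.instance Definition _ k v := GRing.isLinear.Build R (mlin k.+1) (mlin k) _
  (@Defs.contract R G V1 W k v) (@contract_linear k v).

Lemma smooth_hderiv (f : G -> W) k : (forall p, smooth_vfun f p) ->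
  forall p, smooth_vfun (hderiv V1 f k) p.
Proof.
move=> sf; elim: k => [//|k IH] p mu c Ac cp.
have s : smooth_at (fun r => \sum_i (mu \o linfun (tens (coordf i)))%VF
   (lie_deriv (vsval (bvec i : subvs_of V1)) (hderiv V1 f k) (cinv c r)) : R) (cmap c p).
  apply: smooth_at_sum => i _.
  have nf : near_pt p (smooth_vfun (hderiv V1 f k)) by move=> c' _ _; near=> x; exact: IH.
  exact: (smooth_lie_deriv (vsval (bvec i : subvs_of V1)) nf (mu \o linfun (tens (coordf i)))%VF Ac cp).
apply: near_eq_smooth_at s; near=> r.
rewrite /= [X in _ = mu X]hom_tens_sum linear_sum; apply: eq_bigr => i _.
by rewrite comp_lfunE lfunE /= -contract_hderiv.
Unshelve. all: by end_near. Qed.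

Lemma near_pt_hderiv (f g : G -> W) k p :
  (forall q, smooth_vfun f q) -> near_pt p (fun q => f q = g q) ->
  near_pt p (fun q => hderiv V1 f k q = hderiv V1 g k q).
Proof.
move=> sf nE; elim: k => [//|k IH] c Ac cp.
have nb := near_pt_join IH Ac cp; apply: filterS nb => r.
set q := cinv c r => nq.
apply/lfunP => v.
have E := near_pt_self (near_pt_lie_deriv (vsval v) (@smooth_hderiv f k sf) nq).
exact: (etrans (contract_hderiv v f k q) (etrans E (esym (contract_hderiv v g k q)))).
Qed.

Lemma hderiv_HD (f : G -> W) k p : (forall q, smooth_vfun f q) ->
  hderiv V1 f k p \in HDspace V1 W k.
Proof.
move=> sf; have [H _] := vspanP [set A | exists (f : G -> W) (p : G),
    smooth_map (lie_atlas G) [set vect_chart W] f /\ A = hderiv V1 f k p].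
by apply: H; exists f, p; split => //; apply/smooth_mapE.
Qed.

Lemma HDspace_sub k (U : {vspace mlin k}) :
  (forall (f : G -> W) p, (forall q, smooth_vfun f q) -> hderiv V1 f k p \in U) ->
  (HDspace V1 W k <= U)%VS.
Proof.
move=> H; apply: (vspanP _).2 => A [f [p [/smooth_mapE sf ->]]]; exact: H.
Qed.

(** Contracting A^{k+1}_{f,p} by v differentiates the map A^k_f along v at p. Its values lie in
    [HDspace V1 W k], so every functional that kills this subspace kills the derivative. *)
Lemma contract_HD k (v : subvs_of V1) (A : mlin k.+1) :
  A \in HDspace V1 W k.+1 -> Defs.contract v A \in HDspace V1 W k.
Proof.
move=> AH; pose L : 'Hom(mlin k.+1, mlin k) := linfun (@Defs.contract R G V1 W k v).
have LE B : L B = Defs.contract v B by rewrite /L lfunE.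
suff H : (HDspace V1 W k.+1 <= L @^-1: HDspace V1 W k)%VS.
  by have := subvP H A AH; rewrite -memv_preim LE.
apply: HDspace_sub => f p sf; rewrite -memv_preim LE contract_hderiv.
apply: hom_sep_vspace => mu Hmu.
rewrite (hom_lie_deriv _ _ (@smooth_hderiv f k sf p)).
have -> : mu \o hderiv V1 f k = (fun=> (0 : R) * 0).
  by apply/funext => q; rewrite /= Hmu ?mulr0 //; exact: hderiv_HD.
rewrite deriv_at_mulr ?mulr0 //.
by move=> c _ _; exact: smooth_at_cst.
Qed.

Definition hcontract_fun k (v : subvs_of V1) (A : HD k.+1) : HD k :=
  vsproj (HDspace V1 W k) (Defs.contract v (vsval A)).

Lemma hcontract_fun_linear k v : linear (@hcontract_fun k v).
Proof. by move=> a A B; rewrite /hcontract_fun !linearP. Qed.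

HB.instance Definition _ k v := GRing.isLinear.Build R (HD k.+1) (HD k) _
  (@hcontract_fun k v) (@hcontract_fun_linear k v).

Definition hcontract k (v : subvs_of V1) : 'Hom(HD k.+1, HD k) := linfun (@hcontract_fun k v).

Lemma vsval_hcontract k v (A : HD k.+1) : vsval (hcontract k v A) = Defs.contract v (vsval A).
Proof. by rewrite lfunE /= vsprojK //; apply: contract_HD; exact: subvsP. Qed.

Lemma hcontract_linearl k (A : HD k.+1) : linear (fun v => hcontract k v A).
Proof.
move=> a u v; apply: val_inj => /=.
rewrite !vsval_hcontract /Defs.contract; exact: linearP.
Qed.

Lemma hcontract0_eq0 k (A : HD k.+1) : (forall v, hcontract k v A = 0) -> A = 0.
Proof.
move=> H; apply: val_inj; apply/lfunP => v; rewrite zero_lfunE.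
by have := congr1 val (H v); rewrite /= vsval_hcontract.
Qed.

End HorizontalDerivatives.

(** * Surjectivity of contraction; elements of HD^1 and HD^2 *)

Section HorizontalJets.
Variables (R : realType) (G : lieGroup R).
Local Notation d := (lie_dim G).
Local Notation atlas := (lie_atlas G).
Local Notation e := (lie_one G).
Local Notation c1 := (chart1 G).
Local Notation o := (cmap (chart1 G) (lie_one G)).
Variables (V1 : {vspace lie_alg G}) (W : vectType R).
Local Notation mlin := (multilin V1 W).
Local Notation HD k := (HD V1 W k).

(* If H has compact support in a chart where a coordinate is strictly monotone
   along v, and H is invariant along v, then H = 0: otherwise H^2 times a positive
   affine function of that coordinate would have a critical point at its maximum. *)
Lemma invariant_compact_support_eq0 (v : lie_alg G) (H : G -> R) c p i (sg r : R) :
  atlas c -> cdom c p -> 0 < r -> (forall q, smooth_fun H q) ->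
  (forall q, deriv_at v H q = 0) ->
  (forall x, sqdist (cmap c p) x <= r ^+ 2 ->
     cim c x /\ 0 < sg * linv_field c v (cinv c x) 0 i) ->
  (forall x, cim c x -> (r / 2) ^+ 2 < sqdist (cmap c p) x -> H (cinv c x) = 0) ->
  `|sg| <= 1 -> H p = 0.
Proof.
move=> Ac cp r0 sH vH Hr H0 sg1; apply: contrapT => /eqP Hp.
set a := cmap c p in Hr H0.
pose K := [set x | sqdist a x <= r ^+ 2].
have Kc x : K x -> cim c x by move=> /Hr[].
pose h x := H (cinv c x).
have sh x : cim c x -> smooth_at h x.
  by move=> cx; have [cx' xK] := cinvP (atlas_chart Ac) cx; have := sH _ c Ac cx'; rewrite xK.
(* On the ball |x_i - a_i| <= r and |sg| <= 1, so the constant r + 1 keeps this function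
   positive. *)
pose phi (x : 'rV[R]_d) := sg * (x 0 i - a 0 i) + (r + 1).
have sphi x : smooth_at phi x.
  apply: smooth_atD; last exact: smooth_at_cst.
  apply: smooth_atM; first exact: smooth_at_cst.
  by apply: smooth_atD; [exact: smooth_at_coord|exact: smooth_at_cst].
have phi0 x : K x -> 0 < phi x.
  move=> Kx; have := sqdist_coord i (ltW r0) Kx; rewrite -ltrBlDr sub0r => Hx.
  have : `|sg * (x 0 i - a 0 i)| <= r.
    by rewrite normrM -[leRHS]mul1r ler_pM.
  by rewrite ler_norml => /andP[+ _]; apply: lt_le_trans; lra.
pose k x := h x * h x * phi x.
have sk x : cim c x -> smooth_at k x.
  by move=> cx; apply: smooth_atM (sphi x); apply: smooth_atM; exact: sh.
have Ka : K a.
  rewrite /K /= /sqdist big1 ?exprn_ge0 ?ltW // => j _.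
  by rewrite subrr expr0n.
have cK : compact K by apply: compact_sqball; exact: ltW.
have ck : {within K, continuous k}.
  apply: continuous_in_subspaceT => x; rewrite inE => Kx.
  exact: smooth_at_continuous (sk x (Kc x Kx)).
have [x Kx maxx] := EVT_max_rV (ex_intro _ a Ka) cK ck.
rewrite inE in Kx; have cx := Kc x Kx; have [cx' xK] := cinvP (atlas_chart Ac) cx.
have ka : 0 < k a.
  have ha : h a != 0 by rewrite /h /a (cmapK (atlas_chart Ac)).
  by rewrite /k mulr_gt0 ?phi0 // -expr2 exprn_even_gt0.
have kx : 0 < k x by apply: lt_le_trans ka (maxx a _); rewrite inE.
have hx : h x != 0 by apply: contraTneq kx => hx; rewrite /k hx !mul0r ltxx.
(* Since [H] vanishes beyond radius r/2, the maximum over the closed ball of radius r is attained in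
   its interior, where derivatives must vanish. *)
have xr : sqdist a x <= (r / 2) ^+ 2.
  by rewrite leNgt; apply: contraNN hx => lt; rewrite /h H0.
have nK : \forall y \near x, K y.
  have lt : sqdist a x < r ^+ 2.
    apply: le_lt_trans xr _; rewrite ltr_pXn2r ?nnegrE ?divr_ge0 // ?ltW //.
    by rewrite ltr_pdivrMr // ltr_pMr // ltr1n.
  have cs := smooth_at_continuous (smooth_at_sqdist a x).
  by move: cs => /cvgr_lt/(_ _ lt); apply: filterS => y /ltW.
have mk : \forall y \near x, k y <= k x.
  by apply: filterS nK => y Ky; apply: maxx; rewrite inE.
pose X := linv_field c v (cinv c x).
have D0 := diff_at_max X (smooth_at_near (sk x cx)) mk.
have dh := smooth_at_differentiable (sh x cx).
have dphi := smooth_at_differentiable (sphi x).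
have Dh : 'd h x X = 0.
  have dh' : differentiable (H \o cinv c) (cmap c (cinv c x)) by rewrite xK.
  have := deriv_at_chart v Ac cx' dh'; rewrite xK vH => E; exact: (esym E).
have Dphi : 'd phi x X = sg * X 0 i.
  apply: diff_along => // t; rewrite /phi !mxE -[t *: (sg * _)]/(t * (sg * _)); ring.
have dhh : differentiable (fun y => h y * h y) x by exact: differentiableM.
have E1 := diff_mul X dhh dphi; have E2 := diff_mul X dh dh.
have E3 : h x * h x * (sg * X 0 i) = 0.
  have arith (A B C D E Z F S : R) : A = 0 -> A = B * C + D * E ->
      B = Z * F + F * Z -> Z = 0 -> E = S -> D * S = 0.
    by move=> -> E1' EB Z0 <-; move: E1'; rewrite EB Z0 mul0r mulr0 addr0 mul0r add0r.
  exact: (arith _ _ _ _ _ _ _ _ D0 E1 E2 Dh Dphi).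
have [_ pos] := Hr x Kx.
have E0 : sg * X 0 i = 0.
  by have /eqP := E3; rewrite mulf_eq0 mulf_eq0 (negbTE hx) /= => /eqP.
by move: pos; rewrite -/X E0 ltxx.
Qed.

(** Let mu kill all contractions by v. For every smooth f the function mu(A^k_f) is then invariant
    along v. Replacing f by its product with a cutoff equal to 1 near p makes it compactly
    supported, hence zero, while its value at p is unchanged; so mu kills all of HD^k. *)
Lemma hcontract_surj k (v : subvs_of V1) : v != 0 ->
  forall B : HD k, exists A : HD k.+1, hcontract W k v A = B.
Proof.
move=> v0 B.
pose L : 'Hom(mlin k.+1, mlin k) := linfun (@Defs.contract R G V1 W k v).
have LE A : L A = Defs.contract v A by rewrite /L lfunE.
suff H : (HDspace V1 W k <= L @: HDspace V1 W k.+1)%VS.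
  have /(subvP H)/memv_imgP[A AH E] := subvsP B.
  exists (vsproj _ A); apply: val_inj => /=.
  by rewrite vsval_hcontract vsprojK // -LE -E.
apply: HDspace_sub => f p sf; apply: hom_sep_vspace => mu Hmu.
have [c [Ac cp]] := chart_at p.
have Xp0 : linv_field c (vsval v) p != 0.
  apply: contraNneq v0 => Xp; apply/eqP/val_inj => /=.
  by rewrite -(lie_coordK (vsval v) Ac cp) Xp /lie_coord mul0mx.
have [i Xi] : exists i, linv_field c (vsval v) p 0 i != 0.
  apply: contrapT => N; move/eqP: Xp0; apply; apply/rowP => i; rewrite mxE.
  by apply/eqP; apply: contrapT => /negP Ni; apply: N; exists i.
set a := cmap c p.
pose X x : R := linv_field c (vsval v) (cinv c x) 0 i.
have sX : smooth_at X a by exact: (linv_smooth (vsval v) Ac cp i).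
have Xa : X a != 0 by rewrite /X /a (cmapK (atlas_chart Ac)).
pose sg := Num.sg (X a).
have nX : \forall x \near a, 0 < sg * X x.
  have cX := smooth_at_continuous (smooth_atM (smooth_at_cst sg a) sX).
  have pos : 0 < cst sg a * X a by rewrite /cst /sg -normrEsg normr_gt0.
  by move: cX => /cvgr_gt/(_ _ pos).
(* A ball inside the chart on which the i-th component of the field along [v] keeps the sign it has
   at [p]. *)
have [r r0 Hr] := sqball_sub (filterI (near_cim (atlas_chart Ac) (cim_cmap cp)) nX).
have r20 : 0 < r / 2 by rewrite divr_gt0.
have r2r : (r / 2) ^+ 2 <= r ^+ 2.
  have hr : r / 2 <= r by lra.
  by rewrite !expr2 ler_pM // ltW.
(* The support has half the radius of the ball, the margin that puts the maximum in the interior. *)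
pose chi := ext c (bump a (r / 2)).
have schi q : smooth_fun chi q.
  apply: (@ext_smooth _ _ c _ a (r / 2)) => //; first exact: ltW.
  - by move=> x Hx; have [] := Hr x (le_trans Hx r2r).
  - by move=> x _; exact: smooth_at_bump.
  - by move=> x; exact: bump0.
pose f' q := chi q *: f q.
have sf' q : smooth_vfun f' q.
  move=> m c' Ac' c'q; have := smooth_atM (schi q c' Ac' c'q) (sf q m c' Ac' c'q).
  by apply: near_eq_smooth_at; near=> x; rewrite /= /f' linearZ.
pose H q : R := mu (hderiv V1 f' k q).
have sH q : smooth_fun H q := @smooth_hderiv _ _ _ _ f' k sf' q mu.
have vH q : deriv_at (vsval v) H q = 0.
  have E := hom_lie_deriv mu (vsval v) (@smooth_hderiv _ _ V1 _ f' k sf' q).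
  apply: etrans (esym E) _; rewrite -contract_hderiv -LE; apply: Hmu.
  by apply: memv_img; exact: hderiv_HD.
have Hp : H p = 0.
  apply: (@invariant_compact_support_eq0 (vsval v) H c p i sg r) => //.
  - move=> x cx lt; have [cx' xK] := cinvP (atlas_chart Ac) cx.
    have nz : near_pt (cinv c x) (fun q => f' q = 0).
      apply: (near_pt_chart Ac cx'); rewrite xK.
      have cs := smooth_at_continuous (smooth_at_sqdist a x).
      have nlt : \forall y \near x, (r / 2) ^+ 2 < sqdist a y.
        by move: cs => /cvgr_gt/(_ _ lt).
      apply: filterS2 (near_cim (atlas_chart Ac) cx) nlt => y cy ly.
      have [cy' yK] := cinvP (atlas_chart Ac) cy.
      by rewrite /f' /chi ext_in // yK bump0 ?scale0r // ltW.
    have E := near_pt_self (near_pt_hderiv V1 k sf' nz).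
    rewrite /H E.
    suff -> : hderiv V1 (fun=> 0 : W) k (cinv c x) = 0 by rewrite linear0.
    elim: k {B L LE Hmu mu H sH vH E} (cinv c x) => [//|k IH] q.
    apply/lfunP => w; rewrite zero_lfunE.
    apply: etrans (contract_hderiv w (fun=> 0 : W) k q) _.
    have -> : hderiv V1 (fun=> 0 : W) k = (fun q => (0 : R) *: (0 : mlin k)).
      by apply/funext => q'; rewrite scale0r IH.
    rewrite lie_deriv_scale ?scaler0 //.
    by move=> c' _ _; exact: smooth_at_cst.
  - by rewrite /sg normr_sg Xa.
have nf : near_pt p (fun q => f' q = f q).
  apply: (near_pt_chart Ac cp).
  apply: filterS2 (near_cim (atlas_chart Ac) (cim_cmap cp)) (near_bump a r20) => x cx bx.
  have [cx' xK] := cinvP (atlas_chart Ac) cx.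
  by rewrite /f' /chi ext_in // xK bx scale1r.
by rewrite -(near_pt_self (near_pt_hderiv V1 k sf' nf)).
Unshelve. all: by end_near. Qed.

(** The function equal to l(x - o) in [chart1], with [l] extended through the projection onto V_1,
    has derivative l(v) at the identity, where the field of v has coordinates v. *)
Lemma tens_HD1 (l : 'Hom(subvs_of V1, R^o)) (w : W) : (tens l w : mlin 1) \in HDspace V1 W 1.
Proof.
pose L : 'Hom('rV[R]_d, R^o) := (l \o linfun (vsproj V1))%VF.
have sh (x : 'rV[R]_d) : smooth_at (fun x => L (x - o) : R) x.
  have := smooth_atD (@smooth_at_lin R d L x) (smooth_at_cst (- L o) x).
  by apply: near_eq_smooth_at; near=> y; rewrite linearB.
have [g [sgl nE]] := local_extension sh.
have sg p : smooth_vfun (fun q => g q *: w) p by exact: smooth_scale.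
suff -> : (tens l w : mlin 1) = hderiv V1 (fun q => g q *: w) 1 e by exact: hderiv_HD.
apply/lfunP => v; rewrite tensE.
apply: esym; apply: etrans (contract_hderiv v _ 0 e) _.
rewrite /= lie_deriv_scale //; congr (_ *: _).
have co := @chart1_one R G; have Ac := @atlas_chart1 R G.
have dg := smooth_at_differentiable (sgl e c1 Ac co).
have E1 := deriv_at_chart (vsval v) Ac co dg.
have nE' : {near o, (fun x => L (x - o) : R) =1 g \o cinv c1}.
  by apply: filterS nE => x [_ Ex]; rewrite /= Ex.
have dL := smooth_at_differentiable (sh o).
have E2 := congr1 (fun h => h (linv_field c1 (vsval v) e)) (near_eq_diff nE' dL).2.
have E3 : 'd (fun x => L (x - o) : R) o (linv_field c1 (vsval v) e) = l v.
  apply: diff_along => // t; rewrite linv_field_one addrAC linearD linearZ subrr !linear0 !add0r.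
  have LV : L (vsval v) = l v by rewrite /L comp_lfunE lfunE /= vsvalK.
  by rewrite -LV.
exact: (etrans E1 (etrans E2 E3)).
Unshelve. all: by end_near. Qed.

Lemma HD1_full : HDspace V1 W 1 = fullv.
Proof.
apply: subv_anti; rewrite subvf /=; apply/subvP => A _.
rewrite [A]hom_tens_sum; apply: memv_suml => i _; exact: tens_HD1.
Qed.

(** Second derivatives at the identity of h^2 w, for h the affine function of [l] in [chart1]: h
    vanishes there, so only the product of first derivatives survives, and no second derivative of h
    along the fields is needed. *)
Lemma HD2_square (l : 'Hom(subvs_of V1, R^o)) (w : W) : exists A : HD 2,
  forall a b, vsval (hcontract W 0 a (hcontract W 1 b A)) = (2 * (l a * l b) : R) *: w.
Proof.
pose L : 'Hom('rV[R]_d, R^o) := (l \o linfun (vsproj V1))%VF.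
pose h (x : 'rV[R]_d) : R := L (x - o).
have sh x : smooth_at h x.
  have := smooth_atD (@smooth_at_lin R d L x) (smooth_at_cst (- L o) x).
  by apply: near_eq_smooth_at; near=> y; rewrite /h linearB.
have Dh x v : 'd h x v = L v.
  apply: diff_along; first exact: smooth_at_differentiable.
  by move=> t; rewrite /h addrAC linearD linearZ.
have shh x : smooth_at (fun y => h y * h y) x by apply: smooth_atM; exact: sh.
have [g [sgl nE]] := local_extension shh.
pose f q := g q *: w.
have sf p : smooth_vfun f p by exact: smooth_scale.
exists (vsproj _ (hderiv V1 f 2 e)) => a b.
rewrite !vsval_hcontract vsprojK; last exact: hderiv_HD.
pose La : 'Hom(mlin 1, mlin 0) := linfun (@Defs.contract R G V1 W 0 a).
have LaE B : La B = Defs.contract a B by rewrite /La lfunE.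
have E1 : Defs.contract a (Defs.contract b (hderiv V1 f 2 e)) =
    lie_deriv (vsval b) (La \o hderiv V1 f 1) e.
  by rewrite contract_hderiv -LaE lin_lie_deriv //; exact: (@smooth_hderiv _ _ V1 W f 1 sf).
rewrite E1.
have -> : La \o hderiv V1 f 1 = fun q => deriv_at (vsval a) g q *: w.
  apply/funext => q; rewrite /= LaE.
  by apply: etrans (contract_hderiv a f 0 q) _; rewrite /= lie_deriv_scale.
have sag : smooth_fun (deriv_at (vsval a) g) e by exact: smooth_fun_deriv.
rewrite lie_deriv_scale //; congr (_ *: _).
have co := @chart1_one R G; have Ac := @atlas_chart1 R G.
pose Q x : R := L (linv_field c1 (vsval a) (cinv c1 x)).
have sQ : smooth_at Q o.
  exact: (smooth_at_comp (@smooth_at_lin R d L _) (linv_smooth (vsval a) Ac co)).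
have sQ2 : smooth_at (fun x => Q x * 2) o by apply: smooth_atM => //; exact: smooth_at_cst.
have nE2 : {near o, (fun x => Q x * 2 * h x) =1 deriv_at (vsval a) g \o cinv c1}.
  have nE3 : \forall x \near o, {near x, (fun y => h y * h y) =1 g \o cinv c1}.
    by apply: near_join; apply: filterS nE => x [_ Ex]; rewrite /= Ex.
  apply: filterS2 nE3 nE => x nx [cx _].
  have [cx' xK] := cinvP (atlas_chart Ac) cx.
  have dhx := smooth_at_differentiable (sh x).
  have dhh := smooth_at_differentiable (shh x).
  have [dg Eg] := near_eq_diff nx dhh.
  have dg' : differentiable (g \o cinv c1) (cmap c1 (cinv c1 x)) by rewrite xK.
  have F1 := deriv_at_chart (vsval a) Ac cx' dg'; rewrite xK in F1.
  have F2 := congr1 (fun k => k (linv_field c1 (vsval a) (cinv c1 x))) Eg.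
  have F3 := diff_mul (linv_field c1 (vsval a) (cinv c1 x)) dhx dhx.
  have F4 := Dh x (linv_field c1 (vsval a) (cinv c1 x)).
  have arith (A B C D q z : R) : A = B -> B = C -> C = D * z + z * D -> D = q ->
    q * 2 * z = A by move=> -> -> -> ->; ring.
  exact: arith F1 F2 F3 F4.
have dT := smooth_at_differentiable (smooth_atM sQ2 (sh o)).
have [dag Eag] := near_eq_diff nE2 dT.
have F1 := deriv_at_chart (vsval b) Ac co dag.
have F2 := congr1 (fun k => k (linv_field c1 (vsval b) e)) Eag.
have F3 := diff_mul (linv_field c1 (vsval b) e) (smooth_at_differentiable sQ2)
  (smooth_at_differentiable (sh o)).
have F4 := Dh o (linv_field c1 (vsval b) e).
have Lv (u : subvs_of V1) : L (linv_field c1 (vsval u) e) = l u.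
  by rewrite linv_field_one /L comp_lfunE lfunE /= vsvalK.
have h0 : h o = 0 by rewrite /h subrr linear0.
have Qo : Q o = l a by rewrite /Q (cmapK (atlas_chart Ac) co) Lv.
have arith (A B C D q z y lb : R) : A = B -> B = C -> C = y * z + q * 2 * D ->
  D = lb -> z = 0 -> A = 2 * (q * lb) by move=> -> -> -> -> ->; ring.
have := arith _ _ _ _ _ _ _ _ F1 F2 F3 F4 h0.
by rewrite Lv Qo.
Unshelve. all: by end_near. Qed.

End HorizontalJets.

(** * Contact vectors in jet coordinates *)

Lemma coordf_comb (R : realType) (V : vectType R) (a : 'I_(\dim {:V}) -> R) i :
  coordf i (\sum_j a j *: bvec j : V) = a i.
Proof.
have vb j : vcoord (bvec j : V) = 'e_j := vpointK _.
rewrite coordfE linear_sum summxE (bigD1 i) //= big1 => [|j ji].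
  by rewrite addr0 linearZ /= vb !mxE !eqxx mulr1.
by rewrite linearZ /= vb !mxE eqxx /= eq_sym (negbTE ji) mulr0.
Qed.

(** * The Lie bracket through scalar derivatives *)

Section Bracket.
Variables (R : realType) (G : lieGroup R).
Local Notation d := (lie_dim G).
Local Notation e := (lie_one G).
Local Notation c1 := (chart1 G).

Lemma lie_bracketE (v w : lie_alg G) k :
  lie_bracket v w 0 k = deriv_at v (deriv_at w (coord1 k)) e - deriv_at w (deriv_at v (coord1 k)) e.
Proof.
have Ac := @atlas_chart1 R G; have co := @chart1_one R G.
pose mu : 'Hom(lie_alg G, R^o) := linfun (mxcoord 0 k).
have muE x : mu x = x 0 k by rewrite lfunE.
have sc q : cdom c1 q -> smooth_vfun (cmap c1 : G -> lie_alg G) q.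
  move=> cq m; apply: (smooth_fun_chart Ac cq).
  apply: near_eq_smooth_at (@smooth_at_lin R d m _).
  apply: filterS (near_cim (atlas_chart Ac) (cim_cmap cq)) => x cx.
  by have [_ xK] := cinvP (atlas_chart Ac) cx; rewrite /= xK.
have nsc : near_pt e (smooth_vfun (cmap c1 : G -> lie_alg G)).
  apply: (near_pt_chart Ac co).
  apply: filterS (near_cim (atlas_chart Ac) (cim_cmap co)) => x cx.
  by apply: sc; have [] := cinvP (atlas_chart Ac) cx.
have E a b : lie_deriv a (lie_deriv b (cmap c1 : G -> lie_alg G)) e 0 k =
    deriv_at a (deriv_at b (coord1 k)) e.
  rewrite -muE; have sl : smooth_vfun (lie_deriv b (cmap c1 : G -> lie_alg G)) e.
    exact: smooth_lie_deriv.
  apply: etrans (hom_lie_deriv mu a sl) _.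
  have Em : mu \o (cmap c1 : G -> lie_alg G) = coord1 k.
    by apply/funext => q; rewrite /= muE.
  have n : near_pt e (fun q => (mu \o lie_deriv b (cmap c1 : G -> lie_alg G)) q =
      deriv_at b (coord1 k) q).
    move=> c Ac' cc; apply: filterS (nsc c Ac' cc) => x sx.
    by rewrite /= (hom_lie_deriv mu b sx) Em.
  exact: (near_pt_self (near_pt_deriv a (sl mu) n)).
by rewrite /lie_bracket !mxE !E.
Qed.

Lemma deriv_at_sum n v (a : 'I_n -> R) (f : 'I_n -> G -> R) p :
  (forall i, smooth_fun (f i) p) ->
  deriv_at v (fun q => \sum_i a i * f i q) p = \sum_i a i * deriv_at v (f i) p.
Proof.
move=> sf; have [c [Ac cp]] := chart_at p.
have df i := smooth_at_differentiable (sf i c Ac cp).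
have ds : differentiable ((fun q => \sum_i a i * f i q) \o cinv c) (cmap c p).
  apply: smooth_at_differentiable; apply: smooth_at_sum => i _.
  by apply: smooth_atM; [exact: smooth_at_cst|exact: sf].
have E1 := deriv_at_chart v Ac cp ds.
have dc i : differentiable (cst (a i) : 'rV[R]_d -> R) (cmap c p) by exact: differentiable_cst.
have E2 := diff_sumM (linv_field c v p) dc df.
apply: etrans E1 (etrans E2 _); apply: eq_bigr => i _.
have Z : 'd (cst (a i) : 'rV[R]_d -> R) (cmap c p) (linv_field c v p) = 0.
  exact: (congr1 (fun h => h (linv_field c v p)) (diff_cst (a i) (cmap c p))).
have E3 := deriv_at_chart v Ac cp (df i).
have arith (x y z t s : R) : x = 0 -> s = t -> x * y + z * t = z * s.
  by move=> -> ->; rewrite mul0r add0r.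
exact: arith Z E3.
Qed.

Lemma deriv_at_suml n (a : 'I_n -> R) (v : 'I_n -> lie_alg G) f p :
  deriv_at (\sum_i a i *: v i) f p = \sum_i a i * deriv_at (v i) f p.
Proof.
rewrite /deriv_at linear_sum; apply: eq_bigr => i _; exact: linearZ.
Qed.

Lemma deriv2_tcoord v w p k :
  deriv_at v (deriv_at w (tcoord p k)) p = deriv_at v (deriv_at w (coord1 k)) e.
Proof.
have -> : deriv_at w (tcoord p k) = deriv_at w (coord1 k) \o lie_mul (lie_inv p).
  by apply/funext => q; rewrite /tcoord deriv_at_trans.
by rewrite deriv_at_trans lie_mulV.
Qed.

End Bracket.

(** * Jets in coordinates and the image of a commutator *)

Section JetCoordinates.
Variables (R : realType) (G : lieGroup R) (V1 : {vspace lie_alg G}) (W : vectType R).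
Local Notation d := (lie_dim G).
Local Notation atlas := (lie_atlas G).
Local Notation HD k := (HD V1 W k).
Local Notation N m := (HDle_dim V1 W m).

(* Levels of a jet are indexed by natural numbers, with value 0 above m. *)
Definition lev m k (r : 'rV[R]_(N m)) : HD k :=
  match pselect (k < m.+1)%N with
  | left H => vpoint (submxrow r (Ordinal H))
  | right _ => 0
  end.

Lemma lev_ord m (i : 'I_m.+1) (r : 'rV[R]_(N m)) : lev i r = vpoint (submxrow r i).
Proof.
case: i => k H /=; rewrite /lev; case: pselect => // H'.
by rewrite (bool_irrelevance H' H).
Qed.

Lemma lev_linear m k : linear (@lev m k).
Proof.
move=> a r s; rewrite /lev; case: pselect => [H|_]; last by rewrite scaler0 addr0.
rewrite -linearP; congr vpoint; apply/rowP => j; rewrite !mxE //.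
Qed.

HB.instance Definition _ m k := GRing.isLinear.Build R 'rV[R]_(N m) (HD k) _
  (@lev m k) (@lev_linear m k).

Definition mkjet m (B : forall k, HD k) : 'rV[R]_(N m) := \mxrow_(k < m.+1) vcoord (B k).

Lemma lev_mkjet m B k : (k < m.+1)%N -> lev k (mkjet m B) = B k.
Proof.
by move=> H; have := @lev_ord m (Ordinal H) (mkjet m B); rewrite mxrowK vcoordK.
Qed.

Lemma lev_chart m (A : HDle V1 W m) (i : 'I_m.+1) : lev i (cmap (HDle_chart V1 W m) A) = A i.
Proof. by rewrite lev_ord mxrowK vcoordK. Qed.

Lemma mkjet_lev m (r : 'rV[R]_(N m)) : mkjet m (fun k => lev k r) = r.
Proof.
rewrite -[RHS]submxrowK; apply: eq_mxrow => i.
by rewrite lev_ord vpointK.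
Qed.

Lemma lev_inj m (r s : 'rV[R]_(N m)) : (forall k, (k < m.+1)%N -> lev k r = lev k s) -> r = s.
Proof.
move=> H; rewrite -(mkjet_lev r) -(mkjet_lev s); apply: eq_mxrow => i.
by rewrite H.
Qed.

(** For k = m this is the Cartan distribution of J^m. Smaller k drops the upper contact equations; k
    = m - 1 gives the next larger distribution, used when dim V_1 = 1. *)
Definition inH m k (c : chart R G d) (r u : 'rV[R]_(d + N m)) : Prop :=
  exists v : subvs_of V1, lsubmx u = linv_field c (vsval v) (cinv c (lsubmx r)) /\
    forall l, (l < k)%N -> lev l (rsubmx u) = hcontract W l v (lev l.+1 (rsubmx r)).

Lemma cartanP m c (x : jet V1 W m) u : atlas c -> cdom c x.1 ->
  cartan c x u <-> inH m c (cmap (jet_chart V1 W m c) x) u.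
Proof.
move=> Ac cx; rewrite /inH /= row_mxKl row_mxKr (cmapK (atlas_chart Ac) cx).
split=> [[v [B [HB ->]]]|[v [Hu HB]]].
  exists v; rewrite row_mxKl row_mxKr; split => // l lm.
  have E := HB (Ordinal lm).
  apply: val_inj; rewrite /= vsval_hcontract.
  have E1 := lev_chart B (widen_ord (leqnSn m) (Ordinal lm)).
  have E2 := lev_chart x.2 (lift ord0 (Ordinal lm)).
  exact: (etrans (congr1 vsval E1) (etrans E (congr1 (fun z => Defs.contract v (vsval z)) (esym E2)))).
exists v, (fun k => lev k (rsubmx u)); split; last first.
  by rewrite -Hu -[LHS]hsubmxK; congr row_mx; symmetry; exact: mkjet_lev.
move=> l; have E2 := lev_chart x.2 (lift ord0 l).
rewrite -E2 -vsval_hcontract; congr vsval.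
exact: (HB l (ltn_ord l)).
Qed.

Lemma lsubmx_smooth (V : normedModType R) n p (f : V -> 'rV[R]_(n + p)) x :
  smooth_row f x -> smooth_row (fun y => lsubmx (f y)) x.
Proof.
by move=> sf; apply: (@smooth_row_comp R V (n + p) n lsubmx f x) => //; exact: smooth_row_lin.
Qed.

Section KeyLemma.
Variables (m k : nat) (c : chart R G d).
Hypothesis Ac : atlas c.
Variables (Phi U : 'rV[R]_(d + N m) -> 'rV[R]_(d + N m)) (r0 C : 'rV[R]_(d + N m)).
Hypotheses (sPhi : smooth_row Phi r0) (sU : smooth_row U r0).
Hypothesis cPhi : cim c (lsubmx (Phi r0)).
Hypothesis HC : \forall r \near r0, inH k c (Phi r) ('d Phi r C).
Hypothesis HU : \forall r \near r0, inH k c (Phi r) ('d Phi r (U r)).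

(** The V_1 component of a horizontal vector; [vsproj] only serves to define it on all vectors. *)
Definition vpart (r u : 'rV[R]_(d + N m)) : subvs_of V1 :=
  vsproj V1 (lie_coord c (cinv c (lsubmx r)) (lsubmx u)).

Lemma vpartP r u v : cim c (lsubmx r) ->
  lsubmx u = linv_field c (vsval v) (cinv c (lsubmx r)) -> vpart r u = v.
Proof.
move=> cr; rewrite /vpart => ->; have [cr' _] := cinvP (atlas_chart Ac) cr.
by rewrite lie_coordK // vsvalK.
Qed.

Lemma vpart_smooth (X : 'rV[R]_(d + N m) -> 'rV[R]_(d + N m)) i :
  smooth_row X r0 -> smooth_at (fun r => coordf i (vpart (Phi r) (X r)) : R) r0.
Proof.
move=> sX.
have s := @lie_coord_smooth R G c _ (fun y => lsubmx (Phi y)) (fun y => lsubmx (X y)) r0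
  Ac cPhi (lsubmx_smooth sPhi) (lsubmx_smooth sX).
have := smooth_at_comp (@smooth_at_lin R d (coordf i \o linfun (vsproj V1))%VF _) s.
by apply: near_eq_smooth_at; near=> r; rewrite /= comp_lfunE (lfunE (vsproj V1)).
Unshelve. all: by end_near. Qed.

Let b := cinv c (lsubmx (Phi r0)).
Let v r := vpart (Phi r) ('d Phi r C).
Let w r := vpart (Phi r) ('d Phi r (U r)).
Let E := 'd U r0 C.
Let vi i r : R := coordf i (v r).
Let wi i r : R := coordf i (w r).

Let ncim : \forall r \near r0, cim c (lsubmx (Phi r)).
Proof.
exact: (@near_continuous _ _ (fun r => lsubmx (Phi r)) r0 _
  (smooth_row_continuous (lsubmx_smooth sPhi)) (near_cim (atlas_chart Ac) cPhi)).
Qed.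

Let sdC : smooth_row (fun r => 'd Phi r C) r0.
Proof. exact: smooth_row_diff. Qed.

Let sdU : smooth_row (fun r => 'd Phi r (U r)) r0.
Proof.
move=> j; have s : smooth_at (fun r => \sum_i U r 0 i * 'd Phi r 'e_i 0 j) r0.
  apply: smooth_at_sum => i _; apply: smooth_atM; first exact: sU.
  exact: smooth_row_diff.
apply: near_eq_smooth_at s; near=> r.
rewrite [in RHS](row_sum_delta (U r)) linear_sum summxE.
by apply: eq_bigr => i _; rewrite linearZ mxE.
Unshelve. all: by end_near. Qed.

Let svi i : smooth_at (vi i) r0. Proof. exact: vpart_smooth. Qed.
Let swi i : smooth_at (wi i) r0. Proof. exact: vpart_smooth. Qed.

Let HC' : \forall r \near r0, lsubmx ('d Phi r C) = linv_field c (vsval (v r)) (cinv c (lsubmx (Phi r)))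
  /\ forall l, (l < k)%N -> lev l (rsubmx ('d Phi r C)) = hcontract W l (v r) (lev l.+1 (rsubmx (Phi r))).
Proof.
apply: filterS2 ncim HC => r cr [v' [E1 E2]].
by rewrite /v (vpartP cr E1).
Qed.

Let HU' : \forall r \near r0, lsubmx ('d Phi r (U r)) = linv_field c (vsval (w r)) (cinv c (lsubmx (Phi r)))
  /\ forall l, (l < k)%N -> lev l (rsubmx ('d Phi r (U r))) = hcontract W l (w r) (lev l.+1 (rsubmx (Phi r))).
Proof.
apply: filterS2 ncim HU => r cr [v' [E1 E2]].
by rewrite /w (vpartP cr E1).
Qed.

(** The V_1 parts [v] and [w] of the images of [C] and [U] vary with the point; this is U(v) - C(w),
    the part of the bracket of the images that comes from their variation. *)
Let delta : subvs_of V1 := \sum_i ('d (vi i) r0 (U r0) - 'd (wi i) r0 C : R) *: bvec i.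

Let dPhi := smooth_row_near sPhi.

Let lin_diff (L : {linear 'rV[R]_(d + N m) -> R^o}) r u : differentiable Phi r ->
  'd (fun r => L (Phi r) : R) r u = L ('d Phi r u).
Proof. by move=> dr; exact: (diff_lin_comp L u dr). Qed.

(** The commutator identity for g = mu(level l of Phi). The contact equation writes its derivatives
    along [C] and [U] through the contractions of level l + 1 by a basis of V_1, which are the
    g_i. *)
Let levelpart l : (l < k)%N ->
  lev l (rsubmx ('d Phi r0 E)) + hcontract W l delta (lev l.+1 (rsubmx (Phi r0)))
  + (hcontract W l (v r0) (lev l.+1 (rsubmx ('d Phi r0 (U r0))))
     - hcontract W l (w r0) (lev l.+1 (rsubmx ('d Phi r0 C)))) = 0.
Proof.
move=> lk; apply: hom_sep => mu.
pose L : {linear 'rV[R]_(d + N m) -> R^o} := mu \o (@lev m l \o rsubmx).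
pose Li i : {linear 'rV[R]_(d + N m) -> R^o} :=
  mu \o (hcontract W l (bvec i) \o (@lev m l.+1 \o rsubmx)).
have sL (M : {linear 'rV[R]_(d + N m) -> R^o}) : smooth_at (fun r => M (Phi r) : R) r0.
  exact: (smooth_at_comp (@smooth_at_lin R _ M _) sPhi).
have suml (x : subvs_of V1) B :
    mu (hcontract W l x B) = \sum_i (coordf i x : R) * mu (hcontract W l (bvec i) B).
  rewrite {1}[x]bvec_sum.
  have -> : hcontract W l (\sum_i coordf i x *: bvec i) B =
      \sum_i coordf i x *: hcontract W l (bvec i) B.
    pose h : {linear subvs_of V1 -> HD l} := HB.pack (fun v => hcontract W l v B)
      (GRing.isLinear.Build R (subvs_of V1) (HD l) _ _ (hcontract_linearl B)).
    rewrite -[LHS]/(h _) linear_sum; apply: eq_bigr => i _; exact: linearZ.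
  by rewrite linear_sum; apply: eq_bigr => i _; rewrite linearZ.
have EC : \forall r \near r0, 'd (fun r => L (Phi r) : R) r C = \sum_i vi i r * Li i (Phi r).
  apply: filterS2 dPhi HC' => r dr [_ /(_ l lk) H].
  by apply: etrans (lin_diff L C dr) _; rewrite /L /= H suml.
have EU : \forall r \near r0, 'd (fun r => L (Phi r) : R) r (U r) = \sum_i wi i r * Li i (Phi r).
  apply: filterS2 dPhi HU' => r dr [_ /(_ l lk) H].
  by apply: etrans (lin_diff L (U r) dr) _; rewrite /L /= H suml.
have AL := constant_field_commutator (sL L) (fun i => sL (Li i)) svi swi sU EC EU.
have d0 := nbhs_singleton dPhi.
have F1 : 'd (fun r => L (Phi r) : R) r0 E = mu (lev l (rsubmx ('d Phi r0 E))) :=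
  lin_diff L E d0.
have F2 i u : 'd (fun r => Li i (Phi r) : R) r0 u =
  mu (hcontract W l (bvec i) (lev l.+1 (rsubmx ('d Phi r0 u)))) := lin_diff (Li i) u d0.
have cb i : coordf i delta = 'd (vi i) r0 (U r0) - 'd (wi i) r0 C.
  exact: coordf_comb.
rewrite !linearD linearN /= !suml.
have G1 : \sum_i ('d (vi i) r0 (U r0) - 'd (wi i) r0 C) * Li i (Phi r0) =
    \sum_i coordf i delta * mu (hcontract W l (bvec i) (lev l.+1 (rsubmx (Phi r0)))).
  by apply: eq_bigr => i _; rewrite cb.
have G2 : \sum_i (vi i r0 * 'd (fun r => Li i (Phi r) : R) r0 (U r0) -
      wi i r0 * 'd (fun r => Li i (Phi r) : R) r0 C) =
    \sum_i coordf i (v r0) * mu (hcontract W l (bvec i) (lev l.+1 (rsubmx ('d Phi r0 (U r0)))))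
    - \sum_i coordf i (w r0) * mu (hcontract W l (bvec i) (lev l.+1 (rsubmx ('d Phi r0 C)))).
  by rewrite -sumrB; apply: eq_bigr => i _; rewrite !F2.
have arith (A A' B B' D D' : R) : A + B + D = 0 -> A = A' -> B = B' -> D = D' ->
  A' + B' + D' = 0 by move=> + <- <- <-.
exact: arith AL F1 G1 G2.
Qed.

(** The commutator identity for a coordinate translated to [b], composed with the base part of Phi;
    the g_i are its derivatives along a basis of V_1. Their second order terms assemble into the
    bracket, which by left invariance is computed at the identity. *)
Let basepart : lie_coord c b (lsubmx ('d Phi r0 E)) + vsval delta
  + lie_bracket (vsval (w r0)) (vsval (v r0)) = 0.
Proof.
have [cb bK] := cinvP (atlas_chart Ac) cPhi; rewrite -/b in cb bK.
set z := lie_coord _ _ _.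
apply/rowP => j; rewrite [LHS]mxE [X in X + _]mxE [RHS]mxE lie_bracketE.
pose psi := tcoord b j.
have spsi : smooth_fun psi b by exact: tcoord_smooth.
pose psi_i i : G -> R := deriv_at (vsval (bvec i : subvs_of V1)) psi.
have spsi_i i : smooth_fun (psi_i i) b by exact: smooth_fun_deriv.
pose bs r := cinv c (lsubmx (Phi r)).
have sbs (f : G -> R) : smooth_fun f b -> smooth_at (fun r => f (bs r)) r0.
  move=> sf; have := sf c Ac cb; rewrite bK => sfc.
  exact: (@smooth_at_comp R _ _ (f \o cinv c) (fun r => lsubmx (Phi r)) r0 sfc (lsubmx_smooth sPhi)).
have dbs (f : G -> R) : smooth_fun f b -> \forall r \near r0, forall u x,
    lsubmx ('d Phi r u) = linv_field c x (bs r) -> 'd (fun r => f (bs r)) r u = deriv_at x f (bs r).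
  move=> sf; have := sf c Ac cb; rewrite bK => sfc.
  have ndf := @near_continuous _ _ (fun r => lsubmx (Phi r)) r0 _
    (smooth_row_continuous (lsubmx_smooth sPhi)) (smooth_at_near sfc).
  apply: filterS3 ndf ncim dPhi => r df cr dr u x Eu.
  have [cr' rK] := cinvP (atlas_chart Ac) cr.
  have dl : differentiable (fun r => lsubmx (Phi r)) r.
    exact: (differentiable_comp dr (differentiable_lsubmx _)).
  have D := congr1 (fun h => h u) (diff_comp dl df).
  have Dl : 'd (fun r => lsubmx (Phi r)) r u = lsubmx ('d Phi r u) := diff_lin_comp lsubmx u dr.
  have df' : differentiable (f \o cinv c) (cmap c (bs r)) by rewrite rK.
  have F := deriv_at_chart x Ac cr' df'; rewrite rK in F.
  apply: etrans D _; apply: etrans (esym F); congr ('d _ _ _).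
  by rewrite Dl Eu.
have suml (x : subvs_of V1) (f : G -> R) q : deriv_at (vsval x) f q =
    \sum_i (coordf i x : R) * deriv_at (vsval (bvec i : subvs_of V1)) f q.
  have -> : vsval x = \sum_i (coordf i x : R) *: vsval (bvec i : subvs_of V1).
    rewrite {1}[x]bvec_sum linear_sum; apply: eq_bigr => i _; exact: linearZ.
  exact: deriv_at_suml.
have EC : \forall r \near r0, 'd (fun r => psi (bs r)) r C = \sum_i vi i r * psi_i i (bs r).
  apply: filterS2 (dbs psi spsi) HC' => r H [Ev _].
  by rewrite (H _ _ Ev) suml.
have EU : \forall r \near r0, 'd (fun r => psi (bs r)) r (U r) = \sum_i wi i r * psi_i i (bs r).
  apply: filterS2 (dbs psi spsi) HU' => r H [Ev _].
  by rewrite (H _ _ Ev) suml.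
have AL := constant_field_commutator (sbs psi spsi) (fun i => sbs _ (spsi_i i)) svi swi sU EC EU.
have Ez : lsubmx ('d Phi r0 E) = linv_field c z (bs r0) by rewrite /z linv_field_coord.
have [Ev _] := nbhs_singleton HC'; have [Ew _] := nbhs_singleton HU'.
have F1 : 'd (fun r => psi (bs r)) r0 E = z 0 j.
  by apply: etrans (nbhs_singleton (dbs psi spsi) _ _ Ez) _; exact: deriv_tcoord.
have F2 i : 'd (fun r => psi_i i (bs r)) r0 (U r0) =
    deriv_at (vsval (w r0)) (deriv_at (vsval (bvec i : subvs_of V1)) (coord1 j)) (lie_one G).
  by apply: etrans (nbhs_singleton (dbs _ (spsi_i i)) _ _ Ew) _; exact: deriv2_tcoord.
have F3 i : 'd (fun r => psi_i i (bs r)) r0 C =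
    deriv_at (vsval (v r0)) (deriv_at (vsval (bvec i : subvs_of V1)) (coord1 j)) (lie_one G).
  by apply: etrans (nbhs_singleton (dbs _ (spsi_i i)) _ _ Ev) _; exact: deriv2_tcoord.
have G1 : \sum_i ('d (vi i) r0 (U r0) - 'd (wi i) r0 C) * psi_i i (bs r0) = vsval delta 0 j.
  rewrite /delta linear_sum summxE; apply: eq_bigr => i _.
  by rewrite linearZ mxE; congr (_ * _); exact: deriv_tcoord.
have sum2 (x y : subvs_of V1) :
    \sum_i (coordf i x : R) * deriv_at (vsval y) (deriv_at (vsval (bvec i : subvs_of V1)) (coord1 j)) (lie_one G)
    = deriv_at (vsval y) (deriv_at (vsval x) (coord1 j)) (lie_one G).
  rewrite -deriv_at_sum; last by move=> i; apply: smooth_fun_deriv; exact: coord1_smooth.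
  by congr deriv_at; apply/funext => q; rewrite [RHS]suml.
have G2 : \sum_i (vi i r0 * 'd (fun r => psi_i i (bs r)) r0 (U r0) -
      wi i r0 * 'd (fun r => psi_i i (bs r)) r0 C) =
    deriv_at (vsval (w r0)) (deriv_at (vsval (v r0)) (coord1 j)) (lie_one G) -
    deriv_at (vsval (v r0)) (deriv_at (vsval (w r0)) (coord1 j)) (lie_one G).
  by rewrite -!sum2 -sumrB; apply: eq_bigr => i _; rewrite F2 F3.
have arith (A A' B B' D D' : R) : A + B + D = 0 -> A = A' -> B = B' -> D = D' ->
  A' + B' + D' = 0 by move=> + <- <- <-.
exact: arith AL F1 G1 G2.
Qed.

(** This is dPhi([C, U]) = [dPhi C, dPhi U] in the left-invariant frame and level by level. Since
    [C] is constant, [C, U] is the derivative of [U] along [C]. *)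
Lemma contact_commutator : exists dl : subvs_of V1,
  lie_coord c b (lsubmx ('d Phi r0 E)) + vsval dl
    + lie_bracket (vsval (w r0)) (vsval (v r0)) = 0 /\
  forall l, (l < k)%N ->
    lev l (rsubmx ('d Phi r0 E)) + hcontract W l dl (lev l.+1 (rsubmx (Phi r0)))
    + (hcontract W l (v r0) (lev l.+1 (rsubmx ('d Phi r0 (U r0))))
     - hcontract W l (w r0) (lev l.+1 (rsubmx ('d Phi r0 C)))) = 0.
Proof. by exists delta; split; [exact: basepart|exact: levelpart]. Qed.

End KeyLemma.
End JetCoordinates.

(** * Horizontal and vertical vectors; contact maps in charts *)

Section ContactMaps.
Variables (R : realType) (G : lieGroup R) (V1 : {vspace lie_alg G}) (W : vectType R).
Local Notation d := (lie_dim G).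
Local Notation atlas := (lie_atlas G).
Local Notation HD k := (HD V1 W k).
Local Notation N m := (HDle_dim V1 W m).
Local Notation jchart m c := (jet_chart V1 W m c).
Local Notation jatlas m := (@jet_atlas R G V1 W m).

Definition hcontractl l (B : HD l.+1) (v : subvs_of V1) : HD l := hcontract W l v B.

HB.instance Definition _ l B := GRing.isLinear.Build R (subvs_of V1) (HD l) _
  (@hcontractl l B) (hcontract_linearl B).

Lemma hcontract0l l (B : HD l.+1) : hcontract W l 0 B = 0.
Proof. exact: (linear0 (hcontractl B)). Qed.

Lemma hcontractNl l v (B : HD l.+1) : hcontract W l (- v) B = - hcontract W l v B.
Proof. exact: (linearN (hcontractl B)). Qed.

Lemma hcontractZl l a v (B : HD l.+1) : hcontract W l (a *: v) B = a *: hcontract W l v B.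
Proof. by rewrite -[LHS]/(hcontractl B (a *: v)) linearZ. Qed.

(** The space HD l depends on l, so [C] is transported along an equality of levels and replaced by 0
    elsewhere; this confines the casts to one place. *)
Definition at_lev m (C : HD m) l : HD l :=
  match PeanoNat.Nat.eq_dec m l with
  | left e => eq_rect m (fun k => HD k : Type) C l e
  | right _ => 0
  end.

Lemma at_lev_same m (C : HD m) : at_lev C m = C.
Proof.
rewrite /at_lev; case: PeanoNat.Nat.eq_dec => // E.
by rewrite (eq_irrelevance E (erefl m)).
Qed.

Lemma at_lev_neq m (C : HD m) l : m <> l -> at_lev C l = 0.
Proof. by move=> ml; rewrite /at_lev; case: PeanoNat.Nat.eq_dec. Qed.

Lemma at_lev_linear m l : linear (fun C : HD m => at_lev C l).
Proof.
move=> a C C'; rewrite /at_lev; case: PeanoNat.Nat.eq_dec => [E|_].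
  by case: l / E.
by rewrite scaler0 addr0.
Qed.

Lemma mkjet_lin m (B B' : forall k, HD k) a :
  mkjet m (fun k => a *: B k + B' k) = a *: mkjet m B + mkjet m B'.
Proof. by apply: lev_inj => k km; rewrite linearP /= !lev_mkjet. Qed.

Lemma eq_mkjet m (B B' : forall k, HD k) : (forall k, (k < m.+1)%N -> B k = B' k) ->
  mkjet m B = mkjet m B'.
Proof. by move=> H; apply: lev_inj => k km; rewrite !lev_mkjet // H. Qed.

Definition vert m k (C : HD k) : 'rV[R]_(d + N m) := row_mx 0 (mkjet m (at_lev C)).

Lemma lev_vert m k (C : HD k) l : (l < m.+1)%N -> lev l (rsubmx (vert m C)) = at_lev C l.
Proof. by move=> lm; rewrite row_mxKr lev_mkjet. Qed.

(** The levels below [k] are forced by the contact equations. The others are kept constant, so that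
    differentiating along a vertical vector sees only the contractions. *)
Definition Hfield m k (c : chart R G d) (w : subvs_of V1) (B : forall l, HD l)
    (r : 'rV[R]_(d + N m)) : 'rV[R]_(d + N m) :=
  row_mx (linv_field c (vsval w) (cinv c (lsubmx r)))
    (mkjet m (fun l => if (l < k)%N then hcontract W l w (lev l.+1 (rsubmx r)) else B l)).

Lemma lev_Hfield m k c w B r l : (l < m.+1)%N -> lev l (rsubmx (@Hfield m k c w B r)) =
  if (l < k)%N then hcontract W l w (lev l.+1 (rsubmx r)) else B l.
Proof. by move=> lm; rewrite row_mxKr lev_mkjet. Qed.

Lemma inH_Hfield m k c w B r : (k <= m)%N -> inH k c r (@Hfield m k c w B r).
Proof.
move=> km; exists w; split; first by rewrite row_mxKl.
by move=> l lk; rewrite lev_Hfield ?lk // ltnS (leq_trans (ltnW lk) km).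
Qed.

Lemma HfieldP m k c r u w : lsubmx u = linv_field c (vsval w) (cinv c (lsubmx r)) ->
  (forall l, (l < k)%N -> lev l (rsubmx u) = hcontract W l w (lev l.+1 (rsubmx r))) ->
  u = @Hfield m k c w (fun l => lev l (rsubmx u)) r.
Proof.
move=> E1 E2; rewrite /Hfield -E1 -[LHS]hsubmxK; congr row_mx.
apply: lev_inj => l lm; rewrite lev_mkjet //.
by case: ifP => // /E2.
Qed.

Lemma inH_lin m k c (r u u' : 'rV[R]_(d + N m)) a :
  inH k c r u -> inH k c r u' -> inH k c r (a *: u + u').
Proof.
move=> [v [E1 E2]] [v' [E1' E2']]; exists (a *: v + v'); split.
  have -> : vsval (a *: v + v') = a *: vsval v + vsval v' by exact: linearP.
  have -> : lsubmx (a *: u + u') = a *: lsubmx u + lsubmx u' by exact: linearP.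
  by rewrite E1 E1' !linv_mxE mulmxDl -scalemxAl.
move=> l lk.
have -> : lev l (rsubmx (a *: u + u')) = a *: lev l (rsubmx u) + lev l (rsubmx u').
  by rewrite !linearP.
by rewrite E2 // E2' // hcontract_linearl.
Qed.

Lemma Hfield_smooth m k c w B (r0 : 'rV[R]_(d + N m)) : atlas c -> cim c (lsubmx r0) ->
  smooth_row (@Hfield m k c w B) r0.
Proof.
move=> Ac cr; have [cr' rK] := cinvP (atlas_chart Ac) cr.
apply: smooth_row_mx.
  have sl := linv_smooth (vsval w) Ac cr'; rewrite rK in sl.
  apply: (@smooth_row_comp R _ _ _ (fun x => linv_field c (vsval w) (cinv c x)) lsubmx) => //.
  exact: smooth_row_lin.
move=> j; pose l : 'I_m.+1 := tagnat.sig1 j.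
have E r : mkjet m (fun l => if (l < k)%N then hcontract W l w (lev l.+1 (rsubmx r)) else B l) 0 j
  = vcoord (if (l < k)%N then hcontract W l w (lev l.+1 (rsubmx r)) else B l) 0 (tagnat.sig2 j).
  by rewrite /mkjet mxE.
case lk : (l < k)%N.
  pose L : {linear 'rV[R]_(d + N m) -> R^o} := mxcoord 0 (tagnat.sig2 j) \o
    (@vcoord R (HD l) \o (hcontract W l w \o (@lev R G V1 W m l.+1 \o rsubmx))).
  apply: near_eq_smooth_at (@smooth_at_lin R _ L r0); near=> r.
  by rewrite E lk.
apply: near_eq_smooth_at (smooth_at_cst (vcoord (B l) 0 (tagnat.sig2 j)) r0); near=> r.
by rewrite E lk.
Unshelve. all: by end_near. Qed.

Lemma diff_Hfield m k c w B (r0 : 'rV[R]_(d + N m)) (C : HD m) :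
  atlas c -> cim c (lsubmx r0) ->
  'd (@Hfield m k c w B) r0 (vert m C) =
  row_mx 0 (mkjet m (fun l => if (l < k)%N then hcontract W l w (at_lev C l.+1) else 0)).
Proof.
move=> Ac cr; have s := Hfield_smooth k w B Ac cr.
apply: diff_along; first exact: smooth_row_differentiable.
move=> t; rewrite /Hfield [X in _ = _ + X]scale_row_mx [RHS]add_row_mx scaler0 addr0.
have E1 : lsubmx (r0 + t *: vert m C) = lsubmx r0.
  by rewrite linearD linearZ /= row_mxKl scaler0 addr0.
rewrite E1; congr row_mx; apply: etrans (etrans (mkjet_lin m _ _ t) (addrC _ _)).
apply: eq_mkjet => l lm.
case: ifP => lk; last by rewrite scaler0 add0r.
rewrite !linearD !linearZ /= addrC; congr (_ *: _ + _).
have [lm'|lm'] := boolP (l < m)%N; first by rewrite lev_vert.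
(* At the top level both sides are 0 by the default values: [lev m.+1] is null, and [C] has no
   component at level m + 1. *)
have El : l = m by apply/eqP; rewrite eqn_leq -ltnS lm leqNgt.
rewrite at_lev_neq ?linear0; last first.
  by move=> E; have /eqP := etrans El E; rewrite eqn_leq ltnn andbF.
have -> : lev l.+1 (rsubmx (vert m C)) = 0; last by rewrite linear0.
by rewrite /lev; case: pselect => // H; exfalso; move: H; rewrite El ltnn.
Qed.

Lemma inH_vert m k c (r : 'rV[R]_(d + N m)) (C : HD m) : (k <= m)%N -> inH k c r (vert m C).
Proof.
move=> km; exists 0; split.
  by rewrite row_mxKl linear0 linv_mxE mul0mx.
move=> l lk; have lm : (l < m)%N by exact: leq_trans lk km.
rewrite lev_vert ?ltnS 1?ltnW // at_lev_neq; last first.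
  by move=> E; move: lm; rewrite E ltnn.
by rewrite hcontract0l.
Qed.

Lemma is_chart_HDle m : is_chart (HDle_chart V1 W m).
Proof.
split.
  move=> A _; apply: functional_extensionality_dep => k /=.
  by rewrite mxrowK vcoordK.
have -> : cim (HDle_chart V1 W m) = setT; last exact: openT.
apply/seteqP; split => // r _; exists (fun k : 'I_m.+1 => lev k r) => //=.
exact: mkjet_lev.
Qed.

Lemma is_chart_jet m c : atlas c -> is_chart (jchart m c).
Proof. by move=> Ac; apply: is_chart_prod; [exact: atlas_chart|exact: is_chart_HDle]. Qed.

Lemma cim_jet m c (r : 'rV[R]_(d + N m)) : cim (jchart m c) r <-> cim c (lsubmx r).
Proof.
split=> [/cim_prod[]//|cr]; apply/cim_prod; split => //.
exists (fun k : 'I_m.+1 => lev k (rsubmx r)) => //=; exact: mkjet_lev.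
Qed.

Section Local.
Variables (m : nat) (F F' : jet V1 W m -> jet V1 W m).
Hypotheses (sF : smooth_map (jatlas m) (jatlas m) F)
  (sF' : smooth_map (jatlas m) (jatlas m) F')
  (FK : cancel F F') (ctF : contact F).

Definition locrep (H : jet V1 W m -> jet V1 W m) c c' :=
  cmap (jchart m c') \o H \o cinv (jchart m c).

Variables (c c' : chart R G d) (Ac : atlas c) (Ac' : atlas c').

Lemma locrep_smooth H x : smooth_map (jatlas m) (jatlas m) H ->
  cdom c x.1 -> cdom c' (H x).1 ->
  (\forall r \near cmap (jchart m c) x, cim c (lsubmx r) /\ cdom c' (H (cinv (jchart m c) r)).1) /\
  smooth_row (locrep H c c') (cmap (jchart m c) x).
Proof.
move=> sH cx cHx.
have jc : jatlas m (jchart m c) by exists c.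
have jc' : jatlas m (jchart m c') by exists c'.
have px : cdom (jchart m c) x by split.
have pHx : cdom (jchart m c') (H x) by split.
have [n s] := smooth_mapP sH (is_chart_jet m Ac) jc jc' px pHx.
by split => //; apply: filterS n => r [/cim_jet ? []].
Qed.

Lemma locrep_contact r u : cim c (lsubmx r) -> cdom c' (F (cinv (jchart m c) r)).1 ->
  inH m c r u -> inH m c' (locrep F c c' r) ('d (locrep F c c') r u).
Proof.
move=> cr cFr Hu; set x := cinv (jchart m c) r.
have [[cx _] xK] := cinvP (is_chart_jet m Ac) ((cim_jet c r).2 cr).
have cxu : cartan c x u by apply/(cartanP _ Ac cx); rewrite xK.
have T : tangent_map (jchart m c) (jchart m c') F x u = 'd (locrep F c c') r u.
  by rewrite /tangent_map xK.
have H := ctF Ac Ac' cx cFr (imageP (tangent_map (jchart m c) (jchart m c') F x) cxu).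
have H' := eq_ind _ (fun z => cartan c' (F x) z) H _ T.
exact: ((cartanP _ Ac' cFr).1 H').
Qed.

Hypothesis F'K : cancel F' F.

(** The chain rule for F' o F = id, in charts. *)
Lemma locrep_inj x u : cdom c x.1 -> cdom c' (F x).1 ->
  'd (locrep F c c') (cmap (jchart m c) x) u = 0 -> u = 0.
Proof.
move=> cx cFx du0; set r := cmap (jchart m c) x in du0.
have [nr s] := locrep_smooth sF cx cFx.
have jc : jatlas m (jchart m c) by exists c.
have jc' : jatlas m (jchart m c') by exists c'.
have pF'x : cdom (jchart m c) (F' (F x)) by rewrite FK; split.
have pFx : cdom (jchart m c') (F x) by split.
have [n' s'] := smooth_mapP sF' (is_chart_jet m Ac') jc' jc pFx pF'x.
have Er : locrep F c c' r = cmap (jchart m c') (F x).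
  have px : cdom (jchart m c) x by split.
  exact: (congr1 (fun z => cmap (jchart m c') (F z)) (cmapK (is_chart_jet m Ac) px)).
have d1 := smooth_row_differentiable s.
have d2 : differentiable (cmap (jchart m c) \o F' \o cinv (jchart m c')) (locrep F c c' r).
  by rewrite Er; exact: smooth_row_differentiable.
have D := congr1 (fun h => h u) (diff_comp d1 d2).
have D0 := etrans D (etrans (congr1 ('d _ (locrep F c c' r)) du0) (linear0 _)).
have nE : {near r, id =1 (cmap (jchart m c) \o F' \o cinv (jchart m c')) \o locrep F c c'}.
  apply: filterS nr => y [cy cFy].
  have [_ yK] := cinvP (is_chart_jet m Ac) ((cim_jet c y).2 cy).
  have pFy : cdom (jchart m c') (F (cinv (jchart m c) y)) by split.
  have E := cmapK (is_chart_jet m Ac') pFy.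
  by rewrite [RHS](congr1 (fun z => cmap (jchart m c) (F' z)) E) FK yK.
have di : differentiable (@id 'rV[R]_(d + N m)) r by exact: ex_diff.
have E := congr1 (fun h => h u) (near_eq_diff nE di).2.
have Du := congr1 (fun h => h u) (@diff_val _ _ _ _ _ _ _ (is_diff_id r)).
exact: (etrans (esym Du) (etrans (esym E) D0)).
Qed.

End Local.
End ContactMaps.

(** * Vertical directions are preserved *)

Lemma coordf_bvec (R : realType) (V : vectType R) (i j : 'I_(\dim {:V})) :
  coordf i (bvec j : V) = (i == j)%:R.
Proof. by rewrite coordfE [vcoord _]vpointK mxE eqxx. Qed.

(** * Dimensions of the spaces HD^k *)

Section HorizontalDimensions.
Variables (R : realType) (G : lieGroup R) (V1 : {vspace lie_alg G}) (W : vectType R).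
Local Notation HD k := (HD V1 W k).
Local Notation n := (\dim {:subvs_of V1}).

Lemma hcontract_lker k (v : subvs_of V1) : v != 0 ->
  (\dim (lker (hcontract W k v)) + \dim {:HD k} = \dim {:HD k.+1})%N.
Proof.
move=> v0; rewrite -(limg_ker_dim (hcontract W k v) fullv) capfv; congr addn.
congr (\dim _); apply: subv_anti; rewrite subvf andbT; apply/subvP => B _.
by have [A <-] := hcontract_surj v0 B; apply: memv_img; exact: memvf.
Qed.

Lemma HD_dim_mono k (v : subvs_of V1) : v != 0 -> (\dim {:HD k} <= \dim {:HD k.+1})%N.
Proof. by move=> /(hcontract_lker k) <-; exact: leq_addl. Qed.

(** Tensoring with the nonzero [w] embeds the dual of V_1; [th] parametrises this dual by V_1
    through the coordinate forms. *)
Lemma HD1_dim (w : W) : w != 0 -> (n <= \dim {:HD 1})%N.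
Proof.
move=> w0; pose th (x : subvs_of V1) : HD 1 :=
  vsproj _ (\sum_i (coordf i x : R) *: (tens (coordf i) w : multilin V1 W 1)).
have th_lin : linear th.
  move=> a x y; rewrite /th -linearP; congr vsproj.
  rewrite scaler_sumr -big_split /=; apply: eq_bigr => i _.
  by rewrite linearP /= scalerDl scalerA.
pose T := linfun (HB.pack_for {linear subvs_of V1 -> HD 1} th
  (GRing.isLinear.Build R (subvs_of V1) (HD 1) _ th th_lin)).
have TE x : T x = th x by rewrite lfunE.
rewrite -(@limg_dim_eq _ _ _ T fullv) ?dimvS ?subvf //.
apply/eqP; rewrite capfv -subv0; apply/subvP => x; rewrite memv_ker TE memv0 => /eqP tx.
apply/eqP; apply: coordf_inj => j.
have E : \sum_i (coordf i x : R) *: (tens (coordf i) w : multilin V1 W 1) = 0.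
  have := congr1 vsval tx; rewrite /th vsprojK ?linear0 // HD1_full; exact: memvf.
have := congr1 (fun A : 'Hom(subvs_of V1, W) => A (bvec j)) E.
rewrite zero_lfunE sum_lfunE (bigD1 j) //= big1 => [|i ij].
  rewrite addr0 scale_lfunE tensE coordf_bvec eqxx scale1r => /eqP.
  by rewrite scaler_eq0 (negbTE w0) orbF => /eqP.
by rewrite scale_lfunE tensE coordf_bvec (negbTE ij) scale0r scaler0.
Qed.

(** With two coordinates available, the square of the first coordinate form is a nonzero element
    killed by contraction with the second basis vector. Contraction onto HD^1 thus has a kernel. *)
Lemma HD2_dim (w : W) : (1 < n)%N -> w != 0 -> (\dim {:HD 1} < \dim {:HD 2})%N.
Proof.
move=> n1 w0.
pose i0 : 'I_n := Ordinal (ltnW n1); pose i1 : 'I_n := Ordinal n1.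
have [A HA] := HD2_square (coordf i0 : 'Hom(subvs_of V1, R^o)) w.
pose b := bvec i1 : subvs_of V1; pose a := bvec i0 : subvs_of V1.
have b0 : b != 0.
  by apply/eqP => E; have := coordf_bvec i1 i1; rewrite -/b E linear0 eqxx => /esym/eqP; rewrite oner_eq0.
rewrite -(hcontract_lker 1 b0) -[X in (X < _)%N]add0n ltn_add2r lt0n dimv_eq0.
apply/eqP => K0.
have : A \in lker (hcontract W 1 b).
  rewrite memv_ker; apply/eqP; apply: hcontract0_eq0 => x; apply: val_inj => /=.
  by rewrite HA coordf_bvec /= !mulr0 scale0r.
rewrite K0 memv0 => /eqP A0; have := HA a a; rewrite A0 !linear0 !coordf_bvec eqxx !mulr1.
by move=> /esym/eqP; rewrite scaler_eq0 (negbTE w0) orbF pnatr_eq0.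
Qed.

End HorizontalDimensions.

Lemma lie_bracketC (R : realType) (G : lieGroup R) (v w : lie_alg G) :
  lie_bracket v w = - lie_bracket w v.
Proof. by rewrite /lie_bracket opprB. Qed.

Lemma lie_bracketZ (R : realType) (G : lieGroup R) (a : R) (v w : lie_alg G) :
  lie_bracket (a *: v) w = a *: lie_bracket v w.
Proof.
have E f q : deriv_at (a *: v) f q = a * deriv_at v f q.
  by rewrite /deriv_at; exact: linearZ.
apply/rowP => k; have E1 := lie_bracketE (a *: v) w k; have E2 := lie_bracketE v w k.
have E3 : (a *: lie_bracket v w) 0 k = a * lie_bracket v w 0 k by rewrite mxE.
have E4 : deriv_at (a *: v) (coord1 k) = fun q => deriv_at v (coord1 k) q * a.
  by apply/funext => q; rewrite E mulrC.
have E5 := @deriv_at_mulr R G w (deriv_at v (coord1 k)) (lie_one G) a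
  (smooth_fun_deriv v (@coord1_smooth R G k)).
have E6 := E (deriv_at w (coord1 k)) (lie_one G).
have arith (x y z t p q s : R) : x = p - q -> y = a * z -> z = t - s -> p = a * t ->
  q = s * a -> x = y by move=> -> -> -> -> ->; rewrite mulrBr (mulrC s).
exact: arith E1 E3 E2 E6 (etrans (congr1 (fun f => deriv_at w f (lie_one G)) E4) E5).
Qed.

(** * Linear algebra of the map induced on V_1 x HD^(m+1) *)

Section VerticalAlgebra.
Variables (R : realType) (G : lieGroup R) (V1 : {vspace lie_alg G}) (W : vectType R).
Local Notation HD k := (HD V1 W k).
Local Notation n := (\dim {:subvs_of V1}).

Section Step.
Variables (m : nat) (S : 'End((subvs_of V1 * HD m.+1)%type)).
Hypothesis Sinj : lker S == 0%VS.
Hypothesis Scomm : forall C w0 B0, hcontract W m w0 C = 0 ->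
  lie_bracket (vsval (S (w0, B0)).1) (vsval (S (0, C)).1) = 0 /\
  hcontract W m (S (0, C)).1 (S (w0, B0)).2 = hcontract W m (S (w0, B0)).1 (S (0, C)).2.

Lemma Ssurj y : exists p, S p = y.
Proof.
have : y \in limg S by rewrite lker0_limgf // memvf.
by move=> /memv_imgP[p _ ->]; exists p.
Qed.

(** Write S(0, C) = (T C, D C). Taking w0 = 0 in [Scomm], the contraction of D C' by T C equals that
    of D C by T C'. If T C1 is nonzero, D embeds ker T into the kernel of contraction by T C1, so
    dim HD^m <= rank T <= dim V_1. Hence T is onto; then T C = 0 annihilates all contractions of D
    C, so T is injective, against dim V_1 < dim HD^(m+1). *)
Lemma vertical_preserved_abelian (w : W) : w != 0 -> (n <= \dim {:HD m})%N ->
  (n < \dim {:HD m.+1})%N -> forall C, (S (0, C)).1 = 0.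
Proof.
move=> w0 nm nm1 C1; apply/eqP; apply: contraT => v0.
pose T_ (C : HD m.+1) := (S (0, C)).1; pose D_ (C : HD m.+1) := (S (0, C)).2.
have pairD a C C' : ((0 : subvs_of V1), a *: C + C') = a *: (0, C) + (0, C') :> (subvs_of V1 * HD m.+1)%type.
  by apply/pair_equal_spec; rewrite /= scaler0 addr0.
have T_lin : linear T_ by move=> a C C'; rewrite /T_ pairD linearP.
have D_lin : linear D_ by move=> a C C'; rewrite /D_ pairD linearP.
pose T := linfun (HB.pack_for {linear HD m.+1 -> subvs_of V1} T_
  (GRing.isLinear.Build R (HD m.+1) (subvs_of V1) _ T_ T_lin)).
pose D := linfun (HB.pack_for {linear HD m.+1 -> HD m.+1} D_
  (GRing.isLinear.Build R (HD m.+1) (HD m.+1) _ D_ D_lin)).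
have TE C : T C = (S (0, C)).1 by rewrite lfunE.
have DE C : D C = (S (0, C)).2 by rewrite lfunE.
have comm C C' : hcontract W m (T C) (D C') = hcontract W m (T C') (D C).
  by rewrite !TE !DE; apply: (Scomm _ _).2; exact: hcontract0l.
have inj C : T C = 0 -> D C = 0 -> C = 0.
  rewrite TE DE => T0 D0; have : (0, C) \in lker S.
    by rewrite memv_ker [S _]surjective_pairing T0 D0.
  by rewrite (eqP Sinj) memv0 => /eqP[].
have dK : \dim (D @: lker T) = \dim (lker T).
  apply: limg_dim_eq; apply/eqP; rewrite -subv0; apply/subvP => C.
  rewrite memv_cap !memv_ker memv0 => /andP[/eqP T0 /eqP D0].
  by rewrite (inj C).
have sub : (D @: lker T <= lker (hcontract W m (T C1)))%VS.
  apply/subvP => _ /memv_imgP[C CT ->]; rewrite memv_ker comm.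
  by move: CT; rewrite memv_ker => /eqP ->; rewrite hcontract0l.
have TC1 : T C1 != 0 by rewrite TE.
have e1 := hcontract_lker W m TC1.
have e2 := limg_ker_dim T fullv; rewrite capfv in e2.
have le1 : (\dim (lker T) <= \dim (lker (hcontract W m (T C1))))%N by rewrite -dK dimvS.
have le2 : (\dim (limg T) <= n)%N by rewrite dimvS // subvf.
have rn : \dim (limg T) = n.
  apply/eqP; rewrite eqn_leq le2 (leq_trans nm) //.
  by rewrite -(leq_add2l (\dim (lker T))) e2 -e1 leq_add2r.
have Tfull : limg T = fullv.
  by apply/eqP; rewrite -(geq_leqif (dimv_leqif_eq (subvf _))) rn.
have K0 : lker T = 0%VS.
  apply/eqP; rewrite -subv0; apply/subvP => C CT.
  have T0 : T C = 0 by move: CT; rewrite memv_ker => /eqP.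
  rewrite memv0 (inj C) //; apply: hcontract0_eq0 => x.
  have : x \in limg T by rewrite Tfull memvf.
  by move=> /memv_imgP[C' _ ->]; rewrite comm T0 hcontract0l.
by move: nm1; rewrite -e2 K0 dimv0 add0n rn ltnn.
Qed.

End Step.

(** For C of the form l tensor w, the relations hold for all (w0, B0) with l(w0) = 0, a subspace of
    codimension at most one. As S is onto, any two vectors of the target have a nontrivial
    combination satisfying them, unless the first already does. Under (A) two vertical vectors with
    independent contractions by v contradict this; under (B) one is vertical and the other has a V_1
    part not commuting with v. *)
Lemma vertical_preserved_rank1 (S : 'End((subvs_of V1 * HD 1)%type)) :
  lker S == 0%VS ->
  (forall C w0 B0, hcontract W 0 w0 C = 0 ->
  lie_bracket (vsval (S (w0, B0)).1) (vsval (S (0, C)).1) = 0 /\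
  hcontract W 0 (S (0, C)).1 (S (w0, B0)).2 = hcontract W 0 (S (w0, B0)).1 (S (0, C)).2) ->
  (1 < \dim {:W})%N \/
   (forall v : lie_alg G, v \in V1 -> v != 0 ->
      exists2 v' : lie_alg G, v' \in V1 & lie_bracket v v' != 0) ->
  forall C, (S (0, C)).1 = 0.
Proof.
move=> Sinj Scomm AB.
have rank1 l (w : W) : (S (0, vsproj _ (tens l w : multilin V1 W 1))).1 = 0.
  set C := vsproj _ _; apply/eqP; apply: contraT; set v := (S (0, C)).1 => v0.
  have CE x : vsval (hcontract W 0 x C) = (l x : R) *: w.
    by rewrite vsval_hcontract vsprojK ?HD1_full ?memvf // -tensE.
  have w0 : w != 0.
    apply: contraNneq v0 => w0; have C0 : C = 0.
      by apply: hcontract0_eq0 => x; apply: val_inj; rewrite /= CE w0 scaler0.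
    have -> : v = (S 0).1 by rewrite /v C0.
    by rewrite linear0.
  have Kcomm p : l p.1 = 0 -> lie_bracket (vsval (S p).1) (vsval v) = 0 /\
     hcontract W 0 v (S p).2 = hcontract W 0 (S p).1 (S (0, C)).2.
    case: p => w0' B0 /= l0; apply: Scomm; apply: val_inj; rewrite /= CE l0.
    by rewrite scale0r.
  (* The coefficients l(p2) and -l(p1) put the combination of the preimages into the kernel of [l].
     If both are 0, the preimage of [y1] lies there by itself. *)
  have combo y1 y2 : exists a b : R, [/\
      lie_bracket (vsval (a *: y1 + b *: y2).1) (vsval v) = 0,
      hcontract W 0 v (a *: y1 + b *: y2).2 = hcontract W 0 (a *: y1 + b *: y2).1 (S (0, C)).2 &
      a = 0 -> b = 0 -> lie_bracket (vsval y1.1) (vsval v) = 0 /\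
         hcontract W 0 v y1.2 = hcontract W 0 y1.1 (S (0, C)).2].
    have [p1 E1] := Ssurj Sinj y1; have [p2 E2] := Ssurj Sinj y2.
    exists (l p2.1), (- (l p1.1)).
    have lk : l ((l p2.1 : R) *: p1 + (- l p1.1 : R) *: p2).1 = 0.
      rewrite /= linearD !linearZ /= -[RHS](subrr ((l p2.1 : R) * l p1.1)).
      by congr (_ + _); rewrite -[LHS]/((- l p1.1 : R) * l p2.1) mulNr mulrC.
    have Sp : S ((l p2.1 : R) *: p1 + (- l p1.1 : R) *: p2) =
        (l p2.1 : R) *: y1 + (- l p1.1 : R) *: y2.
      by rewrite -E1 -E2 linearD; congr (_ + _); exact: linearZ.
    have := Kcomm _ lk; rewrite Sp => -[b1 b2].
    split; [exact: b1|exact: b2|move=> _ /eqP; rewrite oppr_eq0 => /eqP l1].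
    by rewrite -E1; exact: Kcomm l1.
  have [E1 HE1] := hcontract_surj v0 (vsproj _ w : HD 0).
  have memW (z : W) : vsval (vsproj (HDspace V1 W 0) z) = z.
    apply: vsprojK; have := @hderiv_HD R G V1 W (fun=> z) 0 (lie_one G); apply.
    by move=> q mu c _ _; exact: smooth_at_cst.
  case: AB => [W2|B].
    have [z Hz] : exists z : W, forall a b : R, a *: w + b *: z = 0 -> a = 0 /\ b = 0.
      have : ~~ (fullv <= <[w]>)%VS.
        apply/negP => /dimvS; rewrite dim_vline w0 => H.
        by move: (leq_trans W2 H).
      move=> /subvPn[z _ zw]; exists z => a b E.
      have b0 : b = 0.
        apply/eqP; apply: contraNT zw => b0; apply/vlineP; exists (- (a / b)).
        apply: (scalerI b0); rewrite scalerA mulrN mulrCA divff // mulr1 scaleNr.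
        by apply/eqP; rewrite -addr_eq0 addrC E.
      split => //; move: E; rewrite b0 scale0r addr0 => /eqP.
      by rewrite scaler_eq0 (negbTE w0) orbF => /eqP.
    have [E2 HE2] := hcontract_surj v0 (vsproj _ z : HD 0).
    have [a [b [_ H2 H3]]] := combo (0, E1) (0, E2).
    have [|a0 b0] := Hz a b.
      have EX : hcontract W 0 v (a *: E1 + b *: E2) = 0.
        by move: H2; rewrite /= !scaler0 addr0 hcontract0l.
      have EY : hcontract W 0 v (a *: E1 + b *: E2) =
          a *: vsproj (HDspace V1 W 0) w + b *: vsproj (HDspace V1 W 0) z.
        by rewrite -HE1 -HE2 linearD; congr (_ + _); exact: linearZ.
      have EZ : vsval (a *: vsproj (HDspace V1 W 0) w + b *: vsproj (HDspace V1 W 0) z) = a *: w + b *: z.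
        by rewrite -{2}[w]memW -{2}[z]memW linearD; congr (_ + _); exact: linearZ.
      by rewrite -EZ -EY EX linear0.
    have [_] := H3 a0 b0; rewrite /= HE1 hcontract0l => /(congr1 vsval).
    by rewrite memW linear0 => /eqP; rewrite (negbTE w0).
  have [w1 w1V nb] := B (vsval v) (subvsP v) (v0 : vsval v != 0).
  have [a [b [H1 H2 H3]]] := combo (0, E1) (vsproj V1 w1, 0).
  have b0 : b = 0.
    apply/eqP; apply: contraNT nb => b0; move: H1.
    rewrite /= scaler0 add0r => H1.
    move: H1; rewrite vsprojK // lie_bracketZ => /eqP.
    by rewrite scaler_eq0 (negbTE b0) /= lie_bracketC oppr_eq0.
  have a0 : a = 0.
    have EX : hcontract W 0 v (a *: E1) = 0.
      by move: H2; rewrite b0 /= !scaler0 !scale0r !addr0 hcontract0l.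
    have EY : hcontract W 0 v (a *: E1) = a *: vsproj (HDspace V1 W 0) w.
      by rewrite -HE1; exact: linearZ.
    have EZ : vsval (a *: vsproj (HDspace V1 W 0) w) = a *: w.
      by rewrite -{2}[w]memW; exact: linearZ.
    have : a *: w = 0 by rewrite -EZ -EY EX linear0.
    move=> /eqP.
    by rewrite scaler_eq0 (negbTE w0) orbF => /eqP.
  have [_] := H3 a0 b0; rewrite /= HE1 hcontract0l => /(congr1 vsval).
  by rewrite memW linear0 => /eqP; rewrite (negbTE w0).
move=> C.
(* HD^1 is all of Hom(V_1, W), so [C] is a sum of rank one elements, and the claim is additive in
   [C]. *)
have -> : C = \sum_i vsproj _ (tens (coordf i) ((vsval C : 'Hom(subvs_of V1, W)) (bvec i)) : multilin V1 W 1).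
  apply: val_inj; rewrite /= linear_sum [LHS](hom_tens_sum (vsval C : 'Hom(subvs_of V1, W))).
  by apply: eq_bigr => i _; symmetry; exact: (vsprojK (tens_HD1 _ _)).
apply: (big_ind (fun z => (S (0, z)).1 = 0)).
- by have -> : (0, 0) = 0 :> (subvs_of V1 * HD 1)%type by []; rewrite linear0.
- move=> x y Hx Hy; have -> : (0, x + y) = (0, x) + (0, y) :> (subvs_of V1 * HD 1)%type.
    by apply/pair_equal_spec; rewrite /= addr0.
  by rewrite linearD /= Hx Hy addr0.
- by move=> i _; exact: rank1.
Qed.

End VerticalAlgebra.

(** * The induced map of a contact diffeomorphism *)

Section VerticalPreserved.
Variables (R : realType) (G : lieGroup R) (V1 : {vspace lie_alg G}) (W : vectType R).
Local Notation d := (lie_dim G).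
Local Notation atlas := (lie_atlas G).
Local Notation HD k := (HD V1 W k).
Local Notation N m := (HDle_dim V1 W m).
Local Notation jchart m c := (jet_chart V1 W m c).
Local Notation jatlas m := (@jet_atlas R G V1 W m).
Local Notation n := (\dim {:subvs_of V1}).

Hypothesis hV1 : forall a b dl : subvs_of V1,
  vsval dl + lie_bracket (vsval a) (vsval b) = 0 ->
  dl = 0 /\ lie_bracket (vsval a) (vsval b) = 0.

Lemma inH_weaken M k c (r u : 'rV[R]_(d + N M)) : (k <= M)%N -> inH M c r u -> inH k c r u.
Proof. by move=> kM [v [E1 E2]]; exists v; split => // l lk; apply: E2; exact: leq_trans lk kM. Qed.

Lemma linv0 c (p : G) : linv_field c (0 : lie_alg G) p = 0.
Proof. by rewrite linv_mxE mul0mx. Qed.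

Lemma vpart_lin M c (r : 'rV[R]_(d + N M)) : linear (@vpart R G V1 W M c r).
Proof.
move=> a u u'; rewrite /vpart /lie_coord.
have -> : lsubmx (a *: u + u') = a *: lsubmx u + lsubmx u' by exact: linearP.
by rewrite mulmxDl -scalemxAl linearP.
Qed.

Lemma vpart0 M c (r : 'rV[R]_(d + N M)) : @vpart R G V1 W M c r 0 = 0.
Proof. by have := vpart_lin c r (-1) 0 0; rewrite scaler0 addr0 scaleN1r addNr. Qed.

(** The levels below the top of a Cartan vector are contractions by its V_1 part, so that part and
    the top level determine it. *)
Lemma inH_eq0 M c (r u : 'rV[R]_(d + N M)) : atlas c -> cim c (lsubmx r) ->
  inH M c r u -> vpart c r u = 0 -> lev M (rsubmx u) = 0 -> u = 0.
Proof.
move=> Ac cr [v [E1 E2]]; rewrite (vpartP Ac cr E1) => v0 top.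
rewrite -[u]hsubmxK E1 v0 linear0 linv0 -[RHS]row_mx0; congr row_mx.
apply: lev_inj => l; rewrite ltnS leq_eqVlt linear0 => /orP[/eqP -> //|lM].
by rewrite E2 // v0 hcontract0l.
Qed.

Section AtJet.
Variables (m : nat).
Local Notation M := m.+1.
Variables (F F' : jet V1 W M -> jet V1 W M).
Hypotheses (sF : smooth_map (jatlas M) (jatlas M) F)
  (sF' : smooth_map (jatlas M) (jatlas M) F')
  (FK : cancel F F') (ctF : contact F).
Variables (c c' : chart R G d).
Hypotheses (Ac : atlas c) (Ac' : atlas c').
Local Notation Phi := (locrep F c c').

Section AtPoint.
Variable x : jet V1 W M.
Hypotheses (cx : cdom c x.1) (cFx : cdom c' (F x).1).
Local Notation r0 := (cmap (jchart M c) x).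

Lemma cim_r0 : cim c (lsubmx r0).
Proof. by apply/(cim_jet (m := M)); apply: cim_cmap; split. Qed.

Lemma cim_Phi : cim c' (lsubmx (Phi r0)).
Proof.
have px : cdom (jchart M c) x by split.
have pFx : cdom (jchart M c') (F x) by split.
have E : Phi r0 = cmap (jchart M c') (F x).
  exact: (congr1 (fun z => cmap (jchart M c') (F z)) (cmapK (is_chart_jet V1 W M Ac) px)).
by rewrite E; exact: ((cim_jet c' _).1 (cim_cmap pFx)).
Qed.

Lemma sPhi : smooth_row Phi r0.
Proof. exact: (locrep_smooth Ac Ac' sF cx cFx).2. Qed.

Lemma near_contact : \forall r \near r0, forall u, inH M c r u -> inH M c' (Phi r) ('d Phi r u).
Proof.
apply: filterS (locrep_smooth Ac Ac' sF cx cFx).1 => r [cr cFr] u.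
exact: (locrep_contact ctF Ac Ac' cr cFr).
Qed.

Definition commutator_rel k (E dC dU : 'rV[R]_(d + N M)) := exists dl : subvs_of V1,
  lie_coord c' (cinv c' (lsubmx (Phi r0))) (lsubmx ('d Phi r0 E)) + vsval dl
    + lie_bracket (vsval (vpart c' (Phi r0) dU)) (vsval (vpart c' (Phi r0) dC)) = 0 /\
  forall l, (l < k)%N ->
    lev l (rsubmx ('d Phi r0 E)) + hcontract W l dl (lev l.+1 (rsubmx (Phi r0)))
    + (hcontract W l (vpart c' (Phi r0) dC) (lev l.+1 (rsubmx dU))
     - hcontract W l (vpart c' (Phi r0) dU) (lev l.+1 (rsubmx dC))) = 0.

Lemma Hfield_commutator k w0 B0 (C : HD M) : (k <= M)%N ->
  (\forall r \near r0, forall u, inH k c r u -> inH k c' (Phi r) ('d Phi r u)) ->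
  commutator_rel k
   (row_mx 0 (mkjet M (fun l => if (l < k)%N then hcontract W l w0 (at_lev C l.+1) else 0)))
   ('d Phi r0 (vert M C)) ('d Phi r0 (Hfield k c w0 B0 r0)).
Proof.
move=> kM nk.
have HC : \forall r \near r0, inH k c' (Phi r) ('d Phi r (vert M C)).
  by apply: filterS nk => r; apply; exact: inH_vert.
have HU : \forall r \near r0, inH k c' (Phi r) ('d Phi r (Hfield k c w0 B0 r)).
  by apply: filterS nk => r; apply; exact: inH_Hfield.
have sU := Hfield_smooth k w0 B0 Ac cim_r0.
have H := contact_commutator Ac' sPhi sU cim_Phi HC HU.
have D := diff_Hfield k w0 B0 C Ac cim_r0.
exact: (eq_ind _ (fun E => commutator_rel k E ('d Phi r0 (vert M C))
  ('d Phi r0 (Hfield k c w0 B0 r0))) H _ D).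
Qed.

(** Linear parametrisation of the Cartan space at [r0]; [Sfun] reads the image under dPhi in the
    same parameters. *)
Definition Hvec (p : (subvs_of V1 * HD M)%type) : 'rV[R]_(d + N M) := Hfield M c p.1 (at_lev p.2) r0.

Lemma Hvec_lin : linear Hvec.
Proof.
move=> a p q; rewrite /Hvec /Hfield [X in _ = X + _]scale_row_mx [RHS]add_row_mx.
congr row_mx.
  have -> : vsval (a *: p + q).1 = a *: vsval p.1 + vsval q.1 by exact: linearP.
  by rewrite !linv_mxE mulmxDl -scalemxAl.
rewrite -mkjet_lin; apply: eq_mkjet => l lM.
by case: ifP => _; [exact: hcontract_linearl|exact: at_lev_linear].
Qed.

Lemma Hvec0 C : Hvec (0, C) = vert M C.
Proof.
rewrite /Hvec /Hfield /vert linear0 linv0; congr row_mx; apply: eq_mkjet => l lM.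
case: ifP => // lm; rewrite hcontract0l at_lev_neq // => E.
by move: lm; rewrite E ltnn.
Qed.

Definition Sfun p : (subvs_of V1 * HD M)%type :=
  (vpart c' (Phi r0) ('d Phi r0 (Hvec p)), lev M (rsubmx ('d Phi r0 (Hvec p)))).

Lemma Sfun_lin : linear Sfun.
Proof.
move=> a p q; rewrite /Sfun Hvec_lin.
have -> : 'd Phi r0 (a *: Hvec p + Hvec q) = a *: 'd Phi r0 (Hvec p) + 'd Phi r0 (Hvec q).
  exact: linearP.
apply/pair_equal_spec; split; first exact: vpart_lin.
set u := 'd Phi r0 (Hvec p); set u' := 'd Phi r0 (Hvec q).
have -> : rsubmx (a *: u + u') = a *: rsubmx u + rsubmx u' by exact: linearP.
exact: lev_linear.
Qed.

HB.instance Definition _ := GRing.isLinear.Build R (subvs_of V1 * HD M)%type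
  (subvs_of V1 * HD M)%type _ Sfun Sfun_lin.

Definition Smap : 'End((subvs_of V1 * HD M)%type) := linfun Sfun.

Lemma contact_dPhi u : inH M c r0 u -> inH M c' (Phi r0) ('d Phi r0 u).
Proof. exact: (nbhs_singleton near_contact). Qed.

Lemma dPhi_inj u : 'd Phi r0 u = 0 -> u = 0.
Proof. exact: (locrep_inj sF sF' FK Ac Ac' cx cFx). Qed.

Lemma Smap_inj : lker Smap == 0%VS.
Proof.
rewrite -subv0; apply/subvP => -[w C]; rewrite memv_ker memv0 lfunE /= => /eqP E.
have E1 := congr1 fst E; have E2 := congr1 snd E.
have H := inH_eq0 Ac' cim_Phi (contact_dPhi (inH_Hfield c w (at_lev C) r0 (leqnn M))) E1 E2.
have {}H := dPhi_inj H.
have [cr0 _] := cinvP (atlas_chart Ac) cim_r0.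
have w0 : w = 0.
  apply: val_inj; rewrite /= -(lie_coordK (vsval w) Ac cr0).
  have := congr1 lsubmx H; rewrite row_mxKl linear0 => ->.
  by rewrite /lie_coord mul0mx ?linear0.
have C0 : C = 0.
  have := congr1 (fun u => lev M (rsubmx u)) H.
  by rewrite lev_Hfield ?ltnSn // ltnn at_lev_same !linear0.
by rewrite w0 C0.
Qed.

(** When the contraction vanishes, so does the commutator field. The base relation is then an
    element of V_1 plus a bracket, both of which vanish by [hV1]; level [m] becomes the second
    relation. *)
Lemma Smap_comm C w0 B0 : hcontract W m w0 C = 0 ->
  lie_bracket (vsval (Smap (w0, B0)).1) (vsval (Smap (0, C)).1) = 0 /\
  hcontract W m (Smap (0, C)).1 (Smap (w0, B0)).2 = hcontract W m (Smap (w0, B0)).1 (Smap (0, C)).2.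
Proof.
move=> wC; have := Hfield_commutator w0 (at_lev B0) C (leqnn M) near_contact.
have -> : mkjet M (fun l => if (l < M)%N then hcontract W l w0 (at_lev C l.+1) else 0) = 0.
  apply: lev_inj => l lM; rewrite lev_mkjet // linear0; case: ifP => // _.
  have [->|/eqP lm] := eqVneq l m; first by rewrite at_lev_same.
  by rewrite at_lev_neq ?linear0 // => -[] E; apply: lm.
rewrite row_mx0 => -[dl []].
have Z : 'd Phi r0 0 = 0 by exact: linear0.
have ES p : Smap p = Sfun p by rewrite lfunE.
rewrite Z !linear0 {1}/lie_coord mul0mx add0r => H1 H2.
have [dl0 br0] := hV1 H1.
rewrite !ES /Sfun /= Hvec0; split; first exact: br0.
have := H2 m (ltnSn m); rewrite !linear0 dl0 hcontract0l !add0r => /eqP.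
by rewrite subr_eq0 => /eqP.
Qed.

Lemma Smap1 C : (Smap (0, C)).1 = vpart c' (Phi r0) ('d Phi r0 (vert M C)).
Proof. by rewrite lfunE /= Hvec0. Qed.

(** The induced map is an injective endomorphism of a finite-dimensional space, hence onto, and a
    Cartan vector is determined by its parameters. *)
Lemma inH_surj u : inH M c' (Phi r0) u -> exists2 u', inH M c r0 u' & 'd Phi r0 u' = u.
Proof.
move=> Hu; have [p Ep] := Ssurj Smap_inj (vpart c' (Phi r0) u, lev M (rsubmx u)).
exists (Hvec p); first exact: inH_Hfield.
have {}Ep : Sfun p = (vpart c' (Phi r0) u, lev M (rsubmx u)) by rewrite -Ep lfunE.
have E1 := congr1 fst Ep; have E2 := congr1 snd Ep; rewrite /= in E1 E2.
have Hp : inH M c' (Phi r0) ('d Phi r0 (Hvec p)) by apply: contact_dPhi; exact: inH_Hfield.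
have Hd := inH_lin (-1) Hu Hp.
suff : -1 *: u + 'd Phi r0 (Hvec p) = 0.
  by rewrite scaleN1r addrC => /eqP; rewrite subr_eq0 => /eqP.
apply: (inH_eq0 Ac' cim_Phi Hd); first by rewrite vpart_lin E1 scaleN1r addNr.
set u' := 'd Phi r0 _ in E2 *.
have -> : rsubmx (-1 *: u + u') = -1 *: rsubmx u + rsubmx u' by exact: linearP.
by rewrite lev_linear E2 scaleN1r addNr.
Qed.

End AtPoint.
End AtJet.

Lemma HD_trivial : (forall w : W, w = 0) -> forall k (C : HD k), C = 0.
Proof.
move=> W0; elim=> [|k IH] C; first by apply: val_inj; exact: etrans (W0 _) (esym (W0 _)).
by apply: hcontract0_eq0 => v; exact: IH.
Qed.

Lemma at_lev0 k l : at_lev (0 : HD k) l = 0.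
Proof. by have := at_lev_linear l (-1) (0 : HD k) 0; rewrite scaler0 addr0 scaleN1r addNr. Qed.

Lemma vert0 M k : vert M (0 : HD k) = 0.
Proof.
rewrite /vert -[RHS]row_mx0; congr row_mx; apply: lev_inj => l lM.
by rewrite lev_mkjet // linear0 at_lev0.
Qed.

(** * The case dim V_1 = 1 *)

Section Goursat.
Hypothesis n1 : n = 1%N.

Lemma line_multiple (a b : subvs_of V1) : a != 0 -> exists t, b = t *: a.
Proof.
move=> a0; have E : <[a]>%VS = fullv.
  by apply/eqP; rewrite -(geq_leqif (dimv_leqif_eq (subvf _))) n1 dim_vline a0.
by have := memvf b; rewrite -E => /vlineP.
Qed.

Lemma line_bracket (a b : subvs_of V1) : lie_bracket (vsval a) (vsval b) = 0.
Proof.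
have [->|b0] := eqVneq b 0.
  rewrite lie_bracketC; have -> : vsval (0 : subvs_of V1) = 0 *: 0 by rewrite scaler0 linear0.
  by rewrite lie_bracketZ scale0r oppr0.
have [t ->] := line_multiple a b0.
have -> : vsval (t *: b) = t *: vsval b by exact: linearZ.
by rewrite lie_bracketZ /lie_bracket subrr scaler0.
Qed.

Lemma line_hcontract_inj k (a : subvs_of V1) (A : HD k.+1) : a != 0 -> hcontract W k a A = 0 -> A = 0.
Proof.
move=> a0 H; apply: hcontract0_eq0 => b; have [t ->] := line_multiple b a0.
by rewrite hcontractZl H scaler0.
Qed.

Lemma line_hcontractC k (a b : subvs_of V1) (A : HD k.+2) :
  hcontract W k a (hcontract W k.+1 b A) = hcontract W k b (hcontract W k.+1 a A).
Proof.
have [->|b0] := eqVneq b 0; first by rewrite !hcontract0l linear0.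
have [t ->] := line_multiple a b0.
by rewrite !hcontractZl; symmetry; exact: linearZ.
Qed.

Variables (m1 : nat).
Local Notation m := m1.+1.
Local Notation M := m1.+2.
Variables (F F' : jet V1 W M -> jet V1 W M).
Hypotheses (sF : smooth_map (jatlas M) (jatlas M) F)
  (sF' : smooth_map (jatlas M) (jatlas M) F')
  (FK : cancel F F') (ctF : contact F).
Variables (c c' : chart R G d).
Hypotheses (Ac : atlas c) (Ac' : atlas c').
Local Notation Phi := (locrep F c c').

(** By surjectivity E is a contraction of some C0, so [vert M E] is the commutator of two Cartan
    fields. On a line brackets vanish and contractions commute, so the relation for the commutator
    is just the contact equation below level [m], with V_1 part -dl. *)
Lemma vert_below_contact x (E : HD m) : cdom c x.1 -> cdom c' (F x).1 ->
  let r0 := cmap (jchart M c) x in inH m c' (Phi r0) ('d Phi r0 (vert M E)).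
Proof.
move=> cx cFx r0.
have [w0 w00] : exists w0 : subvs_of V1, w0 != 0.
  apply: contrapT => H; have : (fullv <= (0 : {vspace subvs_of V1}))%VS.
    apply/subvP => z _; rewrite memv0; apply: contraT => z0; exfalso; apply: H; by exists z.
  by move=> /dimvS; rewrite n1 dimv0.
have [C0 EC] := hcontract_surj w00 E.
have := Hfield_commutator sF Ac Ac' cx cFx w0 (fun _ => 0) C0 (leqnn M)
  (near_contact sF ctF Ac Ac' cx cFx).
have -> : row_mx 0 (mkjet M (fun l => if (l < M)%N then hcontract W l w0 (at_lev C0 l.+1) else 0))
    = vert M E.
  rewrite /vert; congr row_mx; apply: eq_mkjet => l; rewrite ltnS leq_eqVlt => /orP[/eqP ->|lM].
    by rewrite ltnn at_lev_neq // => /n_Sn.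
  rewrite lM; have [->|/eqP lm] := eqVneq l m; first by rewrite !at_lev_same EC.
  rewrite !at_lev_neq ?linear0 //; first by move=> ml; apply: lm.
  by move=> [] ml; apply: lm.
rewrite -/r0 => -[dl [H1 H2]].
have cP := cim_Phi Ac cx cFx; have [cP' _] := cinvP (atlas_chart Ac') cP.
have HC := contact_dPhi sF ctF Ac Ac' cx cFx (inH_vert c r0 C0 (leqnn M)).
have HU := contact_dPhi sF ctF Ac Ac' cx cFx (inH_Hfield c w0 (fun _ => 0) r0 (leqnn M)).
move: HC HU H1 H2; rewrite -/r0.
move: ('d Phi r0 (vert M C0)) ('d Phi r0 (Hfield M c w0 _ r0)) ('d Phi r0 (vert M E)) => dC dU dE.
move=> [v [Ev1 Ev2]] [w [Ew1 Ew2]].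
rewrite (vpartP Ac' cP Ev1) (vpartP Ac' cP Ew1) line_bracket addr0 => H1 H2.
exists (- dl); split.
  rewrite -(linv_field_coord (lsubmx dE) Ac' cP').
  have -> : vsval (- dl) = - vsval dl by exact: linearN.
  by congr linv_field; apply/eqP; rewrite -addr_eq0; apply/eqP.
move=> l lm; have lM : (l < M)%N by exact: ltnW.
have := H2 l lM; rewrite Ev2 // Ew2 // line_hcontractC subrr addr0 hcontractNl => /eqP.
by rewrite addr_eq0 => /eqP.
Qed.

Lemma below_contact x u : cdom c x.1 -> cdom c' (F x).1 ->
  let r0 := cmap (jchart M c) x in inH m c r0 u -> inH m c' (Phi r0) ('d Phi r0 u).
Proof.
move=> cx cFx r0 [w [E1 E2]].
(* The defect of [u] in the contact equation at level [m], the only one left out of the larger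
   distribution; subtracting [vert M E] leaves a Cartan vector. *)
pose E : HD m := lev m (rsubmx u) - hcontract W m w (lev M (rsubmx r0)).
have Eu : u = 1 *: Hfield M c w (fun l => lev l (rsubmx u)) r0 + vert M E.
  rewrite scale1r /Hfield /vert add_row_mx addr0 -E1 -[LHS]hsubmxK; congr row_mx.
  apply: lev_inj => l; rewrite ltnS leq_eqVlt linearD /= => /orP[/eqP ->|lM].
    rewrite !lev_mkjet // ltnn at_lev_neq ?addr0 //; exact: n_Sn.
  have lM1 : (l < M.+1)%N by exact: ltnW.
  rewrite !(lev_mkjet _ lM1) lM; have [->|/eqP lm] := eqVneq l m.
    by rewrite at_lev_same /E addrC subrK.
  rewrite at_lev_neq ?addr0; last by move=> ml; apply: lm.
  by apply: E2; rewrite ltn_neqAle -ltnS lM andbT; apply/eqP.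
have H1 := contact_dPhi sF ctF Ac Ac' cx cFx
  (inH_Hfield c w (fun l => lev l (rsubmx u)) r0 (leqnn M)).
have H1' := inH_weaken (leqnSn m) H1.
have H2 := vert_below_contact E cx cFx.
have H3 := inH_lin 1 H1' H2.
have EL : 'd Phi r0 (1 *: Hfield M c w (fun l => lev l (rsubmx u)) r0 + vert M E) =
  1 *: 'd Phi r0 (Hfield M c w (fun l => lev l (rsubmx u)) r0) + 'd Phi r0 (vert M E).
  exact: linearP.
have H4 := eq_ind_r (fun z => inH m c' (Phi r0) z) H3 EL.
exact: (eq_ind_r (fun z => inH m c' (Phi r0) ('d Phi r0 z)) H4 Eu).
Qed.

Lemma near_below_contact x : cdom c x.1 -> cdom c' (F x).1 ->
  \forall r \near cmap (jchart M c) x, forall u, inH m c r u -> inH m c' (Phi r) ('d Phi r u).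
Proof.
move=> cx cFx; apply: filterS (locrep_smooth Ac Ac' sF cx cFx).1 => r [cr cFr] u.
have [[cy _] yK] := cinvP (is_chart_jet V1 W M Ac) ((cim_jet c r).2 cr).
have := @below_contact (cinv (jchart M c) r) u cy cFr.
by rewrite yK.
Qed.

(** The constant field [vert M C] commutes with the constant vertical fields at level [m]. If its
    image had a nonzero V_1 part, the commutator relation would make dPhi(vert M E) a Cartan vector
    for a nonzero E in HD^m. Then [vert M E] would be one too, which its zero V_1 part forbids. *)
Lemma vertical_preserved_line x (C : HD M) : cdom c x.1 -> cdom c' (F x).1 ->
  let r0 := cmap (jchart M c) x in vpart c' (Phi r0) ('d Phi r0 (vert M C)) = 0.
Proof.
move=> cx cFx r0; apply/eqP; apply: contraT => v0.
have C0 : C != 0.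
  apply: contraNneq v0 => ->.
  rewrite vert0.
  have -> : 'd Phi r0 0 = 0 by exact: linear0.
  by rewrite /vpart linear0 /lie_coord mul0mx linear0.
set v := vpart _ _ _ in v0.
have [HCv [Ev1 Ev2]] := contact_dPhi sF ctF Ac Ac' cx cFx (inH_vert c r0 C (leqnn M)).
have cP := cim_Phi Ac cx cFx.
have vE : v = HCv := vpartP Ac' cP Ev1.
(* Only E nonzero matters; contraction by [v] is injective on a line, so this choice provides such
   an element. *)
pose E : HD m := hcontract W m v C.
have E0 : E != 0.
  by apply: contraNneq C0 => H; apply/eqP; exact: (line_hcontract_inj v0 H).
have Hu : inH m c r0 (vert M E).
  exists 0; split; first by rewrite row_mxKl linear0 linv0.
  move=> l lm; rewrite lev_vert; last by rewrite ltnS ltnW // ltnW.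
  by rewrite hcontract0l at_lev_neq // => ml; move: lm; rewrite ml ltnn.
(* With w = 0 the field [Hfield] is constant, so [vert M E] fits the commutator relation with
   vanishing commutator. *)
have Eu := HfieldP (w := 0) (k := m) (c := c) (r := r0) (u := vert M E).
have {}Eu : vert M E = Hfield m c 0 (fun l => lev l (rsubmx (vert M E))) r0.
  apply: Eu; first by rewrite row_mxKl linear0 linv0.
  move=> l lm; rewrite lev_vert; last by rewrite ltnS ltnW // ltnW.
  by rewrite hcontract0l at_lev_neq // => ml; move: lm; rewrite ml ltnn.
have := Hfield_commutator sF Ac Ac' cx cFx 0 (fun l => lev l (rsubmx (vert M E))) C
  (leqnSn m) (near_below_contact cx cFx).
have -> : mkjet M (fun l => if (l < m)%N then hcontract W l 0 (at_lev C l.+1) else 0) = 0.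
  by apply: lev_inj => l lM; rewrite lev_mkjet // linear0; case: ifP => // _; rewrite hcontract0l.
rewrite row_mx0 -Eu -/r0 -/v => -[dl [H1 H2]].
have Z : 'd Phi r0 0 = 0 by exact: linear0.
have [dl0 _] : dl = 0 /\ True.
  split => //; apply: val_inj; move: H1.
  by rewrite Z linear0 /lie_coord mul0mx add0r line_bracket addr0.
have [w [Ew1 Ew2]] := below_contact cx cFx Hu.
have wE := vpartP Ac' cP Ew1.
(* The relation at level m - 1 says that contraction by [v] kills the defect of the image at level
   [m]; injectivity yields the missing contact equation. *)
have top : lev m (rsubmx ('d Phi r0 (vert M E))) = hcontract W m w (lev M (rsubmx (Phi r0))).
  apply/eqP; rewrite -subr_eq0; apply/eqP; apply: (line_hcontract_inj v0).
  have := H2 m1 (ltnSn m1); rewrite Z !linear0 dl0 hcontract0l !add0r wE.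
  rewrite (Ev2 m (ltnSn m)) -vE line_hcontractC linearB /= => H; exact: H.
have HM : inH M c' (Phi r0) ('d Phi r0 (vert M E)).
  exists w; split => // l; rewrite ltnS leq_eqVlt => /orP[/eqP ->|lm]; [exact: top|exact: Ew2].
have [u' [wu [Eu1 Eu2]] Eu'] := inH_surj sF sF' FK ctF Ac Ac' cx cFx HM.
have E' : u' = vert M E.
  apply/eqP; rewrite -subr_eq0; apply/eqP; apply: (dPhi_inj sF sF' FK Ac Ac' cx cFx).
  by apply: etrans (linearB _ _ _) _; rewrite Eu' subrr.
have cr := cim_r0 cx; have [cr' _] := cinvP (atlas_chart Ac) cr.
have lE : lsubmx (vert M E) = 0 by rewrite row_mxKl.
have wu0 : wu = 0.
  apply: val_inj; rewrite /= -(lie_coordK (vsval wu) Ac cr') -Eu1 E' lE.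
  by rewrite /lie_coord mul0mx ?linear0.
have := Eu2 m (ltnSn m); rewrite E' lev_vert; last by rewrite ltnS ltnW.
by rewrite at_lev_same wu0 hcontract0l => /eqP; rewrite (negbTE E0).
Qed.

End Goursat.
Lemma vertical_trivial m (F : jet V1 W m.+1 -> jet V1 W m.+1) c c' r0 (C : HD m.+1) :
  (forall w : W, w = 0) \/ n = 0%N ->
  vpart c' (locrep F c c' r0) ('d (locrep F c c') r0 (vert m.+1 C)) = 0.
Proof.
move=> [W0|n0].
  rewrite (HD_trivial W0 C) vert0.
  have -> : 'd (locrep F c c') r0 0 = 0 by exact: linear0.
  exact: vpart0.
have E : (fullv : {vspace subvs_of V1}) = 0%VS by apply/eqP; rewrite -dimv_eq0 n0.
by apply/eqP; rewrite -memv0 -E memvf.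
Qed.

Lemma vertical_preserved m (F F' : jet V1 W m.+1 -> jet V1 W m.+1) c c' x (C : HD m.+1) :
  smooth_map (jatlas m.+1) (jatlas m.+1) F -> smooth_map (jatlas m.+1) (jatlas m.+1) F' ->
  cancel F F' -> contact F -> atlas c -> atlas c' -> cdom c x.1 -> cdom c' (F x).1 ->
  (m = 0%N -> (1 < \dim {:W})%N \/
   (forall v : lie_alg G, v \in V1 -> v != 0 ->
      exists2 v' : lie_alg G, v' \in V1 & lie_bracket v v' != 0)) ->
  vpart c' (locrep F c c' (cmap (jchart m.+1 c) x))
    ('d (locrep F c c') (cmap (jchart m.+1 c) x) (vert m.+1 C)) = 0.
Proof.
move=> sF sF' FK ctF Ac Ac' cx cFx AB.
have [W0|/existsNP[w /eqP w0]] := pselect (forall w : W, w = 0).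
  by apply: vertical_trivial; left.
have [n0|n0] := posnP n; first by apply: vertical_trivial; right.
case: m F F' x C sF sF' FK ctF cx cFx AB => [|m1] F F' x C sF sF' FK ctF cx cFx AB.
  apply: etrans (esym (Smap1 F c c' x C)) _.
  apply: vertical_preserved_rank1 (AB erefl) C; first exact: (Smap_inj sF sF' FK ctF Ac Ac' cx cFx).
  move=> C' w1 B1 h; exact: (Smap_comm sF ctF Ac Ac' cx cFx B1 h).
have [n1|n1] := eqVneq n 1%N.
  exact: (vertical_preserved_line n1 sF sF' FK ctF Ac Ac' C cx cFx).
have v0 : vpick (fullv : {vspace subvs_of V1}) != 0 by rewrite vpick0 -dimv_eq0 -lt0n.
have n2 : (1 < n)%N by rewrite ltn_neqAle eq_sym n1.
(* Contraction being onto, dimensions do not decrease with the level, so both bounds pass from HD^1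
   and HD^2 to all higher levels. *)
have N1 k : (n <= \dim {:HD k.+1})%N.
  elim: k => [|k IH]; first exact: HD1_dim w0.
  exact: leq_trans IH (HD_dim_mono W k.+1 v0).
have N2 k : (n < \dim {:HD k.+2})%N.
  elim: k => [|k IH]; first exact: leq_ltn_trans (N1 0%N) (HD2_dim n2 w0).
  exact: leq_trans IH (HD_dim_mono W k.+2 v0).
apply: etrans (esym (Smap1 F c c' x C)) _.
apply: (vertical_preserved_abelian _ _ w0 (N1 m1) (N2 m1)).
  exact: (Smap_inj sF sF' FK ctF Ac Ac' cx cFx).
move=> C' w1 B1 h; exact: (Smap_comm sF ctF Ac Ac' cx cFx B1 h).
Qed.

End VerticalPreserved.

(** * Consequences of the stratification for V_1 *)

Section Stratified.
Variables (R : realType) (G : lieGroup R) (s : nat) (V : nat -> {vspace lie_alg G}).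
Hypothesis sV : stratification s V.

Lemma bracket_spaceP (U U' : {vspace lie_alg G}) u u' : u \in U -> u' \in U' ->
  lie_bracket u u' \in bracket_space U U'.
Proof.
move=> Uu Uu'.
apply: ((vspanP [set lie_bracket a b | a in [set` U] & b in [set` U']]).1 (lie_bracket u u')).
by exists u => //; exists u'.
Qed.

(** The bracket lies in V_2, which meets V_1 trivially; for s = 1 it vanishes by nilpotency. *)
Lemma strat_V1_bracket (a b dl : subvs_of (V 1%N)) :
  vsval dl + lie_bracket (vsval a) (vsval b) = 0 ->
  dl = 0 /\ lie_bracket (vsval a) (vsval b) = 0.
Proof.
have Hbr := bracket_spaceP (subvsP a) (subvsP b) => E.
suff br0 : lie_bracket (vsval a) (vsval b) = 0.
  by split => //; apply: val_inj; move: E; rewrite br0 addr0.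
have [s1|s1] := leqP s 1.
  have s1' : s = 1%N by apply/eqP; rewrite eqn_leq s1 (strat_step sV).
  by move: Hbr; rewrite (strat_nil sV) ?s1' // memv0 => /eqP.
have Hbr2 : lie_bracket (vsval a) (vsval b) \in V 2.
  by have <- := @strat_gen _ _ _ _ sV 1%N s1.
have s0 : (0 < s)%N by exact: ltnW.
have /directv_sumP/(_ (Ordinal s1) isT) D := strat_direct sV.
apply/eqP; rewrite -memv0 -D memv_cap; apply/andP; split; first exact: Hbr2.
have -> : lie_bracket (vsval a) (vsval b) = - vsval dl.
  by apply/eqP; rewrite -addr_eq0 addrC E.
rewrite memvN; apply: (subvP (sumv_sup (Ordinal s0) _ (subvv (V 1%N)))) => //; exact: subvsP.
Qed.

(** If V_1 = 0, each V_{j+1} = [V_1, V_j] vanishes as well, against V_s nonzero. *)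
Lemma strat_V1_neq0 : exists v : subvs_of (V 1%N), v != 0.
Proof.
apply: contrapT => H.
have V10 : V 1%N = 0%VS.
  apply/eqP; rewrite -subv0; apply/subvP => v Vv; rewrite memv0; apply: contraT => v0.
  exfalso; apply: H; exists (Subvs Vv); apply: contra v0 => /eqP/(congr1 vsval) /= E.
  by apply/eqP; exact: E.
have Vj j : (j.+1 <= s)%N -> V j.+1 = 0%VS.
  case: j => [//|j] js; rewrite -(strat_gen sV (j := j.+1)) //.
  apply/eqP; rewrite -subv0; apply: (vspanP _).2 => _ [u /= Vu [u' _ <-]].
  move: Vu; rewrite V10 memv0 => /eqP ->.
  have -> : lie_bracket 0 u' = 0.
    by have := lie_bracketZ 0 (0 : lie_alg G) u'; rewrite !scale0r.
  exact: mem0v.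
have := strat_last sV; have := strat_step sV.
by case: s Vj => // k Vj _; rewrite Vj ?eqxx.
Qed.

End Stratified.

(** * Descent to the lower jet space *)

Section Truncation.
Variables (R : realType) (G : lieGroup R) (V1 : {vspace lie_alg G}) (W : vectType R) (m : nat).
Local Notation d := (lie_dim G).
Local Notation atlas := (lie_atlas G).
Local Notation HD k := (HD V1 W k).
Local Notation N k := (HDle_dim V1 W k).
Local Notation M := m.+1.

Lemma HDle_ext k (A A' : HDle V1 W k) : (forall l, (l < k.+1)%N ->
  lev l (cmap (HDle_chart V1 W k) A) = lev l (cmap (HDle_chart V1 W k) A')) -> A = A'.
Proof.
move=> H; apply: functional_extensionality_dep => i.
by rewrite -(lev_chart A i) -(lev_chart A' i); exact: H.
Qed.

Lemma HDle_chartK k (r : 'rV[R]_(N k)) : cmap (HDle_chart V1 W k) (cinv (HDle_chart V1 W k) r) = r.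
Proof. by rewrite /= -[RHS]submxrowK; apply: eq_mxrow => i; rewrite vpointK. Qed.

Lemma lev_trunc (A : HDle V1 W M) l : (l < M)%N ->
  lev l (cmap (HDle_chart V1 W m) (fun k => A (widen_ord (leqnSn M) k))) =
  lev l (cmap (HDle_chart V1 W M) A).
Proof.
move=> lM.
have E1 := lev_chart (fun k : 'I_m.+1 => A (widen_ord (leqnSn M) k)) (Ordinal lM).
have E2 := lev_chart A (widen_ord (leqnSn M) (Ordinal lM)).
exact: etrans E1 (esym E2).
Qed.

Definition jcons (x : jet V1 W m) (C : HD M) : jet V1 W M :=
  (x.1, fun k : 'I_M.+1 => (fun l : nat =>
     if (l < M)%N then lev l (cmap (HDle_chart V1 W m) x.2) else at_lev C l) k).

Lemma lev_jcons x C l : (l < M.+1)%N -> lev l (cmap (HDle_chart V1 W M) (jcons x C).2) =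
  if (l < M)%N then lev l (cmap (HDle_chart V1 W m) x.2) else at_lev C l.
Proof.
exact: (@lev_mkjet R G V1 W M (fun l => if (l < M)%N
  then lev l (cmap (HDle_chart V1 W m) x.2) else at_lev C l)).
Qed.

Lemma jcons_proj x C : jet_proj (jcons x C) = x.
Proof.
case: x => p A; rewrite /jet_proj /=; congr pair; apply: HDle_ext => l lM.
apply: etrans (lev_trunc (jcons (p, A) C).2 lM) _.
by rewrite lev_jcons ?lM // ltnS ltnW.
Qed.

Definition trunc (r : 'rV[R]_(d + N M)) : 'rV[R]_(d + N m) :=
  row_mx (lsubmx r) (mkjet m (fun l => lev l (rsubmx r))).

Lemma trunc_lin : linear trunc.
Proof.
move=> a u u'; rewrite /trunc [X in _ = X + _]scale_row_mx [RHS]add_row_mx; congr row_mx.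
  exact: linearP.
rewrite -mkjet_lin; apply: eq_mkjet => l lM.
have -> : rsubmx (a *: u + u') = a *: rsubmx u + rsubmx u' by exact: linearP.
exact: lev_linear.
Qed.

HB.instance Definition _ := GRing.isLinear.Build R 'rV[R]_(d + N M) 'rV[R]_(d + N m) _
  trunc trunc_lin.

Lemma trunc_proj c (x : jet V1 W M) :
  cmap (jet_chart V1 W m c) (jet_proj x) = trunc (cmap (jet_chart V1 W M c) x).
Proof.
rewrite /trunc /= row_mxKl row_mxKr; congr row_mx; apply: lev_inj => l lM.
by rewrite lev_mkjet //; exact: lev_trunc.
Qed.

Lemma lsubmx_trunc r : lsubmx (trunc r) = lsubmx r.
Proof. exact: row_mxKl. Qed.

Lemma lev_truncr r l : (l < M)%N -> lev l (rsubmx (trunc r)) = lev l (rsubmx r).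
Proof.
by move=> lM; apply: etrans (congr1 (fun z => lev l z) (row_mxKr _ _)) _; exact: lev_mkjet.
Qed.

Lemma trunc_inH c r u : inH M c r u -> inH m c (trunc r) (trunc u).
Proof.
move=> [v [E1 E2]]; exists v; split.
  apply: etrans (lsubmx_trunc u) (etrans E1 _).
  exact: (congr1 (fun z => linv_field c (vsval v) (cinv c z)) (esym (lsubmx_trunc r))).
move=> l lm; apply: etrans (lev_truncr u (ltnW lm)) (etrans (E2 l (ltnW lm)) _).
exact: (congr1 (fun z => hcontract W l v z) (esym (@lev_truncr r l.+1 lm))).
Qed.

(** Linear part of the section [jcons x C] of the projection, which in charts is r |-> lift0 r +
    vert M C. *)
Definition lift0 (r : 'rV[R]_(d + N m)) : 'rV[R]_(d + N M) :=
  row_mx (lsubmx r) (mkjet M (fun l => if (l < M)%N then lev l (rsubmx r) else 0)).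

Lemma lift0_lin : linear lift0.
Proof.
move=> a u u'; rewrite /lift0 [X in _ = X + _]scale_row_mx [RHS]add_row_mx; congr row_mx.
  exact: linearP.
rewrite -mkjet_lin; apply: eq_mkjet => l lM.
have -> : rsubmx (a *: u + u') = a *: rsubmx u + rsubmx u' by exact: linearP.
by case: ifP => _; [exact: lev_linear|rewrite scaler0 addr0].
Qed.

HB.instance Definition _ := GRing.isLinear.Build R 'rV[R]_(d + N m) 'rV[R]_(d + N M) _
  lift0 lift0_lin.

Lemma lev_lift r (C : HD M) l : (l < M.+1)%N -> lev l (rsubmx (lift0 r + vert M C)) =
  if (l < M)%N then lev l (rsubmx r) else at_lev C l.
Proof.
move=> lM; rewrite linearD [lev _ _]linearD /= lev_vert // row_mxKr lev_mkjet //.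
case: ifP => lm; last by rewrite add0r.
by rewrite at_lev_neq ?addr0 // => E; move: lm; rewrite E ltnn.
Qed.

Lemma lsubmx_lift r (C : HD M) : lsubmx (lift0 r + vert M C) = lsubmx r.
Proof. by rewrite linearD /= !row_mxKl addr0. Qed.

Lemma jcons_chart c x C :
  cmap (jet_chart V1 W M c) (jcons x C) = lift0 (cmap (jet_chart V1 W m c) x) + vert M C.
Proof.
rewrite -[RHS]hsubmxK lsubmx_lift /= row_mxKl; congr row_mx; apply: lev_inj => l lM.
apply: etrans (lev_jcons _ _ lM) _; by rewrite lev_lift // row_mxKr.
Qed.

Lemma jcons_cinv c r C :
  jcons (cinv (jet_chart V1 W m c) r) C = cinv (jet_chart V1 W M c) (lift0 r + vert M C).
Proof.
rewrite /jcons; congr pair; first by rewrite lsubmx_lift.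
apply: HDle_ext => l lM.
apply: etrans (lev_jcons (cinv (jet_chart V1 W m c) r) C lM) _.
apply: etrans (esym (congr1 (fun z => lev l z) (HDle_chartK (rsubmx (lift0 r + vert M C))))).
rewrite lev_lift //; case: ifP => // _; congr lev; exact: HDle_chartK.
Qed.

(** Lifting [u] adds one contact equation, at level [m], and it involves the top component of the
    base jet only; [C] is chosen to satisfy it. The top component of the lifted vector is free and
    set to 0. *)
Lemma inH_lift c r (C : HD M) v u : lsubmx u = linv_field c (vsval v) (cinv c (lsubmx r)) ->
  (forall l, (l < m)%N -> lev l (rsubmx u) = hcontract W l v (lev l.+1 (rsubmx r))) ->
  hcontract W m v C = lev m (rsubmx u) -> inH M c (lift0 r + vert M C) (lift0 u).
Proof.
move=> E1 E2 EC; exists v; split; first by rewrite lsubmx_lift row_mxKl.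
move=> l lM; rewrite row_mxKr lev_mkjet ?lM; last exact: ltnW.
rewrite lev_lift //; move: lM; rewrite ltnS leq_eqVlt => /orP[/eqP ->|lm].
  by rewrite ltnn at_lev_same.
by rewrite ltnS lm E2.
Qed.

End Truncation.

Section Descent.
Variables (R : realType) (G : lieGroup R) (V1 : {vspace lie_alg G}) (W : vectType R) (m : nat).
Local Notation d := (lie_dim G).
Local Notation atlas := (lie_atlas G).
Local Notation HD k := (HD V1 W k).
Local Notation N k := (HDle_dim V1 W k).
Local Notation jchart m c := (jet_chart V1 W m c).
Local Notation jatlas m := (@jet_atlas R G V1 W m).
Local Notation M := m.+1.

Variables (F F' : jet V1 W M -> jet V1 W M) (v1 : subvs_of V1).
Hypotheses (sF : smooth_map (jatlas M) (jatlas M) F)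
  (sF' : smooth_map (jatlas M) (jatlas M) F')
  (FK : cancel F F') (ctF : contact F) (v10 : v1 != 0).
Hypothesis F_vert : forall c c' x (C : HD M), atlas c -> atlas c' -> cdom c x.1 -> cdom c' (F x).1 ->
  vpart c' (locrep F c c' (cmap (jchart M c) x))
    ('d (locrep F c c') (cmap (jchart M c) x) (vert M C)) = 0.

Definition is_vert (u : 'rV[R]_(d + N M)) :=
  lsubmx u = 0 /\ forall l, (l < M)%N -> lev l (rsubmx u) = 0.

Lemma vert_image c c' x (C : HD M) : atlas c -> atlas c' -> cdom c x.1 -> cdom c' (F x).1 ->
  is_vert ('d (locrep F c c') (cmap (jchart M c) x) (vert M C)).
Proof.
move=> Ac Ac' cx cFx; have v0 := F_vert C Ac Ac' cx cFx.
have [v [E1 E2]] := contact_dPhi sF ctF Ac Ac' cx cFx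
  (inH_vert c (cmap (jchart M c) x) C (leqnn M)).
have E := vpartP Ac' (cim_Phi Ac cx cFx) E1.
have {E v0} v0 : v = 0 by exact: etrans (esym E) v0.
split; first by rewrite E1 v0 linear0 linv0.
by move=> l lM; rewrite E2 // v0 hcontract0l.
Qed.

(** The whole line r0 + t vert M C stays in the source chart, which does not restrict the fibre, and
    the derivative vanishes at every t. The target chart is chosen anew at each t, which is why
    [Psi] is a global function with local expressions [h]. *)
Lemma const_along (Psi : jet V1 W M -> R) :
  (forall z c', atlas c' -> cdom c' z.1 -> exists h : 'rV[R]_(d + N M) -> R^o,
    [/\ forall z', cdom c' z'.1 -> Psi z' = h (cmap (jchart M c') z'),
        differentiable h (cmap (jchart M c') z) &
        forall u, is_vert u -> 'd h (cmap (jchart M c') z) u = 0]) ->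
  forall c x (C : HD M), atlas c -> cdom c x.1 ->
  Psi (F (cinv (jchart M c) (cmap (jchart M c) x + vert M C))) = Psi (F x).
Proof.
move=> H c x C Ac cx; set r0 := cmap (jchart M c) x.
pose K : 'rV[R]_(d + N M) -> R^o := fun r => Psi (F (cinv (jchart M c) r)).
have D (s : R) : is_derive s (1 : R) (fun t : R => K (r0 + t *: vert M C)) 0.
  set rs := r0 + s *: vert M C.
  have ls : lsubmx rs = lsubmx r0.
    have lE : lsubmx (vert M C) = 0 by exact: row_mxKl.
    have E0 : lsubmx (s *: vert M C + r0) = s *: lsubmx (vert M C) + lsubmx r0 by exact: linearP.
    by rewrite /rs addrC E0 lE scaler0 add0r.
  have crs : cim c (lsubmx rs).
    by rewrite ls; apply/(cim_jet (m := M)); apply: cim_cmap; split.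
  have [[cxs _] Ers] := cinvP (is_chart_jet V1 W M Ac) ((cim_jet c rs).2 crs).
  set xs := cinv (jchart M c) rs in cxs Ers.
  have [c' [Ac' cF]] := chart_at (F xs).1.
  have [h [Eh dh h0]] := H (F xs) c' Ac' cF.
  have [nP sP] := locrep_smooth Ac Ac' sF cxs cF.
  have Vi := vert_image C Ac Ac' cxs cF.
  move: nP sP Vi; rewrite Ers => nP sP Vi.
  have dP := smooth_row_differentiable sP.
  have nE : {near rs, h \o locrep F c c' =1 K}.
    by apply: filterS nP => r [_ cF']; rewrite /K Eh.
  have dhP : differentiable (h \o locrep F c c') rs by exact: differentiable_comp dP dh.
  have [dK EK] := near_eq_diff nE dhP.
  have E0 : 'd K rs (vert M C) = 0.
    apply: etrans (congr1 (fun f => f (vert M C)) EK) _.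
    apply: etrans (congr1 (fun f => f (vert M C)) (diff_comp dP dh)) _.
    exact: h0 Vi.
  exact: (eq_ind _ (fun z => is_derive s (1 : R) (fun t : R => K (r0 + t *: vert M C)) z)
    (is_derive_line dK) _ E0).
have E := is_derive_0_is_cst 1 0 D; rewrite /= in E.
rewrite scale1r scale0r addr0 in E; apply: etrans E _.
by rewrite /K cmapK //; exact: is_chart_jet.
Qed.

(** The jet components are tested by linear functionals, the fibre being a vector space; the group
    component, whose path may leave any chart, by global smooth functions separating points. *)
Lemma proj_along c x (C : HD M) : atlas c -> cdom c x.1 ->
  jet_proj (F (cinv (jchart M c) (cmap (jchart M c) x + vert M C))) = jet_proj (F x).
Proof.
move=> Ac cx; set y := cinv _ _; rewrite /jet_proj; congr pair.
  apply: contrapT => neq; have [g [sg gneq]] := smooth_functions_separate neq.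
  apply: gneq; apply: (@const_along (fun z => g z.1) _ c x C Ac cx) => z c' Ac' cz.
  exists ((g \o cinv c') \o lsubmx); split.
  - by move=> z' cz'; rewrite /= row_mxKl (cmapK (atlas_chart Ac') cz').
  - apply: differentiable_comp; first exact: differentiable_lin.
    by rewrite /= row_mxKl; exact: smooth_at_differentiable (sg z.1 c' Ac' cz).
  move=> u [u0 _].
  have dl : differentiable (lsubmx : 'rV[R]_(d + N M) -> 'rV[R]_d) (cmap (jchart M c') z).
    exact: differentiable_lin.
  have dg : differentiable (g \o cinv c' : _ -> R^o) (lsubmx (cmap (jchart M c') z)).
    by rewrite /= row_mxKl; exact: smooth_at_differentiable (sg z.1 c' Ac' cz).
  apply: etrans (congr1 (fun f => f u) (diff_comp dl dg)) _.
  apply: etrans (congr1 ('d (g \o cinv c' : _ -> R^o) (lsubmx (cmap (jchart M c') z)))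
    (etrans (congr1 (fun f => f u) (diff_linear _ _)) u0)) _.
  exact: linear0.
apply: functional_extensionality_dep => k; apply: hom_sep_eq => mu.
apply: (@const_along (fun z => mu (z.2 (widen_ord (leqnSn M) k))) _ c x C Ac cx) => z c' Ac' cz.
pose L : 'rV[R]_(d + N M) -> R^o := fun r => mu (lev k (rsubmx r)).
have L_lin : linear L.
  move=> a r r'; rewrite /L.
  have -> : rsubmx (a *: r + r') = a *: rsubmx r + rsubmx r' by exact: linearP.
  by rewrite lev_linear; exact: linearP.
pose HL := GRing.isLinear.Build R 'rV[R]_(d + N M) R^o _ L L_lin.
pose LL : {linear 'rV[R]_(d + N M) -> R^o} := HB.pack L HL.
exists L; split.
- move=> z' _; congr (mu _); rewrite /= row_mxKr.
  exact: esym (lev_chart z'.2 (widen_ord (leqnSn M) k)).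
- exact: (differentiable_lin LL).
move=> u [_ u0]; apply: etrans (congr1 (fun f => f u) (diff_linear LL _)) _.
by rewrite /= /L u0 ?linear0.
Qed.

Definition descend_map (x : jet V1 W m) : jet V1 W m := jet_proj (F (jcons x 0)).

Lemma descend_mapE x (C : HD M) : descend_map x = jet_proj (F (jcons x C)).
Proof.
have [c [Ac cx]] := chart_at x.1.
have := @proj_along c (jcons x 0) C Ac cx.
rewrite jcons_chart vert0 addr0 -jcons_chart => E.
apply: etrans (esym E) _; congr (jet_proj (F _)).
by apply: cmapK; [exact: is_chart_jet|split].
Qed.

Lemma descend_prolongs : prolongs descend_map F.
Proof.
apply/funext => x /=.
have [c [Ac cx]] := chart_at x.1.
have E : jcons (jet_proj x) (x.2 ord_max) = x.
  case: x cx => p A cx; rewrite /jcons /jet_proj /=; congr pair; apply: HDle_ext => l lM.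
  apply: etrans (lev_jcons (jet_proj (p, A)) (A ord_max) lM) _.
  move: lM; rewrite ltnS leq_eqVlt => /orP[/eqP ->|lM].
    by rewrite ltnn at_lev_same; exact: esym (lev_chart A ord_max).
  by rewrite lM; exact: lev_trunc.
by rewrite (descend_mapE _ (x.2 ord_max)) E.
Qed.

Lemma locrep_descend c c' (C : HD M) : locrep descend_map c c' =
  (@trunc R G V1 W m) \o (locrep F c c' \o (fun r => lift0 r + vert M C)).
Proof.
apply/funext => r.
apply: etrans (congr1 (fun z => cmap (jchart m c') z) (descend_mapE (cinv (jchart m c) r) C)) _.
by rewrite jcons_cinv; exact: trunc_proj.
Qed.

Lemma lift_smooth (C : HD M) r : smooth_row (fun r => @lift0 R G V1 W m r + vert M C) r.
Proof.
move=> j; apply: near_eq_smooth_at (smooth_atD (smooth_row_lin (@lift0 R G V1 W m) r j)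
  (smooth_row_cst (vert M C) r j)).
by near=> y; rewrite [RHS]mxE.
Unshelve. all: by end_near. Qed.

Lemma lift_chart c c' r (C : HD M) : atlas c -> atlas c' -> cim c (lsubmx r) ->
  cdom c' (descend_map (cinv (jchart m c) r)).1 ->
  let x := jcons (cinv (jchart m c) r) C in
  [/\ cdom c x.1, cdom c' (F x).1 & cmap (jchart M c) x = lift0 r + vert M C].
Proof.
move=> Ac Ac' cr; rewrite (descend_mapE _ C) => cF x.
have [[cx _] E] := cinvP (is_chart_jet V1 W m Ac) ((cim_jet c r).2 cr).
split => //; by rewrite /x jcons_chart E.
Qed.

Lemma descend_smooth : smooth_map (jatlas m) (jatlas m) descend_map.
Proof.
move=> _ _ [c Ac <-] [c' Ac' <-] /=; set D := [set r | _].
have DP r : D r -> cim c (lsubmx r) /\ cdom c' (descend_map (cinv (jchart m c) r)).1.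
  by move=> [/(cim_jet c) cr [cF _]].
have oD : open D.
  rewrite openE => r /DP[cr cF].
  have [cx cFx E] := lift_chart 0 Ac Ac' cr cF.
  have [nP _] := locrep_smooth Ac Ac' sF cx cFx; rewrite E in nP.
  have H : \forall s \near r, cim c (lsubmx (lift0 s + vert M (0 : HD M))) /\
    cdom c' (F (cinv (jchart M c) (lift0 s + vert M (0 : HD M)))).1.
    exact: smooth_row_continuous (lift_smooth 0 r) _ nP.
  have H' : nbhs r D; last exact: H'.
  apply: filterS H => s [cs cFs]; split.
    by apply/(cim_jet c); move: cs; rewrite lsubmx_lift.
  exact: (conj (eq_ind_r (fun z => cdom c' (jet_proj (F z)).1) cFs (jcons_cinv c s 0)) I).
split => //; apply/(smooth_onP _ oD) => r /DP[cr cF].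
have [cx cFx E] := lift_chart 0 Ac Ac' cr cF.
have [_ sP] := locrep_smooth Ac Ac' sF cx cFx; rewrite E in sP.
have sP' := @smooth_row_comp R 'rV[R]_(d + N m) (d + N M) (d + N M) (locrep F c c')
  (fun s => lift0 s + vert M (0 : HD M)) r sP (lift_smooth 0 r).
have sT := @smooth_row_comp R 'rV[R]_(d + N m) (d + N M) (d + N m) (@trunc R G V1 W m)
  (locrep F c c' \o (fun s => lift0 s + vert M (0 : HD M))) r
  (smooth_row_lin (@trunc R G V1 W m) _) sP'.
exact: (eq_ind_r (fun f => smooth_row f r) sT (locrep_descend c c' 0)).
Qed.

Lemma diff_descend c c' r (C : HD M) u : atlas c -> atlas c' -> cim c (lsubmx r) ->
  cdom c' (descend_map (cinv (jchart m c) r)).1 ->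
  'd (locrep descend_map c c') r u = trunc ('d (locrep F c c') (lift0 r + vert M C) (lift0 u)).
Proof.
move=> Ac Ac' cr cF; have [cx cFx E] := lift_chart C Ac Ac' cr cF.
have [_ sP] := locrep_smooth Ac Ac' sF cx cFx; rewrite E in sP.
have dl := smooth_row_differentiable (lift_smooth C r).
have dP := smooth_row_differentiable sP.
apply: etrans (congr1 (fun f => 'd f r u) (locrep_descend c c' C)) _.
apply: etrans (diff_lin_comp _ _ (differentiable_comp dl dP)) _.
congr trunc; apply: etrans (congr1 (fun f => f u) (diff_comp dl dP)) _.
congr ('d (locrep F c c') (lift0 r + vert M C) _).
have dI : differentiable (@lift0 R G V1 W m) r by exact: differentiable_lin.
apply: etrans (congr1 (fun f => f u) (diffD dI (differentiable_cst (vert M C) r))) _.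
have E1 : 'd (@lift0 R G V1 W m) r u = lift0 u.
  exact: (congr1 (fun f => f u) (diff_linear _ _)).
have E2 : 'd (cst (vert M C)) r u = 0 by exact: (congr1 (fun f => f u) (diff_cst _ _)).
exact: etrans (congr2 +%R E1 E2) (addr0 _).
Qed.

Lemma descend_contact : contact descend_map.
Proof.
move=> x c c' Ac Ac' cx cFx _ [u cu <-].
set r := cmap (jchart m c) x.
have Er : cinv (jchart m c) r = x by apply: cmapK; [exact: is_chart_jet|split].
have cr : cim c (lsubmx r) by apply/(cim_jet (m := m)); apply: cim_cmap; split.
have cF : cdom c' (descend_map (cinv (jchart m c) r)).1 by rewrite Er.
have Hu : inH m c r u by exact: ((cartanP _ Ac cx).1 cu).
pose T := 'd (locrep descend_map c c') r.
have nz w u' : w != 0 -> lsubmx u' = linv_field c (vsval w) (cinv c (lsubmx r)) ->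
    (forall l, (l < m)%N -> lev l (rsubmx u') = hcontract W l w (lev l.+1 (rsubmx r))) ->
    inH m c' (cmap (jchart m c') (descend_map x)) (T u').
  move=> w0 E1 E2; have [C EC] := hcontract_surj w0 (lev m (rsubmx u')).
  have [cy cFy E] := lift_chart C Ac Ac' cr cF.
  have HM := inH_lift E1 E2 EC; rewrite -E in HM.
  have HT := trunc_inH (contact_dPhi sF ctF Ac Ac' cy cFy HM).
  have ET := diff_descend C u' Ac Ac' cr cF; rewrite -E in ET.
  have EP : trunc (locrep F c c' (cmap (jchart M c) (jcons (cinv (jchart m c) r) C))) =
      cmap (jchart m c') (descend_map x).
    apply: etrans _ (congr1 (fun z => cmap (jchart m c') (descend_map z)) Er).
    apply: etrans _ (esym (congr1 (fun f => f r) (locrep_descend c c' C))).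
    by rewrite E.
  have H1 := eq_ind_r (fun z => inH m c' _ z) HT ET.
  exact: (eq_ind _ (fun z => inH m c' z (T u')) H1 _ EP).
have goal : inH m c' (cmap (jchart m c') (descend_map x)) (T u).
  have [v [E1 E2]] := Hu; have [v0|v0] := eqVneq v 0; last exact: nz v0 E1 E2.
  (* The lift requires a nonzero V_1 part. A vector with V_1 part 0 is the difference of two Cartan
     vectors with V_1 part [v1], and the target Cartan space is linear. *)
  pose u1 := Hfield m c v1 (fun=> 0) r.
  have E3 : lsubmx u1 = linv_field c (vsval v1) (cinv c (lsubmx r)) by rewrite row_mxKl.
  have E4 l : (l < m)%N -> lev l (rsubmx u1) = hcontract W l v1 (lev l.+1 (rsubmx r)).
    by move=> lm; rewrite lev_Hfield ?lm // ltnS ltnW.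
  have H1 := nz v1 u1 v10 E3 E4.
  have H2 : inH m c' (cmap (jchart m c') (descend_map x)) (T (u1 + u)).
    apply: (nz v1) => //.
      by rewrite linearD /= E3 E1 v0 linear0 linv0 addr0.
    move=> l lm.
    have -> : rsubmx (u1 + u) = rsubmx u1 + rsubmx u by exact: linearD.
    have -> : lev l (rsubmx u1 + rsubmx u) = lev l (rsubmx u1) + lev l (rsubmx u) by exact: linearD.
    by rewrite E4 // E2 // v0 hcontract0l addr0.
  have E5 : -1 *: T u1 + T (u1 + u) = T u.
    apply: etrans (congr1 (fun z => -1 *: T u1 + z) (linearD _ _ _)) _.
    by rewrite scaleN1r addKr.
  exact: (eq_ind _ (fun z => inH m c' _ z) (inH_lin (-1) H1 H2) _ E5).
exact: ((cartanP _ Ac' cFx).2 goal).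
Qed.

End Descent.

(** * Inverse maps, descent by one level, and iteration *)

Section Conclusion.
Variables (R : realType) (G : lieGroup R) (V1 : {vspace lie_alg G}) (W : vectType R).
Local Notation d := (lie_dim G).
Local Notation atlas := (lie_atlas G).
Local Notation jchart m c := (jet_chart V1 W m c).
Local Notation jatlas m := (@jet_atlas R G V1 W m).

Hypothesis hV1 : forall a b dl : subvs_of V1,
  vsval dl + lie_bracket (vsval a) (vsval b) = 0 ->
  dl = 0 /\ lie_bracket (vsval a) (vsval b) = 0.

(** By [inH_surj] a Cartan vector at F x is the image of a Cartan vector at x, and the differential
    of F' sends it back there. *)
Lemma contact_inv m (F F' : jet V1 W m.+1 -> jet V1 W m.+1) :
  smooth_map (jatlas m.+1) (jatlas m.+1) F -> smooth_map (jatlas m.+1) (jatlas m.+1) F' ->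
  cancel F F' -> cancel F' F -> contact F -> contact F'.
Proof.
move=> sF sF' FK F'K ctF y c' c Ac' Ac cy cx _ [u cu <-].
set x := F' y in cx *; have Fx : F x = y by exact: F'K.
have cFx : cdom c' (F x).1 by rewrite Fx.
have xK := cmapK (is_chart_jet V1 W m.+1 Ac) (conj cx I : cdom (jchart m.+1 c) x).
have Er : locrep F c c' (cmap (jchart m.+1 c) x) = cmap (jchart m.+1 c') y.
  exact: etrans (congr1 (fun z => cmap (jchart m.+1 c') (F z)) xK)
    (congr1 (fun z => cmap (jchart m.+1 c') z) Fx).
have Hu := (cartanP _ Ac' cy).1 cu; rewrite -Er in Hu.
have [u' Hu' Eu'] := inH_surj sF sF' FK ctF Ac Ac' cx cFx Hu.
have [nP sP] := locrep_smooth Ac Ac' sF cx cFx.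
have [_ sP'] := locrep_smooth Ac' Ac sF' cy cx; rewrite -Er in sP'.
have dP := smooth_row_differentiable sP; have dP' := smooth_row_differentiable sP'.
have nid : {near cmap (jchart m.+1 c) x, idfun =1 locrep F' c' c \o locrep F c c'}.
  apply: filterS nP => r [cr cFr].
  have K1 := cmapK (is_chart_jet V1 W m.+1 Ac')
    (conj cFr I : cdom (jchart m.+1 c') (F (cinv (jchart m.+1 c) r))).
  apply: esym; apply: etrans (congr1 (fun z => cmap (jchart m.+1 c) (F' z)) K1) _.
  apply: etrans (congr1 (fun z => cmap (jchart m.+1 c) z) (FK _)) _.
  exact: (cinvP (is_chart_jet V1 W m.+1 Ac) ((cim_jet c r).2 cr)).2.
have [_ E1] := near_eq_diff nid (differentiable_lin idfun _).
have E2 : 'd (locrep F' c' c) (locrep F c c' (cmap (jchart m.+1 c) x)) u = u'.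
  rewrite -Eu'.
  apply: etrans (esym (congr1 (fun f => f u') (diff_comp dP dP'))) _.
  apply: etrans (congr1 (fun f => f u') E1) _.
  exact: (congr1 (fun f => f u') (diff_linear idfun _)).
have E3 : tangent_map (jchart m.+1 c') (jchart m.+1 c) F' y u = u'.
  exact: etrans (congr1 (fun z => 'd (locrep F' c' c) z u) (esym Er)) E2.
exact: (eq_ind_r (fun z => cartan c x z) ((cartanP _ Ac cx).2 Hu') E3).
Qed.

Lemma descend m (F : jet V1 W m.+1 -> jet V1 W m.+1) :
  (exists v : subvs_of V1, v != 0) ->
  (m = 0%N -> (1 < \dim {:W})%N \/
   (forall v : lie_alg G, v \in V1 -> v != 0 ->
      exists2 v' : lie_alg G, v' \in V1 & lie_bracket v v' != 0)) ->
  contact_diffeo F ->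
  exists F0 : jet V1 W m -> jet V1 W m, contact_diffeo F0 /\ prolongs F0 F.
Proof.
move=> [v1 v10] AB [sF [F' [FK F'K sF']] ctF].
have ctF' := contact_inv sF sF' FK F'K ctF.
have FV c c' x C Ac Ac' cx cFx := @vertical_preserved _ _ _ W hV1 m F F' c c' x C
  sF sF' FK ctF Ac Ac' cx cFx AB.
have FV' c c' x C Ac Ac' cx cFx := @vertical_preserved _ _ _ W hV1 m F' F c c' x C
  sF' sF F'K ctF' Ac Ac' cx cFx AB.
have P := descend_prolongs sF ctF FV; have P' := descend_prolongs sF' ctF' FV'.
exists (descend_map F); split=> //; split.
- exact: (descend_smooth sF ctF FV).
- exists (descend_map F'); split.
  + move=> x; apply: etrans (esym (congr1 (fun f => f (F (jcons x 0))) P')) _.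
    by rewrite /= FK jcons_proj.
  + move=> x; apply: etrans (esym (congr1 (fun f => f (F' (jcons x 0))) P)) _.
    by rewrite /= F'K jcons_proj.
  + exact: (descend_smooth sF' ctF' FV').
- exact: (descend_contact sF ctF v10 FV).
Qed.

Lemma descend_to_first m (F : jet V1 W m.+1 -> jet V1 W m.+1) :
  (exists v : subvs_of V1, v != 0) -> contact_diffeo F ->
  exists F1 : jet V1 W 1 -> jet V1 W 1, contact_diffeo F1 /\ iterated_prolongation F1 F.
Proof.
move=> hv; elim: m F => [|m IH] F cF.
  exists F; split => //; exists (fun j => match PeanoNat.Nat.eq_dec 1 j with
    | left e => eq_rect 1%N (fun k => jet V1 W k -> jet V1 W k) F j e
    | right _ => id
    end).
  have E : (match PeanoNat.Nat.eq_dec 1 1 with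
    | left e => eq_rect 1%N (fun k => jet V1 W k -> jet V1 W k) F 1%N e
    | right _ => id
    end) = F.
    by case: PeanoNat.Nat.eq_dec => // e; rewrite (eq_irrelevance e (erefl _)).
  split => //.
    by case=> [//|[|//]] _; rewrite E.
  by case=> [//|[|//]].
have [|F0 [cF0 pF0]] := descend hv _ cF; first by [].
have [F1 [cF1 [Fs [H1 H2 H3 H4]]]] := IH F0 cF0.
(* Jets of different orders have different types, so the family given by induction is overridden at
   index m + 2 by transport of [F] along an equality of indices. *)
exists F1; split => //; pose Gs j : jet V1 W j -> jet V1 W j :=
  match PeanoNat.Nat.eq_dec m.+2 j with
  | left e => eq_rect m.+2 (fun k => jet V1 W k -> jet V1 W k) F j e
  | right _ => Fs j
  end.
have GE : Gs m.+2 = F.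
  by rewrite /Gs; case: PeanoNat.Nat.eq_dec => // e; rewrite (eq_irrelevance e (erefl _)).
have GN j : m.+2 <> j -> Gs j = Fs j by rewrite /Gs; case: PeanoNat.Nat.eq_dec.
have jN j : (j <= m.+1)%N -> m.+2 <> j by move=> + E; rewrite -E ltnn.
exists Gs; split.
- move=> j /andP[j1]; rewrite leq_eqVlt => /orP[/eqP ->|jm]; first by rewrite GE.
  by rewrite (GN _ (jN _ jm)); apply: H1; rewrite j1.
- exact: etrans (GN 1%N (jN 1%N isT)) H2.
- exact: GE.
move=> j /andP[j1]; rewrite ltnS leq_eqVlt => /orP[/eqP ->|jm].
  by rewrite GE (GN _ (jN _ (leqnn _))) H3.
by rewrite (GN _ (jN _ (ltnW jm))) (GN _ (jN _ jm)); apply: H4; rewrite j1.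
Qed.

End Conclusion.

Theorem theorem1p2 (R : realType) (G : lieGroup R) (s : nat)
    (V : nat -> {vspace lie_alg G}) (hG : carnot_group s V) (W : vectType R) :
  (forall (m : nat) (F : jet (V 1%N) W m -> jet (V 1%N) W m),
     (2 <= m)%N -> contact_diffeo F ->
     exists F1 : jet (V 1%N) W 1 -> jet (V 1%N) W 1,
       contact_diffeo F1 /\ iterated_prolongation F1 F) /\
  ((1 < \dim {:W})%N \/
   (forall v : lie_alg G, v \in V 1%N -> v != 0 ->
      exists2 v' : lie_alg G, v' \in V 1%N & lie_bracket v v' != 0) ->
   forall F : jet (V 1%N) W 1 -> jet (V 1%N) W 1,
     contact_diffeo F ->
     exists F0 : jet (V 1%N) W 0 -> jet (V 1%N) W 0,
       contact_diffeo F0 /\ prolongs F0 F).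
Proof.
case: hG => _ _ sV; have hV1 := strat_V1_bracket sV; have hv := strat_V1_neq0 sV; split.
  by case=> [//|m] F m2 cF; exact: (descend_to_first hV1 hv cF).
by move=> AB F cF; exact: (descend hV1 hv (fun=> AB) cF).
Qed.
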